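(* Let $\psi$ denote Dedekind's arithmetic function. For almost all positive integers $n$, \[ \frac{\psi(\psi(n))}{\psi(n)}\sim\frac{6e^\gamma}{\pi^2}\log_3 n. \]
   Context: Dedekind's arithmetic function is $\psi(n)=n\prod_{p\mid n}\left(1+\frac1p\right)$ for positive integers $n$, the product being over the distinct primes $p$ dividing $n$ (so $\psi(1)=1$). $\gamma$ denotes Euler's constant. $\log_k$ denotes the $k$-fold iterate of the natural logarithm (so $\log_3 n=\log\log\log n$), not a logarithm to base $k$. The phrase ''$f(n)\sim g(n)$ for almost all positive integers $n$'' is the usual normal-order statement: for every $\varepsilon>0$, the number of positive integers $n\le x$ for which $|f(n)-g(n)|\le\varepsilon\, g(n)$ fails (or for which $g(n)$ is undefined, which concerns only finitely many small $n$) is $o(x)$ as $x\to\infty$. *)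

(* Defs.v *)
From HB Require Import structures.
From mathcomp Require Import all_boot all_order all_algebra.
From mathcomp Require Import all_classical all_reals all_analysis.

Set Implicit Arguments.
Unset Strict Implicit.
Unset Printing Implicit Defensive.

Import Order.TTheory GRing.Theory Num.Theory.
Import numFieldNormedType.Exports.

Local Open Scope classical_set_scope.
Local Open Scope ring_scope.

(* nat-valued, so that it can be iterated; the division is exact, and
   [dedekind_psiE] gives the usual product formula. *)
Definition dedekind_psi (n : nat) : nat :=
  (n * \prod_(p <- primes n) p.+1 %/ \prod_(p <- primes n) p)%N.

Lemma dvdn_prod_primes (n : nat) : (0 < n)%N ->
  (\prod_(p <- primes n) p %| n)%N.
Proof.
move=> n0; rewrite [X in (_ %| X)%N](prod_prime_decomp n0).
rewrite prime_decompE big_map /=.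
rewrite big_seq [X in (_ %| X)%N]big_seq.
apply: (big_ind2 (fun a b => a %| b)%N) => //.
  by move=> *; exact: dvdn_mul.
move=> p; rewrite -logn_gt0.
by case: (logn p n) => // k _; rewrite expnS dvdn_mulr.
Qed.

Lemma dedekind_psiE (F : numFieldType) (n : nat) :
  (dedekind_psi n)%:R = n%:R * \prod_(p <- primes n) (1 + p%:R^-1) :> F.
Proof.
have [->|n0] := posnP n; first by rewrite /dedekind_psi mul0n div0n mul0r.
have P0 : \prod_(p <- primes n) p%:R != 0 :> F.
  rewrite prodf_seq_neq0; apply/allP => p.
  by rewrite mem_primes pnatr_eq0 -lt0n => /andP[/prime_gt0].
apply: (mulIf P0); rewrite -mulrA -big_split /= -natr_prod -natrM divnK.
  rewrite natrM natr_prod; congr (_ * _).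
  apply: eq_big_seq => p; rewrite mem_primes => /andP[/prime_gt0 p0 _].
  by rewrite mulrDl mul1r mulVf ?pnatr_eq0 -?lt0n// -natr1.
exact/dvdn_mulr/dvdn_prod_primes.
Qed.

(* [series harmonic n] is 1 + 1/2 + ... + 1/n. *)
Definition euler_gamma_seq (R : realType) (n : nat) : R :=
  series harmonic n - ln n%:R.

Definition euler_gamma (R : realType) : R := limn (euler_gamma_seq R).

Lemma is_cvg_euler_gamma_seq (R : realType) : cvgn (euler_gamma_seq R).
Proof.
have i0 (n : nat) : 0 <= n.+1%:R^-1 :> R by rewrite invr_ge0.
have stepl (n : nat) : ln n.+2%:R - ln n.+1%:R <= n.+1%:R^-1 :> R.
  rewrite -ln_div ?posrE ?ltr0n// -[n.+2%:R]natr1 mulrDl divff ?pnatr_eq0//.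
  by rewrite mul1r le_ln1Dx// (lt_le_trans _ (i0 n))// oppr_lt0 ltr01.
have stepu (n : nat) : n.+2%:R^-1 <= ln n.+2%:R - ln n.+1%:R :> R.
  rewrite -opprB lerNr -ln_div ?posrE ?ltr0n//.
  have -> : n.+1%:R / n.+2%:R = 1 + - n.+2%:R^-1 :> R.
    have n2 : n.+2%:R != 0 :> R by rewrite pnatr_eq0.
    by apply: (mulIf n2); rewrite mulrDl mulNr mulVf// divfK// mul1r -[n.+2%:R]natr1 addrK.
  by rewrite le_ln1Dx// ltrN2 invf_lt1 ?ltr0n// ltr1n.
have lb (n : nat) : ln n.+1%:R <= series harmonic n :> R.
  elim: n => [|n IH]; first by rewrite ln1 seriesEnat /= big_geq.
  by rewrite seriesSr -(subrK (ln n.+1%:R) (ln _)) addrC lerD//=; exact: stepl.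
have : cvgn [sequence euler_gamma_seq R n.+1]_n.
  apply: nonincreasing_is_cvgn.
    apply/nonincreasing_seqP => n; rewrite /euler_gamma_seq /=.
    rewrite [series _ n.+2]seriesSr lerBlDr -addrA lerD2l addrC.
    exact: stepu.
  exists 0 => _ [n _ <-]; rewrite /euler_gamma_seq /= subr_ge0.
  by rewrite (le_trans (lb n))// seriesSr lerDl; exact: i0.
by move=> /cvg_ex[l]; rewrite cvg_shiftS => ul; apply/cvg_ex; exists l.
Qed.

(* [ln] is 0 on nonpositive arguments, so [iter_ln 3 n%:R] takes a junk value
   where log log log n is undefined, namely for n = 1, 2 (which cannot affect
   an o(x) count). *)
Definition iter_ln (R : realType) (k : nat) (x : R) : R := iter k (@ln R) x.

Definition exceptional_count (R : realType) (f g : nat -> R) (e x : R) : nat :=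
  (\sum_(1 <= n < (Num.truncn x).+1 | ~~ (`|f n - g n| <= e * g n)%R) 1)%N.

Definition normal_order (R : realType) (f g : nat -> R) : Prop :=
  forall e : R, 0 < e ->
    (exceptional_count f g e x)%:R / x @[x --> +oo] --> (0 : R).

(* Main.v *)
(** Let L = log log x, and recall psi(m)/m = prod_(p | m) (1 + 1/p).

    Fix a prime p <= L^(1-e). The primes q = -1 (mod p) up to sqrt x have
    reciprocal sum about L/p, which is large, so by Turan's variance bound
    almost every n <= x has such a prime factor q, and then p | q+1 | psi(n).
    Hence psi(n) is typically divisible by all these p, up to a set of small
    reciprocal sum. Conversely p | psi(n) forces p^2 | n or q | n for some prime
    q = -1 (mod p); since the reciprocals of these q sum to O(L/p), the sum of
    1/p over the p | psi(n) with p > L^(1+e) is small on average. So for almost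
    all n the ratio psi(psi(n))/psi(n) lies, up to a factor 1 + O(e), between
    the values of prod_(p <= y) (1 + 1/p) at y = L^(1-e) and y = L^(1+e), where
    log y ~ log L ~ log_3 n; by Mertens and zeta(2) = pi^2/6 this product is
    asymptotic to (6 e^gamma/pi^2) log y.

    Uniformity in p is essential. The upper bound for primes q = -1 (mod p)
    comes from Selberg's sieve. The lower bound comes from the characters mod p,
    with all L-series truncated: L(1,chi) >> 1/p for the quadratic character by
    a Lambert series argument, while for the others a small value at chi would
    recur at its conjugate and make the product of all L(s,chi) too small. *)

Require Import Defs.
From mathcomp Require Import all_boot all_order all_algebra all_fingroup all_solvable all_field.
From mathcomp Require Import all_classical all_reals all_analysis.
From mathcomp Require Import complex zify ring lra.
Import Order.TTheory GRing.Theory Num.Theory.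
Import numFieldNormedType.Exports.
Import Normc.
Local Open Scope classical_set_scope.
Local Open Scope ring_scope.

Set Implicit Arguments.
Unset Strict Implicit.
Unset Printing Implicit Defensive.

(** * Selberg's sieve for primes in progressions *)

(** The main obstacle is that the lower bound for primes [q = -1 (mod p)] may lose only about
    [p (1 + ln p)] against [log log x], that is, [O(1 + ln p)] per character on average. A single
    character may well be very small near 1, so only the sum of the logarithms over all characters
    is controlled, and it is controlled at one point, [s = 1 + exp (- 80 p (1 + ln p))]. Bounding
    character sums by [p] makes the truncated L-sums Lipschitz in [s], uniformly in their length,
    which carries the estimate to every smaller [d]. Everything stays on the real axis, with no
    zero-free region, and the truncation length is the last parameter chosen. Euler's constant
    enters Mertens' product only through harmonic numbers: primes are grouped by the integer part of
    [ln q], the harmonic sum is subtracted, and Abel means compared with zeta near 1 show that the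
    difference tends to 0. In the final estimates the parameter is [t = log_3 N]: then
    [log log N = exp t], and the powers of [log log N] that cut off the primes are [exp ((1 - d) t)]
    and [exp ((1 + d) t)]. *)

Lemma sum_eqn_mod (d r M : nat) : (r < d)%N ->
  (\sum_(m < M) (m %% d == r) = (M + (d - r.+1)) %/ d)%N.
Proof.
move=> rd; elim: M => [|M IH]; first by rewrite big_ord0 divn_small//; lia.
rewrite big_ord_recr /= IH addSn divnS; last lia.
rewrite addnC; congr (_ + _)%N.
have -> : (M + (d - r.+1)).+1 = (M + (d - r))%N by lia.
have -> : (M %% d == r)%N = (M == r %[mod d])%N by rewrite [(r %% d)%N]modn_small.
rewrite -(eqn_modDr (d - r)%N) subnKC; last exact: ltnW.
by rewrite modnn.
Qed.

(** The numbers congruent to -1 modulo [a] are parametrised as [a * m + a.-1 = a * (m + 1) - 1].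
    Divisibility by [d] means that [m + 1] inverts [a] modulo [d]; with [u] the inverse, [u + d.-1]
    stands for [u - 1]. *)
Lemma coprime_dvdn_mod (a d : nat) : (0 < a)%N -> (0 < d)%N -> coprime a d ->
  exists2 r, (r < d)%N & forall m, (d %| a * m + a.-1)%N = (m %% d == r)%N.
Proof.
move=> a0 d0 /(coprimeP _ a0)[[u v] /= uv].
have ua : (u * a = v * d + 1)%N by lia.
exists ((u + d.-1) %% d)%N; first by rewrite ltn_mod.
move=> m.
have -> : (d %| a * m + a.-1)%N = (a * m.+1 == 1 %[mod d])%N.
  have -> : (a * m.+1 = a * m + a.-1 + 1)%N by lia.
  by rewrite -{2}[1%N]add0n eqn_modDr mod0n.
have -> : (m %% d == (u + d.-1) %% d)%N = (m.+1 == u %[mod d])%N.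
  rewrite -(eqn_modDr 1) addn1 -addnA addn1 prednK//.
  by rewrite -[in X in _ = X](modnDr u d).
apply/eqP/eqP => [h|h].
  have : (u * (a * m.+1) = u * 1 %[mod d])%N by rewrite -modnMmr h modnMmr.
  by rewrite mulnA ua mulnDl mul1n muln1 mulnAC modnMDl.
by rewrite -modnMmr h modnMmr mulnC ua modnMDl.
Qed.

Lemma prod_dvdn_all (s : seq nat) (n : nat) : uniq s -> all prime s ->
  (\prod_(q <- s) q %| n)%N = all (fun q => q %| n)%N s.
Proof.
elim: s => [|q s IH]; first by rewrite big_nil dvd1n.
move=> /= /andP[qs us] /andP[pq ps].
rewrite big_cons Gauss_dvd ?IH// big_seq.
elim/big_ind: _ => [|x y cx cy|x xs]; rewrite ?coprimen1 ?coprimeMr ?cx//.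
rewrite prime_coprime// dvdn_prime2 ?(allP ps _ xs)//.
by apply: contra qs => /eqP->.
Qed.

Section SieveAverage.
Variable R : realType.

Lemma count_dvdn (a d M : nat) : (0 < a)%N -> (0 < d)%N -> coprime a d ->
  `|\sum_(m < M) (d %| a * m + a.-1)%N%:R - M%:R / d%:R| <= 1 :> R.
Proof.
move=> a0 d0 cad; have [r rd rE] := coprime_dvdn_mod a0 d0 cad.
have -> : \sum_(m < M) (d %| a * m + a.-1)%N%:R = ((M + (d - r.+1)) %/ d)%N%:R :> R.
  by rewrite -sum_eqn_mod// natr_sum; apply: eq_bigr => m _; rewrite rE.
set c := (d - r.+1)%N; set k := (_ %/ _)%N.
have h1 : (k * d <= M + c)%N by exact: leq_divM.
have h2 : (M + c < k.+1 * d)%N by rewrite ltn_ceil.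
have cd : (c < d)%N by rewrite /c; lia.
have dR : (0 : R) < d%:R by rewrite ltr0n.
rewrite -[X in `|X - _|](mulfK (lt0r_neq0 dR)) -mulrBl normrM normfV (ger0_norm (ltW dR)).
rewrite ler_pdivrMr// mul1r -natrM ler_norml.
apply/andP; split.
  by rewrite lerNl opprB lerBlDr -natrD ler_nat; lia.
by rewrite lerBlDr -natrD ler_nat; lia.
Qed.

(** Expand the product over subsets [D]. Where the coefficient is nonzero, [D] consists of primes
    coprime to [a], so its indicators combine into divisibility by their product [dD D], of mean
    [1 / dD D] with error at most 1 by [count_dvdn]. The total error is the sum of the absolute
    coefficients, which factors again. *)
Lemma sum_prod_dvdn (a z M : nat) (F G : 'I_z.+1 -> R) : (0 < a)%N ->
  (forall q : 'I_z.+1, G q != 0 -> prime q && coprime a q) ->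
  `|\sum_(m < M) \prod_q (F q + G q * (q %| a * m + a.-1)%N%:R)
    - M%:R * \prod_q (F q + G q / q%:R)| <= \prod_q (`|F q| + `|G q|).
Proof.
move=> a0 HG.
pose coef (D : {set 'I_z.+1}) := \prod_q (if q \in D then G q else F q).
pose dD (D : {set 'I_z.+1}) : nat := (\prod_(q in D) q)%N.
have coef0 D : coef D != 0 -> forall q, q \in D -> prime q && coprime a q.
  move=> cD q qD; apply: HG; apply: contra cD => /eqP Gq.
  by rewrite /coef (bigD1 q)//= qD Gq mul0r.
have expand c : \prod_q (F q + G q * c q) = \sum_D coef D * \prod_(q in D) c q.
  under eq_bigr do rewrite addrC.
  rewrite bigA_distr; apply: eq_bigr => D _.
  rewrite (big_mkcond (fun q => q \in D)) -big_split /=; apply: eq_bigr => q _.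
  by case: ifP => _; rewrite ?mulr1.
have dDE D : dD D = (\prod_(x <- [seq nat_of_ord q | q <- enum D]) x)%N.
  by rewrite big_map big_enum.
have dDdvd D n : coef D != 0 -> \prod_(q in D) (q %| n)%N%:R = (dD D %| n)%N%:R :> R.
  move=> cD; rewrite dDE prod_dvdn_all; first last.
  - by apply/allP => x /mapP[q]; rewrite mem_enum => /(coef0 _ cD)/andP[pq _] ->.
  - by rewrite map_inj_uniq ?enum_uniq//; exact: val_inj.
  rewrite -natr_prod; congr _%:R.
  case: allP => [h|h].
    by rewrite big1// => q qD; rewrite h//; apply/mapP; exists q; rewrite ?mem_enum.
  apply/eqP; rewrite -leqn0 leqNgt; apply/negP => h'.
  apply: h => x /mapP[q]; rewrite mem_enum => qD ->.
  by move: h'; rewrite (bigD1 q)//=; case: (_ %| _)%N.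
have Dcop D : coef D != 0 -> (0 < dD D)%N && coprime a (dD D).
  move=> cD; rewrite /dD; elim/big_ind: _ => [|x y|q /(coef0 _ cD)/andP[pq ->]].
  - by rewrite coprimen1.
  - by rewrite coprimeMr muln_gt0 => /andP[-> ->] /andP[-> ->].
  - by rewrite prime_gt0.
have -> : \sum_(m < M) \prod_q (F q + G q * (q %| a * m + a.-1)%N%:R) =
    \sum_D coef D * \sum_(m < M) (dD D %| a * m + a.-1)%N%:R.
  under eq_bigr do rewrite (expand (fun q : 'I__ => (q %| _)%N%:R)).
  rewrite exchange_big /=; apply: eq_bigr => D _; rewrite mulr_sumr.
  apply: eq_bigr => m _; have [->|cD] := eqVneq (coef D) 0; first by rewrite !mul0r.
  by rewrite dDdvd.
have -> : \prod_q (F q + G q / q%:R) = \sum_D coef D * (dD D)%:R^-1.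
  rewrite (expand (fun q : 'I__ => q%:R^-1)); apply: eq_bigr => D _.
  by rewrite prodfV natr_prod.
rewrite mulr_sumr -sumrB (le_trans (ler_norm_sum _ _ _))//.
under [leRHS]eq_bigr do rewrite addrC.
rewrite bigA_distr; apply: ler_sum => D _.
rewrite mulrCA -mulrBr normrM.
have [->|cD] := eqVneq (coef D) 0.
  by rewrite normr0 mul0r; apply: prodr_ge0 => q _; case: ifP.
rewrite -[leRHS]mulr1; apply: ler_pM => //; last first.
  by have /andP[d0 cop] := Dcop _ cD; exact: count_dvdn.
rewrite /coef normr_prod; apply: ler_prod => q _.
by rewrite normr_ge0; case: ifP => /=.
Qed.

End SieveAverage.

Definition squarefree (n : nat) := all (fun q => ~~ (q ^ 2 %| n)%N) (primes n).

Lemma squarefree_prod_primes n : (0 < n)%N -> squarefree n ->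
  (\prod_(q <- primes n) q = n)%N.
Proof.
move=> n0 /allP sf; rewrite [RHS](prod_prime_decomp n0) prime_decompE big_map.
apply: eq_big_seq => q qn /=; have := sf _ qn; have := qn.
rewrite mem_primes => /and3P[pq _ _]; rewrite pfactor_dvdn//.
move: qn; rewrite -logn_gt0.
by case: (logn q n) => [|[|k]]//; rewrite expn1.
Qed.

Lemma big_ord_primes (T : Type) (idx : T) (op : Monoid.com_law idx) (z k : nat) (F : nat -> T) :
  (0 < k <= z)%N ->
  \big[op/idx]_(q < z.+1 | prime q && (q %| k)%N) F q = \big[op/idx]_(q <- primes k) F q.
Proof.
move=> /andP[k0 kz].
rewrite -(big_mkord (fun q => prime q && (q %| k)%N)) -big_filter.
apply: perm_big; apply: uniq_perm; rewrite ?filter_uniq ?iota_uniq ?primes_uniq//.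
move=> q; rewrite mem_filter mem_primes mem_index_iota k0 /=.
case: (boolP (prime q)) => //= pq; case: (boolP (q %| k)%N) => //= qk.
by rewrite ltnS (leq_trans (dvdn_leq k0 qk)).
Qed.

Lemma sqr_dvdn_squarefree n : (0 < n)%N ->
  exists k m : nat, n = (k * m ^ 2)%N /\ squarefree k.
Proof.
move=> n0; pose P m := (m ^ 2 %| n)%N.
have P1 : exists m, P m by exists 1%N; rewrite /P dvd1n.
have Pb m : P m -> (m <= n)%N.
  by move=> /(dvdn_leq n0); apply: leq_trans; case: m => // m; rewrite expnS leq_pmulr.
have [m Pm mmax] := ex_maxnP P1 Pb.
have m0 : (0 < m)%N by rewrite (leq_trans _ (mmax 1%N _))// /P dvd1n.
exists (n %/ m ^ 2)%N, m; split; first by rewrite divnK.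
apply/allP => q; rewrite mem_primes => /and3P[pq _ _]; apply/negP => qk.
have : P (q * m)%N by rewrite /P expnMn -(divnK Pm) dvdn_mul.
move=> /mmax; rewrite leqNgt => /negP; apply.
by rewrite -[X in (X < _)%N]mul1n ltn_pmul2r// prime_gt1.
Qed.

Lemma sum_multiples (V : nmodType) (F : nat -> V) a z : (0 < a)%N ->
  \sum_(1 <= n < z.+1 | (a %| n)%N) F n = \sum_(1 <= m < (z %/ a).+1) F (a * m)%N.
Proof.
move=> a0; elim: z => [|z IH]; first by rewrite div0n !big_geq.
rewrite big_mkcond big_nat_recr//= -big_mkcond/= IH divnS//.
case: ifP => az; last by rewrite addr0.
rewrite add1n [in RHS]big_nat_recr//=; congr (_ + F _).
by rewrite -[LHS](divnK az) divnS// az mulnC.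
Qed.

Section Harmonic.
Variable R : realType.

Lemma sum_inv_sqr_tail y B : (0 < y)%N ->
  \sum_(y.+1 <= n < B) n%:R ^- 2 <= y%:R^-1 :> R.
Proof.
move=> y0; have [By|yB] := leqP B y.+1; first by rewrite big_geq// invr_ge0.
suff : \sum_(y.+1 <= n < B) n%:R ^- 2 <= y%:R^-1 - B.-1%:R^-1 :> R.
  by move=> /le_trans; apply; rewrite gerBl.
case: B yB => // B; rewrite ltnS => yB /=.
rewrite big_add1 /= -[leRHS]opprB -(telescope_sumr (fun n => n%:R^-1 : R) (ltnW yB)) -sumrN.
rewrite big_nat_cond [leRHS]big_nat_cond; apply: ler_sum => n /andP[/andP[yn _] _].
have n0 : 0 < n%:R :> R by rewrite ltr0n (leq_trans y0).
rewrite opprB -natr1 -exprVn.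
have -> : n%:R^-1 - (n%:R + 1)^-1 = (n%:R * (n%:R + 1))^-1 :> R by field; lra.
by rewrite exprVn lef_pV2 ?posrE ?exprn_gt0 ?mulr_gt0//; nra.
Qed.

Lemma sum_inv_sqr_le2 z : \sum_(1 <= m < z.+1) m%:R ^- 2 <= 2 :> R.
Proof.
case: z => [|z]; first by rewrite big_geq.
by rewrite big_ltn// expr1n invr1; have := @sum_inv_sqr_tail 1 z.+2 isT; rewrite invr1; lra.
Qed.

Lemma ln_succ_sub_le n : (0 < n)%N -> ln n.+1%:R - ln n%:R <= n%:R^-1 :> R.
Proof.
move=> n0; have n1 : (0 : R) < n%:R by rewrite ltr0n.
rewrite -ln_div ?posrE ?ltr0n//.
have -> : n.+1%:R / n%:R = 1 + n%:R^-1 :> R by rewrite -natr1; field; lra.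
by rewrite le_ln1Dx// (@lt_le_trans _ _ 0)// ltrN10.
Qed.

Lemma ln_le_harmonic z : ln z.+1%:R <= \sum_(1 <= n < z.+1) n%:R^-1 :> R.
Proof.
elim: z => [|z IH]; first by rewrite ln1 big_geq.
rewrite big_nat_recr//= -[ln _](subrK (ln z.+1%:R)) addrC lerD//.
exact: ln_succ_sub_le.
Qed.

(** For prime [a] the multiples of [a] contribute [1 / a] times a shorter harmonic sum, hence at
    most half. The case [a = 1] is carried along because the sieve for it is Chebyshev's upper
    bound, needed for Mertens' theorem. *)
Lemma harmonic_coprime_ge a z : prime a \/ a = 1%N ->
  \sum_(1 <= n < z.+1) n%:R^-1 <=
    2 * \sum_(1 <= n < z.+1 | coprime a n) n%:R^-1 :> R.
Proof.
have i0 n : 0 <= n%:R^-1 :> R by rewrite invr_ge0.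
set A := \sum_(_ <= _ < _ | coprime _ _) _.
have A0 : 0 <= A by apply: sumr_ge0.
case=> [pa|a1]; last first.
  have -> : A = \sum_(1 <= n < z.+1) n%:R^-1.
    by apply: eq_bigl => n; rewrite a1 coprime1n.
  by rewrite mulr_natl mulr2n lerDl; apply: sumr_ge0.
set H := \sum_(1 <= n < z.+1) _.
have : H = A + a%:R^-1 * \sum_(1 <= m < (z %/ a).+1) m%:R^-1.
  rewrite [LHS](bigID (coprime a)) /=; congr (_ + _).
  under eq_bigl => n do rewrite prime_coprime// negbK.
  rewrite sum_multiples ?prime_gt0// mulr_sumr.
  by apply: eq_bigr => m _; rewrite natrM invfM.
have : a%:R^-1 * \sum_(1 <= m < (z %/ a).+1) m%:R^-1 <= 2^-1 * H.
  apply: ler_pM => //; first exact: sumr_ge0.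
    by rewrite lef_pV2 ?posrE ?ltr0n ?ler_nat ?prime_gt1 ?prime_gt0.
  rewrite /H (@big_cat_nat _ _ _ (z %/ a).+1 1 z.+1)//= ?ltnS ?leq_div//.
  by rewrite lerDl sumr_ge0.
by move=> ? ?; lra.
Qed.

Lemma ler_nat_term (P : pred nat) (F : nat -> R) m n k : (m <= k < n)%N -> P k ->
  (forall i, P i -> 0 <= F i) -> F k <= \sum_(m <= i < n | P i) F i.
Proof.
move=> kmn Pk F0; rewrite big_mkcond (bigD1_seq k) ?iota_uniq ?mem_index_iota//= Pk.
by rewrite lerDl sumr_ge0// => i _; case: ifP => // /F0.
Qed.

Definition squarefree_harmonic (a z : nat) : R :=
  \sum_(1 <= k < z.+1 | squarefree k && coprime a k) k%:R^-1.

(** Write each [n] as [k * m ^ 2] with [k] squarefree; the factor 2 bounds the sum of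
    [1 / m ^ 2]. *)
Lemma sum_inv_coprime_squarefree a z :
  \sum_(1 <= n < z.+1 | coprime a n) n%:R^-1 <= 2 * squarefree_harmonic a z.
Proof.
have i0 n : 0 <= n%:R^-1 :> R by rewrite invr_ge0.
rewrite mulrC (le_trans _ (ler_wpM2l (sumr_ge0 _ _) (sum_inv_sqr_le2 z)))//.
rewrite mulr_suml; under [leRHS]eq_bigr do rewrite mulr_sumr.
have E n : (0 < n < z.+1)%N -> coprime a n -> n%:R^-1 <=
    \sum_(1 <= k < z.+1 | squarefree k && coprime a k) \sum_(1 <= m < z.+1)
      ((n == k * m ^ 2)%N%:R * n%:R^-1) :> R.
  move=> /andP[n0 nz] an; have [k [m [nE sf]]] := sqr_dvdn_squarefree n0.
  have km : (0 < k <= n)%N && (0 < m <= n)%N.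
    move: n0; rewrite nE muln_gt0 expn_gt0 orbF => /andP[k0 m0].
    rewrite k0 m0 leq_pmulr ?expn_gt0 ?m0//=.
    by rewrite expnS expn1 mulnA leq_pmull// muln_gt0 k0.
  move: km => /andP[/andP[k0 kn] /andP[m0 mn]].
  have ak : coprime a k by move: an; rewrite nE coprimeMr => /andP[].
  have kz : (0 < k < z.+1)%N by rewrite k0 (leq_ltn_trans kn).
  have mz : (0 < m < z.+1)%N by rewrite m0 (leq_ltn_trans mn).
  apply: le_trans (ler_nat_term (P := fun k => squarefree k && coprime a k) kz _ _).
  - apply: le_trans (ler_nat_term (P := predT) mz _ _) => //.
    by rewrite -nE eqxx mul1r.
  - by rewrite sf ak.
  - by move=> j _; rewrite sumr_ge0// => l _; rewrite mulr_ge0.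
have {E} : \sum_(1 <= n < z.+1 | coprime a n) n%:R^-1 <=
    \sum_(1 <= n < z.+1 | coprime a n)
    \sum_(1 <= k < z.+1 | squarefree k && coprime a k) \sum_(1 <= m < z.+1)
      ((n == k * m ^ 2)%N%:R * n%:R^-1) :> R.
  by rewrite big_nat_cond [leRHS]big_nat_cond; apply: ler_sum => n /andP[]; exact: E.
move=> /le_trans; apply.
rewrite exchange_big /=; apply: ler_sum => k _.
rewrite exchange_big /=; apply: ler_sum => m _.
have c0 : 0 <= k%:R^-1 / m%:R ^+ 2 :> R by rewrite mulr_ge0// -exprVn exprn_ge0.
have [kmz|kmz] := boolP ((0 < k * m ^ 2 < z.+1)%N && coprime a (k * m ^ 2)).
  move/andP: kmz => [kmz akm].
  rewrite big_mkcond (bigD1_seq (k * m ^ 2)%N) ?iota_uniq ?mem_index_iota//=.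
  rewrite akm eqxx mul1r natrM natrX invfM big1 ?addr0// => i /negPf ->.
  by rewrite mul0r if_same.
rewrite big1_seq// => i /andP[ai]; rewrite mem_index_iota => iz.
case: eqP => [ik|]; last by rewrite mul0r.
by move: kmz; rewrite -ik iz ai.
Qed.

Lemma sum_inv_squarefree_ge a z : prime a \/ a = 1%N ->
  ln z.+1%:R / 4 <= squarefree_harmonic a z.
Proof.
move=> pa; have := harmonic_coprime_ge z pa; have := sum_inv_coprime_squarefree a z.
by have := ln_le_harmonic z; lra.
Qed.

End Harmonic.

Section SelbergSieve.
Variable R : realType.

(** A product of centred indicators: [1 / q - [q | n]] has mean 0 over [n], so products belonging to
    different squarefree [k] are uncorrelated. *)
Definition sieve_factor (z k n : nat) : R :=
  \prod_(q < z.+1 | prime q && (q %| k)%N) (q%:R^-1 - (q %| n)%N%:R).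

Lemma sieve_factor_prime z k n : (0 < k <= z)%N -> squarefree k ->
  prime n -> (z < n)%N -> sieve_factor z k n = k%:R^-1.
Proof.
move=> kz sf pn zn; rewrite /sieve_factor.
transitivity (\prod_(q < z.+1 | prime q && (q %| k)%N) q%:R^-1 : R).
  apply: eq_bigr => q /andP[pq _]; rewrite dvdn_prime2//.
  have -> : (nat_of_ord q == n) = false by apply/eqP; have := ltn_ord q; lia.
  by rewrite subr0.
rewrite (big_ord_primes _ (fun q => q%:R^-1))// prodfV -natr_prod.
by rewrite squarefree_prod_primes//; case/andP: kz.
Qed.

(** Since indicators are idempotent, the factor at [q] is [F q + G q * [q | n]]. Its mean is
    [1/q - 1/q^2 <= 1/q] if [q] divides both [k] and [l], and 0 if it divides exactly one; two
    different squarefree numbers have a prime of the second kind. The error [|F q| + |G q|] is at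
    most [q] for each number that [q] divides. *)
Lemma sum_sieve_factor a z k l M : (0 < a)%N ->
  (0 < k <= z)%N -> (0 < l <= z)%N -> squarefree k -> squarefree l ->
  coprime a k -> coprime a l ->
  \sum_(m < M) sieve_factor z k (a * m + a.-1) * sieve_factor z l (a * m + a.-1)
    <= M%:R * ((k == l)%:R / k%:R) + k%:R * l%:R.
Proof.
move=> a0 kz lz sk sl ak al.
pose A (q : 'I_z.+1) := prime q && (q %| k)%N.
pose B (q : 'I_z.+1) := prime q && (q %| l)%N.
pose F (q : 'I_z.+1) : R := (if A q then q%:R^-1 else 1) * (if B q then q%:R^-1 else 1).
pose G (q : 'I_z.+1) : R :=
  if A q && B q then 1 - 2 / q%:R else if A q || B q then -1 else 0.
have G0 q : G q != 0 -> prime q && coprime a q.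
  rewrite /G /A /B; case: (boolP (prime q)) => /= pq; last by rewrite eqxx.
  case: (boolP (q %| k)%N) => /= qk; first by rewrite (coprime_dvdr qk ak).
  by case: (boolP (q %| l)%N) => /= qk'; rewrite ?eqxx// (coprime_dvdr qk' al).
have := sum_prod_dvdn M F a0 G0.
have -> : \sum_(m < M) \prod_q (F q + G q * (q %| a * m + a.-1)%N%:R) =
  \sum_(m < M) sieve_factor z k (a * m + a.-1) * sieve_factor z l (a * m + a.-1).
  apply: eq_bigr => m _; rewrite /sieve_factor.
  rewrite [X in _ = X * _]big_mkcond [X in _ = _ * X]big_mkcond -big_split /=.
  apply: eq_bigr => q _; rewrite /F /G -/(A q) -/(B q).
  by case: (A q); case: (B q); case: (_ %| _)%N => /=; ring.
have q2 (q : 'I_z.+1) : A q || B q -> 2 <= q%:R :> R.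
  by rewrite ler_nat => /orP[] /andP[/prime_gt1].
have main : \prod_q (F q + G q / q%:R) <= (k == l)%:R / k%:R.
  have [kl|kl] := eqVneq k l.
    rewrite mul1r -[k in leRHS](squarefree_prod_primes _ sk); last by case/andP: kz.
    rewrite natr_prod -prodfV -(@big_ord_primes _ _ _ z k (fun q => q%:R^-1))//.
    rewrite [leRHS]big_mkcond; apply: ler_prod => q _.
    rewrite /F /G; have -> : B q = A q by rewrite /A /B kl.
    rewrite andbb orbb -/(A q); case: ifP => [Aq|_]; last by rewrite mul0r; lra.
    have := q2 q; rewrite Aq => /(_ isT) qq.
    have i0 : 0 < q%:R^-1 :> R by rewrite invr_gt0; lra.
    have i1 : q%:R^-1 <= 2^-1 :> R by rewrite lef_pV2 ?posrE//; lra.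
    by move: (q%:R^-1 : R) i0 i1 => t; nra.
  have [q qAB] : exists q, A q (+) B q.
    apply/existsP; apply: contraNT kl => /existsPn AB.
    have [k0 l0] : (0 < k)%N /\ (0 < l)%N by case/andP: kz; case/andP: lz.
    apply/eqP; rewrite -[LHS](squarefree_prod_primes k0 sk).
    rewrite -[RHS](squarefree_prod_primes l0 sl).
    rewrite -(@big_ord_primes _ _ _ z k id)// -(@big_ord_primes _ _ _ z l id)//.
    by apply: eq_bigl => q; have := AB q; rewrite /A /B; do 2 case: (_ && _).
  rewrite (bigD1 q)//= /F /G; move: qAB (q2 q).
  by case: (A q); case: (B q) => //= _ _; rewrite ?mulr1 ?mul1r mulN1r addrN mul0r.
have err : \prod_q (`|F q| + `|G q|) <= k%:R * l%:R.
  have E j : (0 < j <= z)%N -> squarefree j -> j%:R =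
      \prod_(q < z.+1) (if prime q && (q %| j)%N then q%:R else 1) :> R.
    move=> jz sj; rewrite -[in LHS](squarefree_prod_primes _ sj); last by case/andP: jz.
    by rewrite natr_prod -(@big_ord_primes R _ _ z j (fun q => q%:R))// big_mkcond.
  rewrite (E k)// (E l)// -big_split /=; apply: ler_prod => q _.
  rewrite addr_ge0//= -/(A q) -/(B q) /F /G; have := q2 q.
  case: (A q); case: (B q) => //= qq; try have {}qq := qq isT;
    rewrite ?normrN ?normr1 ?normr0 ?mulr1 ?mul1r ?addr0//.
  - have i0 : 0 < q%:R^-1 :> R by rewrite invr_gt0; lra.
    have i1 : q%:R^-1 <= 2^-1 :> R by rewrite lef_pV2 ?posrE//; lra.
    by move: (q%:R^-1 : R) i0 i1 => t ? ?; rewrite !ger0_norm; nra.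
  - have i0 : 0 < q%:R^-1 :> R by rewrite invr_gt0; lra.
    have i1 : q%:R^-1 <= 2^-1 :> R by rewrite lef_pV2 ?posrE//; lra.
    by rewrite ger0_norm ?ltW//; lra.
  - have i0 : 0 < q%:R^-1 :> R by rewrite invr_gt0; lra.
    have i1 : q%:R^-1 <= 2^-1 :> R by rewrite lef_pV2 ?posrE//; lra.
    by rewrite ger0_norm ?ltW//; lra.
  - by rewrite normr1.
rewrite ler_norml => /andP[_]; rewrite lerBlDl => /le_trans; apply.
by apply: lerD => //; rewrite ler_wpM2l.
Qed.

(* On primes [n > z] the weights [sieve_factor z k n] add up to [G], while over a
   progression they are nearly orthogonal, with mean square [1/k]. *)
Lemma selberg_sieve a z M : (0 < a)%N ->
  (\sum_(m < M) (prime (a * m + a.-1) && (z < a * m + a.-1)))%N%:R *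
    squarefree_harmonic R a z ^+ 2 <= M%:R * squarefree_harmonic R a z + z%:R ^+ 4.
Proof.
move=> a0; set G := squarefree_harmonic R a z.
pose w n : R := \sum_(1 <= k < z.+1 | squarefree k && coprime a k) sieve_factor z k n.
have : (\sum_(m < M) (prime (a * m + a.-1) && (z < a * m + a.-1)))%N%:R * G ^+ 2 <=
    \sum_(m < M) w (a * m + a.-1)%N ^+ 2.
  rewrite natr_sum mulr_suml; apply: ler_sum => m _.
  case: (boolP (_ && _)) => [/andP[pn zn]|_]; last by rewrite mul0r sqr_ge0.
  rewrite mul1r le_eqVlt; apply/orP; left; apply/eqP; congr (_ ^+ 2).
  rewrite /G /w /squarefree_harmonic big_nat_cond [RHS]big_nat_cond; apply: eq_bigr => k /and3P[kz sk _].
  by rewrite sieve_factor_prime.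
move=> /le_trans; apply.
under eq_bigr do rewrite expr2 /w mulr_suml.
under eq_bigr => m _ do under eq_bigr do rewrite mulr_sumr.
rewrite exchange_big /=; under eq_bigr do rewrite exchange_big /=.
pose Q k := (0 < k <= z)%N && (squarefree k && coprime a k).
have E : \sum_(1 <= k < z.+1 | squarefree k && coprime a k)
    \sum_(1 <= l < z.+1 | squarefree l && coprime a l)
    \sum_(m < M) sieve_factor z k (a * m + a.-1) * sieve_factor z l (a * m + a.-1)
  <= \sum_(1 <= k < z.+1 | squarefree k && coprime a k)
    \sum_(1 <= l < z.+1 | squarefree l && coprime a l)
      (M%:R * ((k == l)%:R / k%:R) + z%:R * z%:R).
  rewrite big_nat_cond [leRHS]big_nat_cond; apply: ler_sum => k /and3P[kz sk ak].
  rewrite big_nat_cond [leRHS]big_nat_cond; apply: ler_sum => l /and3P[lz sl al].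
  apply: le_trans (sum_sieve_factor M a0 kz lz sk sl ak al) _.
  rewrite lerD2l ler_pM// ler_nat; first by case/andP: kz.
  by case/andP: lz.
apply: (le_trans E); under eq_bigr do rewrite big_split /=.
rewrite big_split /=; apply: lerD.
  rewrite /G /squarefree_harmonic mulr_sumr big_nat_cond [leRHS]big_nat_cond.
  apply: ler_sum => k /and3P[kz sk ak].
  rewrite big_mkcond (bigD1_seq k) ?iota_uniq ?mem_index_iota//= sk ak eqxx mul1r.
  rewrite big1 ?addr0// => l /negPf lk; rewrite eq_sym lk mul0r mulr0.
  by case: ifP.
have C (P : pred nat) (x : R) : 0 <= x -> \sum_(1 <= k < z.+1 | P k) x <= z%:R * x.
  move=> x0; rewrite big_mkcond (le_trans (ler_sum _ (G := fun=> x) _))//.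
    by move=> k _; case: ifP.
  by rewrite sumr_const_nat subn1 mulr_natl.
apply: le_trans (ler_sum _ (fun k _ => C _ _ _)) _; first by rewrite mulr_ge0.
apply: le_trans (C _ _ _) _; first by rewrite !mulr_ge0.
by rewrite !exprS expr0 mulr1.
Qed.

End SelbergSieve.

Section PrimesInProgression.
Variable R : realType.

Lemma squarefree_harmonic_ge1 a z : (0 < z)%N -> 1 <= squarefree_harmonic R a z.
Proof.
move=> z0; rewrite -[leLHS](invr1 R).
apply: (ler_nat_term (P := fun k => squarefree k && coprime a k)
  (F := fun k => k%:R^-1 : R) (k := 1%N)) => //.
by rewrite coprimen1.
Qed.

Lemma sum_prime_le_level a z M : (0 < a)%N -> (0 < z)%N ->
  (\sum_(m < M) (prime (a * m + a.-1) && (a * m + a.-1 <= z)) <= z.+1)%N.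
Proof.
move=> a0 z0.
suff : (\sum_(m < M) (prime (a * m + a.-1) && (a * m + a.-1 <= z)) <= minn M z.+1)%N.
  by move=> /leq_trans; apply; lia.
elim: M => [|M IH]; first by rewrite big_ord0.
rewrite big_ord_recr /=.
case: (boolP (prime _ && _)) => [/andP[pm mz]|_] /=; last first.
  by rewrite addn0 (leq_trans IH)//; lia.
have Mz : (M <= a * M + a.-1)%N by nia.
by move: (\sum_(m < M) _)%N IH => s; lia.
Qed.

Lemma ln_le_sqrt (x : R) : 0 < x -> ln x <= 2 * Num.sqrt x.
Proof.
move=> x0; have s0 : 0 < Num.sqrt x by rewrite sqrtr_gt0.
rewrite -{1}(sqr_sqrtr (ltW x0)) lnXn// mulr_natl lerMn2r/=.
by rewrite ltW// ln_sublinear.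
Qed.

Lemma primes_in_progression_le a M : prime a \/ a = 1%N -> (1 < M)%N ->
  (\sum_(m < M) prime (a * m + a.-1))%N%:R <= 40 * M%:R / ln M%:R :> R.
Proof.
move=> pa M1.
have a0 : (0 < a)%N by case: pa => [/prime_gt0|->].
(* The level [z] is about [M^(1/8)]: the sieve error [z^4] is then at most [sqrt M], while [G] is
   still at least [ln M / 32]. As [z] depends on [M] alone, the bound is uniform in [a]. *)
pose P z := (0 < z)%N && (z ^ 8 <= M)%N.
have P1 : exists z, P z by exists 1%N; rewrite /P exp1n /= ltnW.
have Pb z : P z -> (z <= M)%N.
  by move=> /andP[z0]; apply: leq_trans; rewrite -[leqLHS]expn1 leq_pexp2l.
have [z /andP[z0 zM] zmax] := ex_maxnP P1 Pb.
have zM1 : (M < z.+1 ^ 8)%N.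
  by rewrite ltnNge; apply/negP => h; have := zmax z.+1; rewrite /P h => /(_ isT); lia.
have lnM0 : 0 < ln M%:R :> R by rewrite ln_gt0// ltr1n.
have M_gt0 : (0 < M)%N by exact: ltnW.
have M0 : 0 < M%:R :> R by rewrite ltr0n.
set G := squarefree_harmonic R a z.
have G1 : 1 <= G by exact: squarefree_harmonic_ge1.
have Gln : ln M%:R / 32 <= G.
  apply: le_trans (sum_inv_squarefree_ge R z pa).
  suff : ln M%:R <= 8 * ln z.+1%:R :> R by lra.
  rewrite mulr_natl -lnXn ?ltr0n// ler_ln ?posrE ?exprn_gt0 ?ltr0n//.
  by rewrite -natrX ler_nat ltnW.
have := selberg_sieve R z M a0; rewrite -/G.
set c := (\sum_(m < M) _)%N => hc.
have c1 : c%:R <= 32 * M%:R / ln M%:R + z%:R ^+ 4 :> R.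
  have : c%:R <= M%:R / G + z%:R ^+ 4.
    rewrite -(ler_pM2r (_ : 0 < G ^+ 2)) ?exprn_gt0 ?(lt_le_trans _ G1)//.
    apply: (le_trans hc); rewrite mulrDl.
    have -> : M%:R / G * G ^+ 2 = M%:R * G.
      by rewrite expr2 mulrA divfK// lt0r_neq0 ?(lt_le_trans _ G1).
    by rewrite lerD2l ler_peMr// ?exprn_ge0// exprn_ege1.
  move=> /le_trans; apply; rewrite lerD2r -mulrA mulrCA.
  apply: ler_wpM2l; first exact: ltW.
  rewrite -[leRHS]invrK lef_pV2 ?posrE ?(lt_le_trans _ G1) ?invr_gt0 ?divr_gt0//.
  by rewrite invf_div.
have z4 : z%:R ^+ 4 <= 2 * M%:R / ln M%:R :> R.
  have s0 : 0 < Num.sqrt M%:R :> R by rewrite sqrtr_gt0.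
  apply: (@le_trans _ _ (Num.sqrt M%:R)).
    rewrite -(ler_sqr (_ : _ \is Num.nneg) (_ : _ \is Num.nneg)) ?nnegrE ?exprn_ge0 ?sqrtr_ge0//.
    by rewrite sqr_sqrtr// -exprM -natrX ler_nat.
  rewrite ler_pdivlMr//; apply: (@le_trans _ _ (2 * Num.sqrt M%:R * Num.sqrt M%:R)).
    by rewrite [leLHS]mulrC ler_wpM2r// ?(ltW s0)// ln_le_sqrt.
  by rewrite -mulrA -expr2 sqr_sqrtr// ltW.
have zz : z%:R <= z%:R ^+ 4 :> R.
  by rewrite -natrX ler_nat -[leqLHS]expn1 leq_pexp2l.
have : (\sum_(m < M) prime (a * m + a.-1) <= c + z.+1)%N.
  apply: leq_trans (leq_add (leqnn _) (sum_prime_le_level M a0 z0)).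
  rewrite -big_split /=; apply: leq_sum => m _; case: prime => //=.
  by case: (ltnP z (a * m + a.-1)%N).
have z1 : 1 <= z%:R :> R by rewrite ler1n.
rewrite -(ler_nat R) natrD -natr1 => /le_trans; apply.
move: c1 z4; rewrite -!mulrA; set u := M%:R / ln M%:R; lra.
Qed.

Lemma ln_succ_sub_ge (n : nat) : (0 < n)%N -> n.+1%:R^-1 <= ln n.+1%:R - ln n%:R :> R.
Proof.
move=> n0; have n1 : (0 : R) < n%:R by rewrite ltr0n.
rewrite -lerN2 opprB -ln_div ?posrE//.
have -> : n%:R / n.+1%:R = 1 + - n.+1%:R^-1 :> R.
  by rewrite -natr1; field; lra.
by rewrite le_ln1Dx// ltrN2 invf_lt1// ltr1n.
Qed.

Lemma ln2_ge_half : 2^-1 <= ln 2 :> R.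
Proof. by have := ln_succ_sub_ge (ltn0Sn 0); rewrite ln1 subr0. Qed.

Lemma lnln_succ_sub_ge (n : nat) : (1 < n)%N ->
  (n.+1%:R * ln n.+1%:R)^-1 <= ln (ln n.+1%:R) - ln (ln n%:R) :> R.
Proof.
move=> n1; have l0 : 0 < ln n%:R :> R by rewrite ln_gt0// ltr1n.
have l1 : 0 < ln n.+1%:R :> R by rewrite ln_gt0// ltr1n ltnW.
rewrite -lerN2 opprB -ln_div ?posrE//.
have -> : ln n%:R / ln n.+1%:R = 1 + - ((ln n.+1%:R - ln n%:R) / ln n.+1%:R) :> R.
  by field; lra.
have d0 : ln n.+1%:R - ln n%:R < ln n.+1%:R :> R by lra.
apply: le_trans (le_ln1Dx _) _; first by rewrite ltrN2 ltr_pdivrMr// mul1r.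
rewrite lerN2 invfM; apply: ler_wpM2r; first by rewrite invr_ge0 ltW.
by apply: ln_succ_sub_ge; exact: ltnW.
Qed.

Lemma sum_inv_ln_le M : (1 < M)%N ->
  \sum_(2 <= j < M) (j.+1%:R * ln j%:R)^-1 <= 2 * (ln (ln M%:R) + 1) :> R.
Proof.
case: M => [|[|M]]// _; elim: M => [|M IH].
  rewrite big_geq// mulr_ge0// -lerBlDr sub0r.
  have := ln2_ge_half => h.
  rewrite lerNl -lnV ?posrE; last by lra.
  have h2 : (ln 2)^-1 <= 2 :> R by rewrite -[leRHS]invrK lef_pV2 ?posrE//; lra.
  apply: (@le_trans _ _ (ln 2)); first by rewrite ler_ln ?posrE ?invr_gt0//; lra.
  have := @ln_sublinear R 2; have := @le_ln1Dx R 1 => h3 _.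
  by apply: le_trans (h3 _); rewrite ?lexx// -?natr1//; lra.
rewrite big_nat_recr//= (le_trans (lerD IH (lexx _)))// -lerBrDl -mulrBr opprD.
rewrite addrACA subrr addr0.
have l1 : 0 < ln M.+2%:R :> R by rewrite ln_gt0// ltr1n.
have l2 : 0 < ln M.+3%:R :> R by rewrite ln_gt0// ltr1n.
have h := @lnln_succ_sub_ge M.+2 isT.
apply: le_trans (ler_wpM2l (_ : 0 <= 2) h) => //.
rewrite !invfM mulrCA ler_wpM2l ?invr_ge0//.
rewrite ler_pdivlMr// mulrC ler_pdivrMr// mulr_natl -lnXn ?ltr0n//.
by rewrite ler_ln ?posrE ?exprn_gt0 ?ltr0n// -natrX ler_nat; lia.
Qed.

Lemma sum_abel_inv (c : nat -> R) M : (0 < M)%N ->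
  \sum_(m < M) c m / m.+1%:R =
    (\sum_(m < M) c m) / M%:R +
    \sum_(1 <= j < M) (\sum_(m < j) c m) / (j%:R * j.+1%:R).
Proof.
case: M => // M _; elim: M => [|M IH]; first by rewrite !big_ord1 big_geq// addr0.
rewrite big_ord_recr /= IH [in RHS]big_ord_recr [in RHS]big_nat_recr//=.
set S := \sum_(m < M.+1) c m.
have : M.+1%:R != 0 :> R by rewrite pnatr_eq0.
have : M.+2%:R != 0 :> R by rewrite pnatr_eq0.
by rewrite -[M.+2%:R]natr1 => ? ?; field; apply/andP.
Qed.

(** Partial summation of the sieve bound. The boundary term and the term [j = 1], where [ln j]
    vanishes, are bounded trivially by 1 each; the rest costs [40 * 2 * (ln (ln M) + 1)]. *)
Lemma sum_prime_progression_inv a M : prime a \/ a = 1%N -> (1 < M)%N ->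
  \sum_(m < M) (prime (a * m + a.-1))%:R / m.+1%:R <= 82 + 80 * ln (ln M%:R) :> R.
Proof.
move=> pa M1; rewrite (sum_abel_inv (fun m => (prime (a * m + a.-1))%:R)) ?(ltnW M1)//.
have S1 j : \sum_(m < j) (prime (a * m + a.-1))%:R <= j%:R :> R.
  rewrite -natr_sum ler_nat -[leqRHS]card_ord -sum1_card.
  by apply: leq_sum => m _; case: prime.
have : (\sum_(m < M) (prime (a * m + a.-1))%:R) / M%:R <= 1 :> R.
  by rewrite ler_pdivrMr ?mul1r// ltr0n ltnW.
rewrite big_ltn// big_ord1.
have : (prime (a * 0 + a.-1))%:R / (1%:R * 2%:R) <= 1 :> R.
  by case: prime; rewrite mul1r/=; lra.
suff : \sum_(2 <= j < M) (\sum_(m < j) (prime (a * m + a.-1))%:R) / (j%:R * j.+1%:R)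
    <= 40 * \sum_(2 <= j < M) (j.+1%:R * ln j%:R)^-1 :> R.
  by have := sum_inv_ln_le M1; lra.
rewrite mulr_sumr big_nat_cond [leRHS]big_nat_cond.
apply: ler_sum => j /andP[/andP[j1 _] _].
have j0 : 0 < j%:R :> R by rewrite ltr0n ltnW.
have l0 : 0 < ln j%:R :> R by rewrite ln_gt0// ltr1n.
rewrite -natr_sum ler_pdivrMr ?mulr_gt0//.
apply: le_trans (primes_in_progression_le pa j1) _.
rewrite le_eqVlt; apply/orP; left; apply/eqP; field.
by rewrite gt_eqF//= gt_eqF//; lra.
Qed.

Lemma sum_progression (p K : nat) (F : nat -> R) : (0 < p)%N ->
  \sum_(q < K | (p %| q.+1)%N) F q = \sum_(m < K %/ p) F (p * m + p.-1)%N.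
Proof.
move=> p0; elim: K => [|K IH]; first by rewrite div0n !big_ord0.
rewrite big_mkcond big_ord_recr /= -big_mkcond IH divnS//.
case: ifP => pK; last by rewrite addr0.
rewrite add1n big_ord_recr /=; congr (_ + F _).
have : (K.+1 = (K %/ p).+1 * p)%N by rewrite -[LHS](divnK pK) divnS// pK.
lia.
Qed.

(** Even the first member [p.-1] of the progression is at least [p / 2], so
    [p * m + p.-1 >= p * (m + 1) / 2] and the factor [1 / p] comes out for all terms:
    [164 = 2 * 82]. *)
Lemma sum_inv_prime_progression_le p N : prime p -> 1 <= ln N%:R :> R ->
  \sum_(q < N.+1 | prime q && (p %| q.+1)%N) q%:R^-1 <=
    164 / p%:R * (1 + ln (ln N%:R)) :> R.
Proof.
move=> pp lN.
have N1 : (1 < N)%N by case: N lN => [|[|N]]//; rewrite ?ln1 ?ler10// ln0// ler10.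
have p1 : 2 <= p%:R :> R by rewrite ler_nat prime_gt1.
have lnlN : 0 <= ln (ln N%:R) :> R by rewrite ln_ge0.
have -> : \sum_(q < N.+1 | prime q && (p %| q.+1)%N) q%:R^-1 =
    \sum_(m < N.+1 %/ p) (prime (p * m + p.-1))%:R / (p * m + p.-1)%:R :> R.
  rewrite -(sum_progression _ (fun q => (prime q)%:R / q%:R)) ?prime_gt0//.
  rewrite big_mkcondl; apply: eq_bigr => q _.
  by case: prime; rewrite ?mul1r ?mul0r.
apply: (@le_trans _ _ (2 / p%:R * \sum_(m < N.+1 %/ p) (prime (p * m + p.-1))%:R / m.+1%:R)).
  rewrite mulr_sumr; apply: ler_sum => m _; rewrite mulrCA ler_wpM2l//.
  have p0 : 0 < p%:R :> R by lra.
  have m0 : 0 <= m%:R :> R by [].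
  rewrite -[leRHS]invrK lef_pV2 ?posrE ?invr_gt0 ?mulr_gt0 ?invr_gt0//; first last.
    by rewrite ltr0n; have := prime_gt1 pp; lia.
  rewrite !invfM !invrK natrD natrM -subn1 natrB ?prime_gt0//.
  by rewrite -[m.+1%:R]natr1; move: (m%:R : R) m0 => t t0; nra.
rewrite mulrAC [leRHS]mulrAC ler_wpM2r ?invr_ge0//.
have [M1|M1] := ltnP 1 (N.+1 %/ p); last first.
  rewrite (@le_trans _ _ 2)//; last by nra.
  case: (N.+1 %/ p)%N M1 => [|[|M]]// _; first by rewrite big_ord0 mulr0.
  by rewrite big_ord1 divr1; case: prime => /=; lra.
have MN : (N.+1 %/ p <= N)%N.
  by rewrite -ltnS ltn_Pdiv ?prime_gt1.
have : ln (ln (N.+1 %/ p)%:R) <= ln (ln N%:R) :> R.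
  have l0 : 0 < ln (N.+1 %/ p)%:R :> R by rewrite ln_gt0 ?ltr1n.
  rewrite ler_ln ?posrE//; last by lra.
  by rewrite ler_ln ?posrE ?ler_nat ?ltr0n// ltnW.
have := sum_prime_progression_inv (or_introl pp) M1.
lra.
Qed.

End PrimesInProgression.

(** * Truncated Euler products *)

Section EulerProduct.
Variable K : numFieldType.

Definition rough (y n : nat) := all (fun q => y < q)%N (primes n).

Lemma roughP y n : (0 < n)%N ->
  reflect (forall q, prime q -> (q %| n)%N -> (y < q)%N) (rough y n).
Proof.
move=> n0; apply: (iffP allP) => [h q pq qn|h q].
  by apply: h; rewrite mem_primes pq n0.
by rewrite mem_primes => /and3P[pq _]; exact: h.
Qed.

Variable a : nat -> K.
Hypothesis a1 : a 1 = 1.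
Hypothesis aM : forall m n, (0 < m)%N -> (0 < n)%N -> a (m * n) = a m * a n.
Hypothesis a_le1 : forall n, (0 < n)%N -> `|a n| <= 1.
Hypothesis a_tail : forall e : K, 0 < e -> exists m0, forall m M, (m0 <= m)%N ->
  \sum_(m <= n < M) `|a n| <= e.

Let G y M := \sum_(1 <= n < M.+1 | rough y n) a n.

(** One step of the sieve of Eratosthenes: the multiples of [y.+1] are removed, and complete
    multiplicativity turns them into a copy of the same sum with a shorter range. *)
Lemma sum_roughS_prime y M : prime y.+1 ->
  G y.+1 M = G y M - a y.+1 * G y (M %/ y.+1).
Proof.
move=> py; rewrite /G [in RHS](bigID (fun n => y.+1 %| n)%N) /= addrC -addrA.
rewrite [X in X + _](_ : _ = G y.+1 M); last first.
  rewrite /G big_nat_cond [RHS]big_nat_cond; apply: eq_bigl => n.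
  case: (boolP (0 < n < M.+1)%N) => //= /andP[n0 _].
  apply/andP/(roughP _ n0) => [[/(roughP _ n0) h yn] q pq qn|h].
    by rewrite ltn_neqAle h// andbT; apply: contra yn => /eqP ->.
  split; first by apply/roughP => // q pq qn; rewrite ltnW// h.
  by apply/negP => yn; have := h _ py yn; rewrite ltnn.
rewrite [X in _ + (X - _)](_ : _ = a y.+1 * G y (M %/ y.+1)); last first.
  under eq_bigl do rewrite andbC.
  rewrite big_mkcondr sum_multiples// mulr_sumr [RHS]big_mkcond.
  rewrite [LHS]big_nat_cond [RHS]big_nat_cond.
  apply: eq_bigr => m /andP[/andP[m0 _] _].
  have -> : rough y (y.+1 * m) = rough y m.
    have ym0 : (0 < y.+1 * m)%N by rewrite muln_gt0.
    apply/(roughP _ ym0)/(roughP _ m0) => h q pq; first by move=> qm; apply: h; rewrite ?dvdn_mull.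
    by rewrite Euclid_dvdM// => /orP[|]; [rewrite dvdn_prime2// => /eqP->|exact: h].
  by case: ifP => //; rewrite aM.
by rewrite subrr addr0.
Qed.

Lemma sum_roughS y M : ~~ prime y.+1 -> G y.+1 M = G y M.
Proof.
move=> py; rewrite /G big_nat_cond [RHS]big_nat_cond; apply: eq_bigl => n.
case: (boolP (0 < n < M.+1)%N) => //= /andP[n0 _].
apply/(roughP _ n0)/(roughP _ n0) => h q pq qn; first by rewrite ltnW// h.
by rewrite ltn_neqAle h// andbT; apply: contra py => /eqP ->.
Qed.

(** Induction on [y]. Sifting by [y.+1] would multiply the sum by [1 - a y.+1] exactly if the range
    did not shrink to [M %/ y.+1]; the discrepancy is a tail of the absolutely convergent series,
    small once [M] is large in terms of [y]. *)
Lemma sum_rough_approx y e : 0 < e -> exists M0, forall M, (M0 <= M)%N ->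
  `|G y M - \prod_(q < y.+1 | prime q) (1 - a q) * G 0 M| <= e.
Proof.
have prodS y' (F : nat -> K) : \prod_(q < y'.+2 | prime q) F q =
    \prod_(q < y'.+1 | prime q) F q * (if prime y'.+1 then F y'.+1 else 1).
  by rewrite big_mkcond big_ord_recr /= -big_mkcond.
elim: y e => [|y IH] e e0.
  exists 0%N => M _; rewrite big_mkcond big_ord1 /= mul1r subrr normr0.
  exact: ltW.
case: (boolP (prime y.+1)) => py; last first.
  have [M0 hM0] := IH e e0; exists M0 => M /hM0.
  by rewrite (prodS y (fun q => 1 - a q)) (negPf py) mulr1 sum_roughS.
have [M0 hM0] := IH (e / 4) (divr_gt0 e0 (ltr0n _ 4)).
have [m0 hm0] := a_tail (divr_gt0 e0 (ltr0n _ 2)).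
exists (maxn M0 (m0 * y.+1)) => M; rewrite geq_max => /andP[/hM0 h M1].
rewrite (prodS y (fun q => 1 - a q)) py sum_roughS_prime//.
set P := \prod_(_ | _) _ in h *; set x := a y.+1.
have -> : G y M - x * G y (M %/ y.+1) - P * (1 - x) * G 0 M =
    (1 - x) * (G y M - P * G 0 M) + x * (G y M - G y (M %/ y.+1)) by ring.
have x1 : `|x| <= 1 by exact: a_le1.
have x2 : `|1 - x| <= 2.
  by rewrite (le_trans (ler_normB _ _))// normr1 (natrD _ 1 1) lerD2l.
apply: (le_trans (ler_normD _ _)); rewrite !normrM.
have -> : e = 2 * (e / 4) + 1 * (e / 2) by field.
apply: lerD; first by apply: ler_pM.
apply: ler_pM => //; apply: le_trans (hm0 (M %/ y.+1).+1 M.+1 _); last first.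
  by rewrite leqW// leq_divRL.
rewrite /G (@big_cat_nat _ _ _ (M %/ y.+1).+1 1 M.+1)//= ?ltnS ?leq_div//.
rewrite addrAC subrr add0r (le_trans (ler_norm_sum _ _ _))// [leRHS](bigID (rough y)) /=.
by rewrite lerDl sumr_ge0.
Qed.

Lemma sum_rough_sub1 y M : (0 < y)%N -> (0 < M)%N ->
  `|G y M - 1| <= \sum_(y.+1 <= n < M.+1) `|a n|.
Proof.
move=> y0 M0; rewrite /G big_mkcond big_ltn// a1 addrC addKr.
rewrite (le_trans (ler_norm_sum _ _ _))//.
have small n : (2 <= n < y.+1)%N -> rough y n = false.
  move=> /andP[n1 ny]; apply/negbTE/negP => /roughP h.
  have := h (ltnW n1) (pdiv n) (pdiv_prime n1) (pdiv_dvd n).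
  by rewrite ltnNge (leq_trans (dvdn_leq _ (pdiv_dvd n)))// ltnW.
have b0 (n : nat) : `|if rough y n then a n else 0| <= `|a n| by case: ifP; rewrite ?normr0.
have [yM|yM] := leqP y M.
  rewrite (@big_cat_nat _ _ _ y.+1 2 M.+1)//= big1_seq ?add0r ?ler_sum// => n.
  by rewrite mem_index_iota => /small ->; rewrite normr0.
rewrite big1_seq ?sumr_ge0// => n /andP[_]; rewrite mem_index_iota => /andP[n2 nM].
by rewrite small ?normr0// n2 (leq_trans nM)// ltnS ltnW.
Qed.

(** After sifting by all primes up to [y], the terms left are [a 1 = 1] and terms with [n > y], a
    small tail. *)
Lemma euler_product e : 0 < e -> exists y0, forall y, (y0 <= y)%N ->
  exists M0, forall M, (M0 <= M)%N ->
  `|\prod_(q < y.+1 | prime q) (1 - a q) * \sum_(1 <= n < M.+1) a n - 1| <= e.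
Proof.
move=> e0; have e2 := divr_gt0 e0 (ltr0n _ 2).
have [m0 hm0] := a_tail e2.
exists (maxn 1 m0) => y; rewrite geq_max => /andP[y0 my].
have [M0 hM0] := sum_rough_approx y e2.
exists (maxn 1 M0) => M; rewrite geq_max => /andP[M1 /hM0 h].
have -> : \sum_(1 <= n < M.+1) a n = G 0 M.
  rewrite /G big_nat_cond [RHS]big_nat_cond; apply: eq_bigl => n.
  case: (boolP (0 < n < M.+1)%N) => //= /andP[n0 _].
  by apply/esym/roughP => // q /prime_gt0.
set P := \prod_(_ | _) _ * _ in h *.
have -> : P - 1 = - (G y M - P) + (G y M - 1) by ring.
apply: (le_trans (ler_normD _ _)); rewrite normrN [e]splitr lerD//.
by apply: le_trans (sum_rough_sub1 _ _) _ => //; apply: hm0; rewrite leqW.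
Qed.

End EulerProduct.

(** * Characters modulo a prime *)

Section Cis.
Variable R : realType.
Implicit Types s t : R.

Definition cis t : R[i] := (cos t +i* sin t)%C.

Lemma cisD s t : cis (s + t) = cis s * cis t.
Proof. by rewrite /cis cosD sinD; simpc; congr (_ +i* _)%C; rewrite addrC mulrC. Qed.

Lemma cis0 : cis 0 = 1.
Proof. by rewrite /cis cos0 sin0. Qed.

Lemma cisX t k : cis t ^+ k = cis (t *+ k).
Proof. by elim: k => [|k IH]; rewrite ?cis0// exprS IH -cisD mulrS. Qed.

Lemma normc_cis t : Normc.normc (cis t) = 1.
Proof. by rewrite /= cos2Dsin2 sqrtr1. Qed.

Lemma sin_eq0_cis t : cis (t *+ 2) = 1 -> sin t = 0.
Proof.
move=> /eqP; rewrite eq_complex /= => /andP[/eqP c1 _].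
have := c1; rewrite cos_mulr2n => c2.
have : cos t ^+ 2 = 1 by lra.
by rewrite cos2sin2 => s; apply/eqP; rewrite -sqrf_eq0; apply/eqP; lra.
Qed.

Lemma cis_primitive_root n : (0 < n)%N -> n.-primitive_root (cis (2 * pi / n%:R)).
Proof.
move=> n0; have nR : (0 : R) < n%:R by rewrite ltr0n.
rewrite /primitive_root_of_unity n0; apply/forallP => i; rewrite unity_rootE cisX.
have [->|ni] := eqVneq i.+1 n.
  rewrite -[_ *+ n]mulr_natr divfK ?lt0r_neq0// mulr_natl.
  by rewrite /cis cos2pi sin2pi eqxx.
have iR : i.+1%:R < n%:R :> R by rewrite ltr_nat ltn_neqAle ni ltn_ord.
rewrite eqbF_neg; apply/eqP.
have -> : 2 * pi / n%:R *+ i.+1 = (pi * (i.+1%:R / n%:R)) *+ 2 :> R.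
  by rewrite -mulr_natr -[RHS]mulr_natr; field; exact: lt0r_neq0.
move=> /sin_eq0_cis; apply/eqP; rewrite gt_eqF// sin_gt0_pi//.
rewrite mulr_gt0 ?pi_gt0 ?divr_gt0 ?ltr0n//=.
by rewrite -[ltRHS]mulr1 ltr_pM2l ?pi_gt0// ltr_pdivrMr// mul1r.
Qed.

End Cis.

(** The exponent with respect to a generator of the cyclic group of units. Only its class modulo
    [p.-1] matters, so all clauses are congruences. The last clause exhibits the generator, on which
    every nonprincipal character differs from 1. *)
Lemma discrete_log p : prime p -> exists ind : nat -> nat,
  [/\ forall m n, ~~ (p %| m)%N -> ~~ (p %| n)%N ->
        ind (m * n)%N = ind m + ind n %[mod p.-1],
      forall m n, ~~ (p %| m)%N -> ~~ (p %| n)%N ->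
        (ind m == ind n %[mod p.-1])%N = (m == n %[mod p])%N &
      exists2 a, ~~ (p %| a)%N & ind a = 1 %[mod p.-1] ].
Proof.
move=> pp.
have /cyclicP[g gE] := field_unit_group_cyclic [set: {unit 'F_p}].
have og : #[g]%g = p.-1 by rewrite orderE -gE card_finField_unit card_Fp.
have unit_n n : ~~ (p %| n)%N -> (n%:R : 'F_p) \is a GRing.unit.
  by move=> pn; rewrite unitfE -(dvdn_pcharf (pchar_Fp pp)).
pose P n i := (n%:R : 'F_p) == FinRing.uval g ^+ i.
have exP n : ~~ (p %| n)%N -> exists i, P n i.
  move=> /unit_n nu; have : FinRing.unit _ nu \in <[g]>%g by rewrite -gE inE.
  move=> /cycleP[i gi]; exists i; rewrite /P -FinRing.val_unitX -gi /=.
  by [].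
pose ind n := if ~~ (p %| n)%N =P true is ReflectT h then xchoose (exP n h) else 0%N.
have indP n : ~~ (p %| n)%N -> n%:R = FinRing.uval g ^+ ind n :> 'F_p.
  move=> pn; rewrite /ind; case: eqP => // h.
  by have /eqP := xchooseP (exP n h).
have gi i j : (i == j %[mod p.-1])%N = (FinRing.uval g ^+ i == FinRing.uval g ^+ j).
  by rewrite -!FinRing.val_unitX (inj_eq val_inj) eq_expg_mod_order og.
have pM m n : ~~ (p %| m)%N -> ~~ (p %| n)%N -> ~~ (p %| m * n)%N.
  by move=> pm pn; rewrite Euclid_dvdM// negb_or pm.
exists ind; split.
- move=> m n pm pn; apply/eqP; rewrite gi exprD -!indP ?pM//.
  by rewrite natrM.
- move=> m n pm pn; rewrite gi -!indP//.
  by rewrite -(inj_eq val_inj) /= !val_Fp_nat.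
- have gp : (FinRing.uval g : nat)%:R = FinRing.uval g by exact: natr_Zp.
  have pg : ~~ (p %| FinRing.uval g)%N.
    by rewrite (dvdn_pcharf (pchar_Fp pp)) gp -unitfE; exact: (valP g).
  exists (FinRing.uval g : nat) => //.
  by apply/eqP; rewrite gi expr1 -indP// gp.
Qed.

Section ComplexNorm.
Variable R : realType.
Implicit Types z w : R[i].

Lemma normc_ge0 z : 0 <= normc z.
Proof. by case: z => a b /=; exact: sqrtr_ge0. Qed.

Lemma normcD z w : normc (z + w) <= normc z + normc w.
Proof. exact: le_normcD. Qed.

Lemma normcN z : normc (- z) = normc z.
Proof. exact: complex.normcN. Qed.

Lemma normc_real (x : R) : normc x%:C%C = `|x|.
Proof. by rewrite /= expr0n addr0 sqrtr_sqr. Qed.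

Lemma normc_sum (I : Type) (r : seq I) (P : pred I) (F : I -> R[i]) :
  normc (\sum_(i <- r | P i) F i) <= \sum_(i <- r | P i) normc (F i).
Proof.
elim/big_rec2: _ => [|i x z _ h]; first by rewrite normc0.
by rewrite (le_trans (normcD _ _))// lerD2l.
Qed.

Lemma Re_le_normc z : `|complex.Re z| <= normc z.
Proof.
by case: z => a b /=; rewrite -sqrtr_sqr ler_wsqrtr// lerDl sqr_ge0.
Qed.

Lemma normr_normc z : `|z| = (normc z)%:C%C.
Proof. by []. Qed.

Lemma mul_conjc_unit z : normc z = 1 -> z * z^*%C = 1.
Proof.
case: z => a b /= h.
have {}h : a ^+ 2 + b ^+ 2 = 1.
  by rewrite -[LHS]sqr_sqrtr ?addr_ge0 ?sqr_ge0// h expr1n.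
by apply/eqP; rewrite eq_complex /=; apply/andP; split; apply/eqP; nra.
Qed.

End ComplexNorm.

Section Characters.
Variables (R : realType) (p : nat).
Hypothesis pp : prime p.

Let p1 : (0 < p.-1)%N.
Proof. by have := prime_gt1 pp; case: p => [|[]]. Qed.

Definition dlog : nat -> nat := projT1 (cid (discrete_log pp)).

Let dlogP := projT2 (cid (discrete_log pp)).

Let zeta : R[i] := cis (2 * pi / p.-1%:R).

Let zeta_prim : p.-1.-primitive_root zeta.
Proof. exact: cis_primitive_root. Qed.

(** The [k]-th power of a fixed generator of the character group: [k = 0] is the principal
    character, [p.-1 - k] the conjugate of [k], and [k.*2 = p.-1] the quadratic character. *)
Definition chi (k n : nat) : R[i] :=
  if (p %| n)%N then 0 else zeta ^+ (k * dlog n).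

Let dlogM m n : ~~ (p %| m)%N -> ~~ (p %| n)%N ->
  dlog (m * n) = dlog m + dlog n %[mod p.-1].
Proof. by case: dlogP => + _ _; exact. Qed.

Let dlog_eq m n : ~~ (p %| m)%N -> ~~ (p %| n)%N ->
  (dlog m == dlog n %[mod p.-1])%N = (m == n %[mod p])%N.
Proof. by case: dlogP => _ + _; exact. Qed.

Let zeta_dlog k m n : ~~ (p %| m)%N -> ~~ (p %| n)%N -> m = n %[mod p] ->
  zeta ^+ (k * dlog m) = zeta ^+ (k * dlog n).
Proof.
move=> pm pn /eqP; rewrite -dlog_eq// => /eqP e; apply/eqP.
by rewrite (eq_prim_root_expr zeta_prim) -modnMmr e modnMmr.
Qed.

Lemma chiM k m n : chi k (m * n) = chi k m * chi k n.
Proof.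
rewrite /chi Euclid_dvdM//; case: (boolP (p %| m)%N) => pm; first by rewrite mul0r.
case: (boolP (p %| n)%N) => pn /=; first by rewrite mulr0.
rewrite -exprD -mulnDr; apply/eqP; rewrite (eq_prim_root_expr zeta_prim).
by rewrite -modnMmr dlogM// modnMmr.
Qed.

Lemma chi_mod k m n : m = n %[mod p] -> chi k m = chi k n.
Proof.
move=> mn; rewrite /chi; have -> : (p %| m)%N = (p %| n)%N by rewrite /dvdn mn.
by case: (boolP (p %| n)%N) => // pn; apply: zeta_dlog => //; rewrite /dvdn mn.
Qed.

Lemma normc_chi k n : normc (chi k n) = (~~ (p %| n)%N)%:R.
Proof.
rewrite /chi; case: (p %| n)%N; first by rewrite normc0.
by rewrite cisX normc_cis.
Qed.

Lemma normc_chi_le1 k n : normc (chi k n) <= 1.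
Proof. by rewrite normc_chi; case: (~~ _). Qed.

Let p_ndvd1 : ~~ (p %| 1)%N.
Proof. by rewrite dvdn1; apply/eqP => p1'; move: pp; rewrite p1'. Qed.

Lemma chi_neq0 k n : ~~ (p %| n)%N -> chi k n != 0.
Proof.
move=> pn; apply/eqP => c; have := normc_chi k n; rewrite c normc0 pn.
by move=> /eqP; rewrite eq_sym oner_eq0.
Qed.

Lemma chi1 k : chi k 1 = 1.
Proof.
apply: (mulfI (chi_neq0 k p_ndvd1)).
by rewrite -chiM muln1 mulr1.
Qed.

(** Multiplication by the generator [a] permutes the residues, so the sum is unchanged when
    multiplied by [chi k a != 1]. *)
Lemma chi_sum0 k : (0 < k < p.-1)%N -> \sum_(n < p) chi k n = 0.
Proof.
move=> /andP[k0 kp]; have [_ _ [a pa a1]] := dlogP.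
have ca : chi k a != 1.
  rewrite /chi (negPf pa) -(prim_expr_mod zeta_prim) -modnMmr a1 modnMmr muln1.
  by rewrite (prim_expr_mod zeta_prim) -(prim_order_dvd zeta_prim) gtnNdvd.
apply: (@mulfI _ (1 - chi k a)); first by rewrite subr_eq0 eq_sym.
rewrite mulr0 mulrBl mul1r; apply/eqP; rewrite subr_eq0 mulr_sumr; apply/eqP.
have p0 := prime_gt0 pp.
pose f (i : 'I_p) : 'I_p := Ordinal (ltn_pmod (a * i) p0).
have finj : injective f.
  have aux (i j : 'I_p) : (i <= j)%N -> (a * i = a * j %[mod p])%N -> i = j.
    move=> ij /esym/eqP; rewrite eqn_mod_dvd ?leq_mul2l ?ij ?orbT//.
    rewrite -mulnBr Euclid_dvdM// (negPf pa) /= => d.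
    apply/val_inj/eqP; rewrite /= eqn_leq ij /= -subn_eq0 eqn0Ngt.
    apply/negP => ji; have := dvdn_leq ji d.
    by have := ltn_ord j; lia.
  move=> i j [ij]; have [h|/ltnW h] := leqP i j; first exact: aux.
  by apply/esym; apply: aux.
rewrite (reindex_inj finj) /=; apply: eq_bigr => i _.
by rewrite -chiM; apply: chi_mod; rewrite modn_mod.
Qed.

Lemma sum_chi_le k N : (0 < k < p.-1)%N -> normc (\sum_(n < N) chi k n) <= p%:R.
Proof.
move=> kp.
have p0 := prime_gt0 pp.
have small M : (M <= p)%N -> normc (\sum_(n < M) chi k n) <= p%:R.
  move=> Mp; rewrite (le_trans (normc_sum _ _ _))//.
  rewrite (@le_trans _ _ (\sum_(n < M) 1))//.
    by apply: ler_sum => n _; exact: normc_chi_le1.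
  by rewrite sumr_const card_ord ler_nat.
suff -> : \sum_(n < N) chi k n = \sum_(n < N %% p) chi k n.
  by apply: small; rewrite ltnW// ltn_mod.
have {}small M : \sum_(n < M + p) chi k n = \sum_(n < M) chi k n.
  rewrite addnC big_split_ord /= chi_sum0// add0r; apply: eq_bigr => n _.
  by apply: chi_mod; rewrite modnDl.
rewrite [in LHS](divn_eq N p); elim: (N %/ p)%N => [|q IH]; first by rewrite mul0n add0n.
by rewrite mulSn -addnA addnC small.
Qed.

Lemma sum_chi_orth n : ~~ (p %| n)%N ->
  \sum_(k < p.-1) chi k n = (if (n == 1 %[mod p])%N then p.-1%:R else 0).
Proof.
move=> pn; rewrite /chi; under eq_bigr do rewrite (negPf pn) mulnC exprM.
set z := zeta ^+ dlog n.
have d1 : dlog 1 = 0 %[mod p.-1].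
  have : dlog 1 + dlog 1 == dlog 1 + 0 %[mod p.-1].
    by rewrite addn0 -dlogM// mul1n.
  by rewrite eqn_modDl => /eqP.
have zE : (z == 1) = (n == 1 %[mod p])%N.
  by rewrite -dlog_eq// d1 -[X in _ == X](expr0 zeta) (eq_prim_root_expr zeta_prim).
case: ifP => n1.
  have /eqP z1 : z == 1 by rewrite zE.
  by under eq_bigr do rewrite z1 expr1n; rewrite sumr_const card_ord.
apply: (@mulfI _ (z - 1)); first by rewrite subr_eq0 zE n1.
rewrite -subrX1 mulr0 /z -exprM mulnC exprM (prim_expr_order zeta_prim).
by rewrite expr1n subrr.
Qed.

Lemma chi_pred k : chi k p.-1 = 1 \/ chi k p.-1 = -1.
Proof.
have : chi k p.-1 ^+ 2 = 1.
  rewrite expr2 -chiM -[RHS](chi1 k); apply: chi_mod.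
  have := prime_gt1 pp; case: p => [|[|m]]// _ /=.
  have -> : (m.+1 * m.+1 = m * m.+2 + 1)%N by lia.
  by rewrite modnMDl.
by move=> /eqP; rewrite sqrf_eq1 => /orP[] /eqP; [left|right].
Qed.

(** Orthogonality at [p.-1 * n], which is 1 modulo [p] exactly when [n] is -1. *)
Lemma sum_chi_pred n : ~~ (p %| n)%N ->
  \sum_(k < p.-1) chi k p.-1 * chi k n = (if (p %| n.+1)%N then p.-1%:R else 0).
Proof.
move=> pn.
have pp1 : ~~ (p %| p.-1)%N by rewrite gtnNdvd// prednK// prime_gt0.
under eq_bigr do rewrite -chiM.
rewrite sum_chi_orth ?Euclid_dvdM ?negb_or ?pp1//.
congr (if _ then _ else _).
have -> : (p.-1 * n == 1 %[mod p])%N = (p.-1 * n + n == 1 + n %[mod p])%N by rewrite eqn_modDr.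
have -> : (p.-1 * n + n = n * p + 0)%N.
  by have := prime_gt0 pp; case: p => // m _ /=; lia.
by rewrite modnMDl eq_sym mod0n add1n.
Qed.

Lemma chi_conj k n : (k <= p.-1)%N -> chi (p.-1 - k) n = (chi k n)^*%C.
Proof.
move=> kp; case: (boolP (p %| n)%N) => pn.
  by rewrite /chi pn conjc0.
apply: (mulfI (chi_neq0 k pn)); rewrite mul_conjc_unit ?normc_chi ?pn//.
rewrite /chi (negPf pn) -exprD -mulnDl subnKC// exprM.
by rewrite (prim_expr_order zeta_prim) expr1n.
Qed.

Lemma chi_real k n : (k.*2 = p.-1)%N ->
  [\/ chi k n = 0, chi k n = 1 | chi k n = -1].
Proof.
move=> k2; case: (boolP (p %| n)%N) => pn.
  by rewrite /chi pn; constructor 1.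
have : chi k n ^+ 2 = 1.
  rewrite /chi (negPf pn) -exprM mulnAC muln2 k2 exprM.
  by rewrite (prim_expr_order zeta_prim) expr1n.
by move=> /eqP; rewrite sqrf_eq1 => /orP[] /eqP ->; [constructor 2|constructor 3].
Qed.

End Characters.

(** * Lower bound for primes congruent to -1 *)

Section AbelSummation.
Variable R : realType.

Lemma normc_abel_sum (c : nat -> R[i]) (B : R) (f : nat -> R) M : c 0%N = 0 ->
  (forall N, normc (\sum_(n < N) c n) <= B) -> (0 < M)%N ->
  normc (\sum_(1 <= n < M.+1) c n * (f n)%:C%C) <=
    B * (`|f M| + \sum_(1 <= n < M) `|f n - f n.+1|).
Proof.
move=> c0 cB; case: M => // M _.
pose S N := \sum_(n < N) c n.
have -> : \sum_(1 <= n < M.+2) c n * (f n)%:C%C =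
    S M.+2 * (f M.+1)%:C%C + \sum_(1 <= n < M.+1) S n.+1 * (f n - f n.+1)%:C%C.
  elim: M => [|M IH].
    by rewrite big_nat1 big_geq// addr0 /S !big_ord_recl big_ord0 c0 addr0 add0r.
  rewrite big_nat_recr//= IH [in RHS]big_nat_recr//= [S M.+3]/S big_ord_recr/= -/(S M.+2).
  by rewrite rmorphB /=; ring.
rewrite (le_trans (normcD _ _))// mulrDr; apply: lerD.
  by rewrite normcM normc_real; apply: ler_wpM2r => //; exact: cB.
rewrite (le_trans (normc_sum _ _ _))// mulr_sumr; apply: ler_sum => n _.
by rewrite normcM normc_real; apply: ler_wpM2r => //; exact: cB.
Qed.

Lemma normc_abel_sum_decr (c : nat -> R[i]) (B : R) (f : nat -> R) M : c 0%N = 0 ->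
  (forall N, normc (\sum_(n < N) c n) <= B) -> (0 < M)%N ->
  (forall n, (0 < n)%N -> 0 <= f n.+1 <= f n) ->
  normc (\sum_(1 <= n < M.+1) c n * (f n)%:C%C) <= B * f 1%N.
Proof.
move=> c0 cB M0 fd; apply: le_trans (normc_abel_sum f c0 cB M0) _.
have B0 : 0 <= B by apply: le_trans (cB 0%N); exact: normc_ge0.
rewrite ler_wpM2l//; case: M M0 => // M _.
have f0 n : (0 < n)%N -> 0 <= f n.
  by move=> /fd/andP[h1 h2]; exact: le_trans h2.
suff -> : \sum_(1 <= n < M.+1) `|f n - f n.+1| = f 1%N - f M.+1.
  by rewrite ger0_norm ?f0// addrC subrK.
elim: M => [|M IH]; first by rewrite big_geq// subrr.
rewrite big_nat_recr//= IH ger0_norm; first by rewrite addrA subrK.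
by rewrite subr_ge0; case/andP: (fd M.+1 isT).
Qed.

End AbelSummation.

(** * The powers n^(-s) for s near 1 *)

Section NegativePowers.
Variable R : realType.
Implicit Types (s d : R) (n : nat).

Definition npow s n : R := expR (- (s * ln n%:R)).

Lemma npow_gt0 s n : 0 < npow s n. Proof. exact: expR_gt0. Qed.

Lemma npow1 s : npow s 1 = 1.
Proof. by rewrite /npow ln1 mulr0 oppr0 expR0. Qed.

Lemma npowM s m n : (0 < m)%N -> (0 < n)%N -> npow s (m * n) = npow s m * npow s n.
Proof.
move=> m0 n0; rewrite /npow natrM lnM ?posrE ?ltr0n// -expRD; congr expR; ring.
Qed.

Lemma npow_inv n : (0 < n)%N -> npow 1 n = n%:R^-1.
Proof. by move=> n0; rewrite /npow mul1r expRN lnK// posrE ltr0n. Qed.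

Lemma ler_npow s m n : 0 <= s -> (0 < m <= n)%N -> npow s n <= npow s m.
Proof.
move=> s0 /andP[m0 mn]; rewrite /npow ler_expR lerN2 ler_wpM2l//.
by rewrite ler_ln ?posrE ?ltr0n ?ler_nat// (leq_trans m0).
Qed.

Lemma npow_le1 s n : 0 <= s -> (0 < n)%N -> npow s n <= 1.
Proof. by move=> s0 n0; rewrite -(npow1 s) ler_npow. Qed.

Lemma npowD s d n : npow (s + d) n = npow s n * npow d n.
Proof. by rewrite /npow -expRD; congr expR; ring. Qed.

Lemma ler_npow_exp s d n : s <= d -> (0 < n)%N -> npow d n <= npow s n.
Proof.
move=> sd n0; rewrite /npow ler_expR lerN2 ler_wpM2r//.
by rewrite ln_ge0// ler1n.
Qed.

Lemma npow_ge1B s n : 1 - s * ln n%:R <= npow s n.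
Proof. exact: expR_ge1Dx. Qed.

(** The function [1/x - x^(-1-d)] vanishes at 1 and at infinity, so it is not monotone and its
    variation has to be estimated; what matters is a bound linear in [d] and free of [M]. *)
Lemma npow_variation d M : 0 <= d -> (0 < M)%N ->
  \sum_(1 <= n < M) `|(npow 1 n - npow (1 + d) n) - (npow 1 n.+1 - npow (1 + d) n.+1)|
    <= 2 * d.
Proof.
move=> d0; case: M => // M _.
(* The majorant is [d] times the integral of [(ln x + 1) / x^2] from 1 to [M.+1]; its antiderivative
   [- (ln x + 2) / x] makes the induction close. *)
suff : \sum_(1 <= n < M.+1)
    `|(npow 1 n - npow (1 + d) n) - (npow 1 n.+1 - npow (1 + d) n.+1)| <=
    d * (2 - (ln M.+1%:R + 2) / M.+1%:R).
  move=> /le_trans; apply; rewrite mulrC ler_wpM2r// gerBl divr_ge0//.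
  by rewrite addr_ge0// ln_ge0// ler1n.
elim: M => [|M IH]; first by rewrite big_geq// ln1; rewrite mulr_ge0//; lra.
rewrite big_nat_recr//= (le_trans (lerD IH (lexx _)))//.
rewrite -lerBrDl -mulrBr !npowD !npow_inv//.
set L := ln M.+1%:R; set L' := ln M.+2%:R.
set u := M.+1%:R^-1; set u' := M.+2%:R^-1.
set v := npow d M.+1; set w := npow d M.+2.
have L'L : L' - L <= u by exact: ln_succ_sub_le.
have L0 : 0 <= L by rewrite ln_ge0// ler1n.
have v0 : 0 < v by exact: npow_gt0.
have v1 : v <= 1 by exact: npow_le1.
have vL : 1 - d * L <= v by exact: npow_ge1B.
have wv : w <= v by apply: ler_npow => //=.
have u0 : 0 < u by rewrite invr_gt0.
have u'0 : 0 < u' by rewrite invr_gt0.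
have uu' : u - u' = u * u'.
  have t0 : 0 < M.+1%:R :> R by rewrite ltr0n.
  by rewrite /u /u' -[M.+2%:R]natr1; move: (M.+1%:R : R) t0 => t t0; field; lra.
have vw : v - w <= d * u.
  have : v * (1 - d * (L' - L)) <= w.
    have -> : w = v * expR (- (d * (L' - L))).
      by rewrite /w /v /npow -expRD; congr expR; rewrite -/L -/L'; ring.
    by rewrite ler_wpM2l ?(ltW v0)// expR_ge1Dx.
  have h1 : d * (L' - L) <= d * u by exact: ler_wpM2l.
  have h2 : v * (d * (L' - L)) <= d * u.
    apply: (@le_trans _ _ (v * (d * u))); first by rewrite ler_wpM2l// ltW.
    by rewrite ler_piMl// mulr_ge0// ltW.
  by rewrite mulrBr mulr1 => h3; lra.
have -> : u - u * v - (u' - u' * w) = (u - u') * (1 - v) - u' * (v - w) by ring.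
rewrite (le_trans (ler_normB _ _))//.
have p0 : 0 < u * u' by rewrite mulr_gt0.
rewrite ger0_norm; last by rewrite uu' mulr_ge0 ?(ltW p0)// subr_ge0.
rewrite ger0_norm; last by rewrite mulr_ge0 ?(ltW u'0)// subr_ge0.
have h1 : (u - u') * (1 - v) <= u * u' * (d * L).
  by rewrite uu' ler_wpM2l ?(ltW p0)//; lra.
have h2 : u' * (v - w) <= u' * (d * u) by rewrite ler_wpM2l ?(ltW u'0).
apply: (le_trans (lerD h1 h2)).
have -> : u * u' * (d * L) + u' * (d * u) = d * (u * u' * (L + 1)) by ring.
rewrite ler_wpM2l//.
have h3 : (L' - L) * u' <= u * u' by rewrite ler_wpM2r// ltW.
have -> : 2 - (L' + 2) * u' - (2 - (L + 2) * u) = (L + 2) * (u - u') - (L' - L) * u'.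
  by ring.
by rewrite uu'; lra.
Qed.

Lemma npow_sub_le d n : 0 <= d -> (0 < n)%N -> `|npow 1 n - npow (1 + d) n| <= d.
Proof.
move=> d0 n0; have n1 : (0 : R) < n%:R by rewrite ltr0n.
rewrite npowD npow_inv// -[X in X - _]mulr1 -mulrBr normrM normfV.
have v1 := npow_le1 d0 n0; rewrite [`|1 - _|]ger0_norm ?subr_ge0//.
rewrite (ger0_norm (ltW n1)) mulrC ler_pdivrMr//.
have : d * ln n%:R <= d * n%:R by rewrite ler_wpM2l// ltW// ln_sublinear.
by have := npow_ge1B d n; lra.
Qed.

End NegativePowers.

Section LipschitzDirichlet.
Variables (R : realType) (p : nat).
Hypothesis pp : prime p.

Definition dirichlet_sum k M (s : R) : R[i] :=
  \sum_(1 <= n < M.+1) chi R pp k n * (npow s n)%:C%C.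

Let chi0 k : chi R pp k 0 = 0. Proof. by rewrite /chi dvdn0. Qed.

Lemma normc_dirichlet_sum_le k M s : (0 < k < p.-1)%N -> 0 <= s ->
  normc (dirichlet_sum k M s) <= p%:R.
Proof.
move=> kp s0; case: M => [|M]; first by rewrite /dirichlet_sum big_geq// normc0.
have sumB N : normc (\sum_(n < N) chi R pp k n) <= p%:R by exact: sum_chi_le.
have fd n : (0 < n)%N -> 0 <= npow s n.+1 <= npow s n.
  by move=> n0; rewrite ltW ?npow_gt0// ler_npow// n0 leqnSn.
by have := normc_abel_sum_decr (chi0 k) sumB (ltn0Sn M) fd; rewrite npow1 mulr1.
Qed.

(** Partial summation against character sums bounded by [p]: the end value of [n^(-1) - n^(-1-d)]
    costs [d] and its variation [2 * d]. The bound does not depend on the length [M]. *)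
Lemma dirichlet_sum_lipschitz k M d : (0 < k < p.-1)%N -> 0 <= d ->
  normc (dirichlet_sum k M 1 - dirichlet_sum k M (1 + d)) <= 3 * p%:R * d.
Proof.
move=> kp d0; case: M => [|M].
  by rewrite /dirichlet_sum !big_geq// subrr normc0 !mulr_ge0.
rewrite /dirichlet_sum -sumrB; under eq_bigr do rewrite -mulrBr -rmorphB.
apply: le_trans (normc_abel_sum (B := p%:R) (fun n => npow 1 n - npow (1 + d) n) _ _ _) _ => //.
  by move=> N; exact: sum_chi_le.
rewrite mulrAC [_ * p%:R]mulrC ler_wpM2l//.
have := npow_variation d0 (ltn0Sn M); have := npow_sub_le d0 (ltn0Sn M).
by rewrite /=; lra.
Qed.

End LipschitzDirichlet.

(** * The value at 1 of a real character *)

Section QuadraticCharacter.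
Variables (R : realType) (c : nat -> R) (p : nat).
Hypothesis p0 : (0 < p)%N.
Hypothesis c0 : c 0 = 0.
Hypothesis c1 : c 1 = 1.
Hypothesis cM : forall m n, c (m * n)%N = c m * c n.
Hypothesis cval : forall n, [\/ c n = 0, c n = 1 | c n = -1].
Hypothesis csum : forall N, `|\sum_(n < N) c n| <= p%:R.

Definition divisor_sum n : R := \sum_(d <- divisors n) c d.

Let cX n k : c (n ^ k)%N = c n ^+ k.
Proof. by elim: k => [|k IH]; rewrite ?expn0 ?c1// expnS cM IH exprS. Qed.

(** Passing from [q ^ k * m] to [q ^ k.+1 * m] adds exactly the divisors [q ^ k.+1 * e] with [e]
    dividing [m]. *)
Lemma divisor_sum_pfactor q k m : prime q -> ~~ (q %| m)%N -> (0 < m)%N ->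
  divisor_sum (q ^ k * m) = (\sum_(i < k.+1) c q ^+ i) * divisor_sum m.
Proof.
move=> pq qm m0; have q0 := prime_gt0 pq.
elim: k => [|k IH]; first by rewrite big_ord1 expn0 mul1n mul1r.
rewrite big_ord_recr /= mulrDl -IH /divisor_sum.
have -> : c q ^+ k.+1 * (\sum_(d <- divisors m) c d) =
    \sum_(d <- [seq q ^ k.+1 * e | e <- divisors m]%N) c d.
  by rewrite big_map mulr_sumr; apply: eq_bigr => d _; rewrite cM cX.
rewrite -big_cat; apply: perm_big; apply: uniq_perm.
- exact: divisors_uniq.
- rewrite cat_uniq divisors_uniq /= map_inj_uniq ?divisors_uniq ?andbT.
    apply/hasPn => d /mapP[e]; rewrite -dvdn_divisors// => em ->.
    rewrite -dvdn_divisors ?muln_gt0 ?expn_gt0 ?q0//.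
    apply/negP => /(dvdn_trans (dvdn_mulr e (dvdnn (q ^ k.+1)))).
    by rewrite expnSr dvdn_pmul2l ?expn_gt0 ?q0// (negPf qm).
  by move=> x y /eqP; rewrite eqn_pmul2l ?expn_gt0 ?q0// => /eqP.
move=> d; rewrite mem_cat -!dvdn_divisors ?muln_gt0 ?expn_gt0 ?q0//.
apply/idP/orP => [dq|[|/mapP[e]]]; last first.
- by rewrite -dvdn_divisors// => em ->; rewrite dvdn_pmul2l ?expn_gt0 ?q0.
- by move=> /dvdn_trans; apply; rewrite dvdn_mul// dvdn_exp2l.
have d0 : (0 < d)%N by apply: dvdn_gt0 dq; rewrite muln_gt0 expn_gt0 q0.
have [e qe dE] := pfactor_coprime pq d0.
move: (logn q d) dE => l dE; subst d.
have cqe j : coprime (q ^ j) e by rewrite coprimeXl.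
have em : (e %| m)%N.
  have : (e %| q ^ k.+1 * m)%N by apply: dvdn_trans dq; rewrite dvdn_mulr.
  by rewrite Gauss_dvdr// coprime_sym.
have : (q ^ l %| q ^ k.+1)%N.
  have : (q ^ l %| q ^ k.+1 * m)%N by apply: dvdn_trans dq; rewrite dvdn_mull.
  by rewrite Gauss_dvdl// coprimeXl// prime_coprime.
rewrite dvdn_Pexp2l ?prime_gt1// leq_eqVlt => /orP[/eqP ->|].
  by right; apply/mapP; exists e; rewrite -?dvdn_divisors// mulnC.
by rewrite ltnS => lk; left; rewrite mulnC dvdn_mul// dvdn_exp2l.
Qed.

(** The local factor at [q ^ k] is 1, [k + 1], or the indicator of even [k], according as [c q] is
    0, 1 or -1. It is never negative, and at least 1 when [k] is even, as it always is in a
    square. *)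
Lemma divisor_sum_ge0 n : (0 < n)%N ->
  0 <= divisor_sum n /\ (forall m, n = (m ^ 2)%N -> 1 <= divisor_sum n).
Proof.
have [N] := ubnP n; elim: N n => // N IH n nN n0.
have [n1|n1] := leqP n 1.
  have -> : n = 1%N by lia.
  by rewrite /divisor_sum /divisors /= big_seq1 c1; split.
have pq := pdiv_prime n1; have q1 := prime_gt1 pq; set q := pdiv n in pq q1 *.
have [m qm nE] := pfactor_coprime pq n0.
have l0 : (0 < logn q n)%N by rewrite logn_gt0 mem_primes pq n0 pdiv_dvd.
have m0 : (0 < m)%N by move: n0; rewrite nE muln_gt0 => /andP[].
have mn : (m < N)%N.
  apply: (@leq_trans n) => //; rewrite [ltnRHS]nE -[ltnLHS]muln1 ltn_pmul2l//.
  by rewrite -[ltnLHS](expn0 q) ltn_exp2l.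
have [IH1 IH2] := IH m mn m0.
have qm' : ~~ (q %| m)%N by rewrite -prime_coprime.
have -> : divisor_sum n = (\sum_(i < (logn q n).+1) c q ^+ i) * divisor_sum m.
  by rewrite -divisor_sum_pfactor// mulnC -nE.
have [s0 s1] : 0 <= \sum_(i < (logn q n).+1) c q ^+ i /\
    (~~ odd (logn q n) -> 1 <= \sum_(i < (logn q n).+1) c q ^+ i).
  case: (cval q) => ->.
  - rewrite big_ord_recl expr0 big1 ?addr0 => [|i _]; last by rewrite expr0n.
    by split.
  - rewrite (eq_bigr (fun=> 1)); last by move=> i _; rewrite expr1n.
    by rewrite sumr_const card_ord; split; rewrite ?ler1n.
  - have -> : \sum_(i < (logn q n).+1) (-1) ^+ i = (~~ odd (logn q n))%:R :> R.
      elim: (logn q n) => [|k IHk]; first by rewrite big_ord1.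
      by rewrite big_ord_recr /= IHk -signr_odd /=; case: odd => /=; rewrite ?expr0 ?expr1; lra.
    by split => // ->.
split; first exact: mulr_ge0.
move=> m1 nm1; have m10 : (0 < m1)%N by move: n0; rewrite nm1 expn_gt0 orbF.
have ln : logn q n = (logn q m1).*2 by rewrite nm1 lognX mul2n.
have [e qe m1E] := pfactor_coprime pq m10.
have me : m = (e ^ 2)%N.
  have q0 : (0 < q ^ logn q n)%N by rewrite expn_gt0 ltnW.
  apply/eqP; rewrite -(eqn_pmul2r q0) -nE ln nm1 [in X in X == _]m1E.
  by rewrite expnMn -expnM muln2.
rewrite -[leLHS]mulr1; apply: ler_pM => //; last exact: IH2 me.
by apply: s1; rewrite ln odd_double.
Qed.

(* [x / (1 - x)] summed against [c] is [sum r(n) x^n]; its main term is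
   [T * sum c(n)/n] with [T = 1/(1-x)], and the remainder is monotone. *)
Definition lambert_rest (x : R) (n : nat) : R :=
  ((1 - x) * n%:R)^-1 - x ^+ n / (1 - x ^+ n).

(** Pair the exponents [i] and [n.-1 - i] and apply the inequality of arithmetic and geometric
    means. *)
Lemma geometric_ge (z : R) n : 0 <= z ->
  n%:R * z ^+ n.-1 <= \sum_(i < n) (z ^+ 2) ^+ i.
Proof.
move=> z0; case: n => [|n]; first by rewrite big_ord0 mul0r.
have : 2 * (n.+1%:R * z ^+ n) <= 2 * \sum_(i < n.+1) (z ^+ 2) ^+ i.
  rewrite [leRHS]mulr_natl [leRHS]mulr2n [X in _ <= _ + X](reindex_inj rev_ord_inj) /=.
  rewrite -big_split /=.
  have -> : 2 * (n.+1%:R * z ^+ n) = \sum_(i < n.+1) (2 * z ^+ n).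
    by rewrite sumr_const card_ord -[RHS]mulr_natl mulrCA.
  apply: ler_sum => i _; rewrite subSS -!exprM.
  have -> : z ^+ n = z ^+ i * z ^+ (n - i) by rewrite -exprD subnKC// -ltnS.
  rewrite ![(2 * _)%N]mulnC !exprM.
  by have := sqr_ge0 (z ^+ i - z ^+ (n - i)); nra.
by lra.
Qed.

(** With [s m = 1 + x + ... + x^(m-1)], the decrease from [n] to [n + 1] is a positive multiple of
    [1/(n(n+1)) - x^n / (s n * s n.+1)]. Its sign follows from [geometric_ge] at [z = sqrt x], used
    for [n] and [n.+1]. *)
Lemma lambert_rest_decr x n : 0 < x < 1 -> (0 < n)%N ->
  0 <= lambert_rest x n.+1 <= lambert_rest x n.
Proof.
move=> /andP[x0 x1] n0.
have y0 : 0 < 1 - x by lra.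
pose s m := \sum_(i < m) x ^+ i.
have sE m : 1 - x ^+ m = (1 - x) * s m.
  by have := subrX1 x m; rewrite -/(s m) => h; lra.
have s0 m : (0 < m)%N -> 0 < s m.
  case: m => // m _; rewrite /s big_ord_recl expr0 ltr_wpDr// sumr_ge0// => i _.
  by rewrite exprn_ge0// ltW.
have rE m : (0 < m)%N -> lambert_rest x m = (m%:R^-1 - x ^+ m / s m) / (1 - x).
  move=> m0; rewrite /lambert_rest sE.
  have := s0 m m0 => sm; have m0' : m%:R != 0 :> R by rewrite pnatr_eq0 -lt0n.
  by field; rewrite m0' !gt_eqF.
rewrite !rE// divr_ge0 ?(ltW y0)//=; last first.
  rewrite subr_ge0 ler_pdivrMr ?s0// mulrC ler_pdivlMr ?ltr0n//.
  rewrite mulr_natr -[X in _ *+ X]card_ord -sumr_const; apply: ler_sum => i _.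
  by rewrite ler_wiXn2l ?ltW// ltnW.
rewrite ler_wpM2r ?invr_ge0 ?(ltW y0)//.
have [z z0 zx] : exists2 z, 0 <= z & z ^+ 2 = x.
  by exists (Num.sqrt x); rewrite ?sqrtr_ge0 ?sqr_sqrtr// ltW.
have z1 : z <= 1 by rewrite -(@ler_pXn2r _ 2)// ?nnegrE// zx expr1n ltW.
have key : n%:R * n.+1%:R * x ^+ n <= s n * s n.+1.
  have h1 := geometric_ge n z0; have h2 := geometric_ge n.+1 z0.
  rewrite zx -/(s n) -/(s n.+1) in h1 h2.
  apply: le_trans (ler_pM _ _ h1 h2); rewrite ?mulr_ge0 ?exprn_ge0//=.
  rewrite mulrACA ler_wpM2l ?mulr_ge0// -exprD -zx -exprM.
  by rewrite ler_wiXn2l//; lia.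
have sS : s n.+1 = 1 + x * s n.
  by rewrite /s big_ord_recl expr0 mulr_sumr; congr (_ + _); apply: eq_bigr => i _; rewrite exprS.
have sn := s0 n n0; have sn1 := s0 n.+1 isT.
have nn : 0 < n%:R :> R by rewrite ltr0n.
have h1 : x ^+ n / s n - x ^+ n.+1 / s n.+1 = x ^+ n / (s n * s n.+1).
  rewrite sS in sn1 *; rewrite exprS; field; rewrite !gt_eqF//.
have h2 : n%:R^-1 - n.+1%:R^-1 = (n%:R * n.+1%:R)^-1 :> R.
  by rewrite -natr1; field; lra.
rewrite -subr_ge0.
have -> : n%:R^-1 - x ^+ n / s n - (n.+1%:R^-1 - x ^+ n.+1 / s n.+1) =
    n%:R^-1 - n.+1%:R^-1 - (x ^+ n / s n - x ^+ n.+1 / s n.+1) by ring.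
rewrite h1 h2 subr_ge0.
by rewrite ler_pdivrMr ?mulr_gt0// mulrC ler_pdivlMr ?mulr_gt0// mulrC.
Qed.

Lemma lambert_rest1 x : 0 < x < 1 -> lambert_rest x 1 = 1.
Proof. by move=> /andP[x0 x1]; rewrite /lambert_rest expr1 mulr1; field; lra. Qed.

(** Exchange the sums over [n] and its divisors [a]; the inner sum is geometric in [x ^ a] and stops
    at [M %/ a], whence the last term. *)
Lemma sum_lambert (x : R) M : 0 < x < 1 ->
  \sum_(1 <= n < M.+1) divisor_sum n * x ^+ n =
  (1 - x)^-1 * \sum_(1 <= a < M.+1) c a / a%:R
  - \sum_(1 <= a < M.+1) c a * lambert_rest x a
  - \sum_(1 <= a < M.+1) c a * (x ^+ (a * (M %/ a).+1) / (1 - x ^+ a)).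
Proof.
move=> /andP[x0 x1].
have dE n : (0 < n < M.+1)%N ->
    divisor_sum n = \sum_(1 <= a < M.+1 | (a %| n)%N) c a.
  move=> /andP[n0 nM]; rewrite /divisor_sum -[in RHS]big_filter.
  apply: perm_big; apply: uniq_perm; rewrite ?divisors_uniq ?filter_uniq ?iota_uniq// => d.
  rewrite mem_filter mem_index_iota -dvdn_divisors//.
  case: (boolP (d %| n)%N) => //= dn.
  by rewrite (dvdn_gt0 n0 dn) ltnS (leq_trans (dvdn_leq n0 dn)).
transitivity (\sum_(1 <= n < M.+1) \sum_(1 <= a < M.+1 | (a %| n)%N) c a * x ^+ n).
  by apply: eq_big_nat => n /dE ->; rewrite mulr_suml.
rewrite [LHS](eq_bigr (fun n => \sum_(1 <= a < M.+1) if (a %| n)%N then c a * x ^+ n else 0));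
  last by move=> n _; rewrite big_mkcond.
rewrite exchange_big /= mulr_sumr -!sumrB; apply: eq_big_nat => a /andP[a0 aM].
rewrite -big_mkcond sum_multiples// -mulr_sumr.
have xa1 : x ^+ a < 1 by rewrite exprn_ilt1 ?(ltW x0)// -lt0n.
have geo K : \sum_(1 <= b < K.+1) x ^+ (a * b) =
    x ^+ a / (1 - x ^+ a) - x ^+ (a * K.+1) / (1 - x ^+ a).
  elim: K => [|K IH]; first by rewrite big_geq// muln1 subrr.
  rewrite big_nat_recr//= IH [in RHS]mulnS exprD; field; lra.
have aR : a%:R != 0 :> R by rewrite pnatr_eq0 -lt0n.
rewrite geo /lambert_rest; field; rewrite aR /=.
by apply/andP; split; rewrite gt_eqF//; lra.
Qed.

(** Take [x = 1 - 1/T] with [T = (16 p)^2]. The squares up to [T] alone contribute at least [16 p]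
    terms, each at least [x^T >= 1/4], so the Lambert sum is at least [4 p]. The monotone remainder,
    by partial summation, and the truncation, for [M >= 2 T^3], cost at most [p] each. Hence [T]
    times the sum is at least [2 p]. *)
Lemma sum_quadratic_character_ge : exists M0, forall M, (M0 <= M)%N ->
  (128 * p%:R)^-1 <= \sum_(1 <= n < M.+1) c n / n%:R.
Proof.
pose h := (128 * p ^ 2)%N; pose T := h.*2.
have p1 : 1 <= p%:R :> R by rewrite ler1n.
have TE : T%:R = 256 * p%:R ^+ 2 :> R.
  by rewrite -natrX -natrM /T /h; congr _%:R; lia.
pose x : R := 1 - T%:R^-1.
have T0 : 0 < T%:R :> R by rewrite TE; nra.
have x01 : 0 < x < 1.
  rewrite /x subr_gt0 invf_lt1//; apply/andP; split; first by rewrite TE; nra.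
  by rewrite gtrBl invr_gt0.
have [x0 x1] := andP x01.
have xT : (1 - x)^-1 = T%:R by rewrite /x opprB addrCA subrr addr0 invrK.
exists (2 * T ^ 3)%N => M M0.
have TM : (T <= M)%N.
  by apply: leq_trans M0; have : (0 < T)%N by [rewrite -(ltr0n R)]; nia.
have := sum_lambert M x01; rewrite xT.
set A := \sum_(_ <= _ < _) _; set F := \sum_(1 <= a < M.+1) c a / a%:R.
set B := \sum_(1 <= a < M.+1) c a * lambert_rest x a.
set E := \sum_(1 <= a < M.+1) _.
have M1 : (0 < M)%N by apply: leq_trans TM; rewrite -(ltr0n R).
have Bp : - B <= p%:R.
  have csum' N : normc (\sum_(n < N) (c n)%:C%C) <= p%:R.
    by rewrite -rmorph_sum normc_real.
  have := normc_abel_sum_decr (c := fun n => (c n)%:C%C) (f := lambert_rest x)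
    _ csum' M1 (fun n n0 => lambert_rest_decr x01 n0).
  rewrite c0 lambert_rest1// mulr1 => /(_ erefl).
  under eq_bigr do rewrite -rmorphM.
  by rewrite -rmorph_sum normc_real -/B ler_norml => /andP[]; lra.
have cle a : `|c a| <= 1 by case: (cval a) => ->; rewrite ?normr0 ?normrN ?normr1.
have Ep : - E <= p%:R.
  have : `|E| <= \sum_(1 <= a < M.+1) x ^+ M * T%:R.
    rewrite (le_trans (ler_norm_sum _ _ _))// big_nat_cond [leRHS]big_nat_cond.
    apply: ler_sum => a /andP[/andP[a0 aM] _]; rewrite normrM -[leRHS]mul1r.
    have xa : 0 < 1 - x ^+ a by rewrite subr_gt0 exprn_ilt1 ?(ltW x0)// -lt0n.
    apply: ler_pM => //; rewrite ger0_norm ?divr_ge0 ?exprn_ge0 ?(ltW x0) ?(ltW xa)//.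
    apply: ler_pM; rewrite ?exprn_ge0 ?invr_ge0 ?(ltW x0) ?(ltW xa)//.
      by rewrite ler_wiXn2l ?(ltW x0) ?(ltW x1)// ltnW// mulnC ltn_ceil.
    rewrite -xT lef_pV2 ?posrE//; last by lra.
    by rewrite lerD2l lerN2 -[leRHS]expr1 ler_wiXn2l ?(ltW x0) ?(ltW x1).
  rewrite sumr_const_nat subn1 /= -mulr_natr => hE.
  suff : x ^+ M * T%:R * M%:R <= p%:R.
    by have := ler_norm (- E); rewrite normrN; lra.
  (* x^M <= exp(-M/T) and exp u >= u^2/2 *)
  have MR : 0 < M%:R :> R by rewrite ltr0n.
  have xM : x ^+ M <= expR (- (M%:R / T%:R)).
    have -> : - (M%:R / T%:R) = M%:R * (- T%:R^-1) :> R by ring.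
    by rewrite expRM_natl; apply: lerXn2r; rewrite ?nnegrE ?expR_ge0 ?(ltW x0)// expR_ge1Dx.
  have eM : expR (- (M%:R / T%:R)) <= 2 * T%:R ^+ 2 / M%:R ^+ 2 :> R.
    rewrite expRN -[leRHS]invrK lef_pV2 ?posrE ?expR_gt0 ?invr_gt0 ?divr_gt0 ?mulr_gt0 ?exprn_gt0//.
    have := @expR_ge1Dxn R (M%:R / T%:R) 1 (divr_ge0 (ltW MR) (ltW T0)).
    rewrite (_ : 2`! = 2)// => /(le_trans _); apply.
    rewrite invf_div -[leLHS]add0r; apply: lerD => //.
    rewrite le_eqVlt; apply/orP; left; apply/eqP; field; lra.
  have : x ^+ M * T%:R * M%:R <= 2 * T%:R ^+ 2 / M%:R ^+ 2 * T%:R * M%:R.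
    rewrite !ler_wpM2r ?(ltW MR) ?(ltW T0)//; exact: le_trans eM.
  move=> /le_trans; apply; apply: le_trans p1.
  have -> : 2 * T%:R ^+ 2 / M%:R ^+ 2 * T%:R * M%:R = (2 * T ^ 3)%N%:R / M%:R :> R.
    by rewrite natrM natrX; field; lra.
  by rewrite ler_pdivrMr// mul1r ler_nat.
have Ap : 4 * p%:R <= A.
  pose t := (16 * p)%N.
  have bern n (y : R) : 0 <= y <= 1 -> 1 - n%:R * y <= (1 - y) ^+ n.
    move=> /andP[y0 y1]; elim: n => [|n IH]; first by rewrite mul0r subr0 expr0.
    have IH' : (1 - y) * (1 - n%:R * y) <= (1 - y) * (1 - y) ^+ n.
      by rewrite ler_wpM2l// subr_ge0.
    have ny : 0 <= n%:R * y * y by rewrite !mulr_ge0.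
    by rewrite exprS -[n.+1%:R]natr1; apply: le_trans IH'; lra.
  have x4 m : (m <= T)%N -> 4^-1 <= x ^+ m.
    move=> mT; apply: (@le_trans _ _ (x ^+ T)); last by rewrite ler_wiXn2l ?(ltW x0) ?(ltW x1).
    have xh : 2^-1 <= x ^+ h.
      apply: le_trans (bern _ _ _); last first.
        by rewrite invr_ge0 (ltW T0)/= invf_le1// TE; nra.
      have -> : T%:R = 2 * h%:R :> R by rewrite /T -mul2n natrM.
      have h0 : 0 < h%:R :> R by rewrite ltr0n /h muln_gt0 expn_gt0 p0.
      by rewrite invfM mulrCA divff ?lt0r_neq0//; lra.
    have -> : 4^-1 = 2^-1 ^+ 2 :> R by lra.
    by rewrite /T -muln2 exprM lerXn2r ?nnegrE ?exprn_ge0 ?(ltW x0).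
  have F0 n : (0 < n)%N -> 0 <= divisor_sum n * x ^+ n.
    by move=> n0; rewrite mulr_ge0 ?exprn_ge0 ?(ltW x0)//; case: (divisor_sum_ge0 n0).
  have sq u : \sum_(1 <= m < u.+1) divisor_sum (m ^ 2) * x ^+ (m ^ 2) <=
      \sum_(1 <= n < (u ^ 2).+1) divisor_sum n * x ^+ n.
    elim: u => [|u IH]; first by rewrite !big_geq.
    rewrite big_nat_recr//= [leRHS](@big_cat_nat _ _ _ (u ^ 2).+1 1)//= ?ltnS ?leq_exp2r//.
    apply: lerD => //; rewrite big_nat_cond.
    apply: (@ler_nat_term R (fun i => ((u ^ 2).+1 <= i < (u.+1 ^ 2).+1) && true)%N
      (fun n => divisor_sum n * x ^+ n)).
    - by rewrite leqnn andbT ltn_exp2r.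
    - by rewrite leqnn !andbT ltn_exp2r.
    - by move=> i /andP[/andP[ui _] _]; apply: F0; exact: leq_trans ui.
  have tT : (t ^ 2 = T)%N by rewrite /t /T /h -muln2; lia.
  apply: (@le_trans _ _ (\sum_(1 <= n < (t ^ 2).+1) divisor_sum n * x ^+ n)); last first.
    rewrite /A (@big_cat_nat _ _ _ (t ^ 2).+1 1 M.+1)//= ?ltnS ?tT//.
    rewrite lerDl big_nat_cond sumr_ge0// => i /andP[/andP[ti _] _].
    by apply: F0; exact: leq_trans ti.
  apply: le_trans (sq t).
  have -> : 4 * p%:R = \sum_(1 <= m < t.+1) 4^-1 :> R.
    by rewrite sumr_const_nat subn1 /= /t -[RHS]mulr_natl natrM; lra.
  rewrite big_nat_cond [leRHS]big_nat_cond; apply: ler_sum => m /andP[/andP[m0 mt] _].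
  have m20 : (0 < m ^ 2)%N by rewrite expn_gt0 m0.
  have [_ /(_ m erefl) r1] := divisor_sum_ge0 m20.
  rewrite -[leLHS]mul1r; apply: ler_pM => //.
  by apply: x4; rewrite -tT leq_exp2r.
move=> AE; have : 2 * p%:R <= T%:R * F by lra.
rewrite TE invfM => h2.
suff : 128^-1 * p%:R^-1 * (256 * p%:R ^+ 2) <= F * (256 * p%:R ^+ 2).
  by rewrite ler_pM2r// -TE.
by apply: le_trans (_ : 2 * p%:R <= _); [rewrite le_eqVlt; apply/orP; left; apply/eqP; field; lra|lra].
Qed.

End QuadraticCharacter.

(** * Zeta and logarithms of Euler products to the right of 1 *)

Section ZetaTail.
Variable R : realType.
Implicit Types d e : R.

Lemma npow_succ_ge d n : 0 <= d -> (0 < n)%N ->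
  d * npow (1 + d) n.+1 <= npow d n - npow d n.+1.
Proof.
move=> d0 n0; have -> : npow d n = npow d n.+1 * expR (d * (ln n.+1%:R - ln n%:R)).
  by rewrite /npow -expRD; congr expR; ring.
rewrite addrC npowD npow_inv// -[X in _ - X]mulr1 -mulrBr mulrA mulrAC mulrC.
rewrite ler_wpM2l ?(ltW (npow_gt0 _ _))// lerBrDl.
apply: le_trans (expR_ge1Dx _); rewrite lerD2l ler_wpM2l//.
exact: ln_succ_sub_ge.
Qed.

Lemma npow_succ_le d n : 0 <= d -> (0 < n)%N ->
  npow d n - npow d n.+1 <= d * npow (1 + d) n.
Proof.
move=> d0 n0; have -> : npow d n.+1 = npow d n * expR (- (d * (ln n.+1%:R - ln n%:R))).
  by rewrite /npow -expRD; congr expR; ring.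
rewrite npowD npow_inv// -[X in X - _]mulr1 -mulrBr mulrA mulrC.
rewrite ler_wpM2r ?(ltW (npow_gt0 _ _))//.
have := expR_ge1Dx (- (d * (ln n.+1%:R - ln n%:R))).
have : d * (ln n.+1%:R - ln n%:R) <= d / n%:R by rewrite ler_wpM2l// ln_succ_sub_le.
by lra.
Qed.

Lemma sum_npow_tail d m M : 0 < d -> (0 < m)%N ->
  \sum_(m.+1 <= n < M) npow (1 + d) n <= npow d m / d.
Proof.
move=> d0 m0; rewrite ler_pdivlMr// mulrC mulr_sumr big_add1.
have [Mm|mM] := leqP M.-1 m; first by rewrite big_geq// ltW// npow_gt0.
apply: (@le_trans _ _ (\sum_(m <= n < M.-1) (npow d n - npow d n.+1))).
  rewrite big_nat_cond [leRHS]big_nat_cond; apply: ler_sum => n /andP[/andP[mn _] _].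
  by apply: npow_succ_ge (ltW d0) _; exact: leq_trans mn.
under eq_bigr do rewrite -opprB.
rewrite sumrN telescope_sumr ?(ltnW mM)// opprB gerBl.
exact/ltW/npow_gt0.
Qed.

Lemma npow_small d e : 0 < d -> 0 < e -> exists2 m, (0 < m)%N & npow d m <= e.
Proof.
move=> d0 e0; pose m := (Num.truncn (expR (ln e^-1 / d))).+1.
have m0 : (0 : R) < m%:R by rewrite ltr0n.
exists m => //; rewrite /npow -[leRHS]lnK ?posrE// ler_expR.
rewrite lerNl -lnV ?posrE// mulrC -ler_pdivrMr// -ler_expR lnK ?posrE//.
exact/ltW/truncnS_gt.
Qed.

Lemma sum_npow_le d M : 0 < d -> \sum_(1 <= n < M.+1) npow (1 + d) n <= 1 + d^-1.
Proof.
move=> d0; case: M => [|M]; first by rewrite big_geq// addr_ge0// invr_ge0 ltW.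
rewrite big_ltn// npow1 lerD2l.
by have := sum_npow_tail M.+2 d0 (ltn0Sn 0); rewrite npow1 mul1r.
Qed.

Lemma sum_npow_ge d M : 0 < d -> (1 - npow d M.+1) / d <= \sum_(1 <= n < M.+1) npow (1 + d) n.
Proof.
move=> d0; rewrite ler_pdivrMr// mulrC mulr_sumr -{1}(npow1 d).
rewrite -opprB -telescope_sumr// -sumrN big_nat_cond [leRHS]big_nat_cond.
apply: ler_sum => n /andP[/andP[n0 _] _]; rewrite opprB.
by apply: npow_succ_le => //; exact: ltW.
Qed.

End ZetaTail.

Section EulerLog.
Variable R : realType.

(** A complex logarithm is avoided: [|1 - z|^2 = 1 + u] with [u = |z|^2 - 2 Re z], and [u >= -3/4]
    gives [u - 4 u^2 <= ln (1 + u) <= u]. *)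
Lemma ln_normc1B (z : R[i]) : normc z <= 2^-1 ->
  `|ln (normc (1 - z)) + complex.Re z| <= 12 * normc z ^+ 2.
Proof.
move=> z2; have rz := Re_le_normc z; have r0 := normc_ge0 z.
set r := normc z in z2 rz r0 *; set a := complex.Re z in rz *.
pose u := r ^+ 2 - 2 * a.
have nE : normc (1 - z) ^+ 2 = 1 + u.
  rewrite /u /a /r; case: z {z2 rz r0 r a u} => a b.
  by rewrite /= !sqr_sqrtr ?addr_ge0 ?sqr_ge0//; ring.
have n1 : 2^-1 <= normc (1 - z).
  have := normcD (1 - z) z; rewrite subrK normc1 -/r; lra.
have n0 : 0 < normc (1 - z) by lra.
have lnE : 2 * ln (normc (1 - z)) = ln (1 + u) by rewrite -nE lnXn// mulr_natl.
have u4 : 4^-1 <= 1 + u by rewrite -nE; nra.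
have up : ln (1 + u) <= u by rewrite le_ln1Dx//; lra.
have lo : u - 4 * u ^+ 2 <= ln (1 + u).
  have h : - ln (1 + u) <= (1 + u)^-1 - 1.
    rewrite -lnV ?posrE; last by lra.
    rewrite -[X in ln X](subrK 1) addrC le_ln1Dx//.
    have : 0 < (1 + u)^-1 by rewrite invr_gt0; lra.
    by lra.
  have h2 : (1 + u)^-1 - 1 = - u + u ^+ 2 / (1 + u) by field; lra.
  have h3 : u ^+ 2 / (1 + u) <= 4 * u ^+ 2.
    rewrite mulrC ler_wpM2r ?sqr_ge0// -[leRHS]invrK lef_pV2 ?posrE ?invr_gt0//; lra.
  by lra.
have := rz; rewrite ler_norml => /andP[a1 a2].
have u25 : u ^+ 2 <= 25 / 4 * r ^+ 2.
  have : `|u| <= 5 / 2 * r by rewrite ler_norml /u; apply/andP; split; nra.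
  rewrite ler_norml => /andP[h1 h2].
  have : 0 <= (5 / 2 * r - u) * (u - - (5 / 2 * r)) by rewrite mulr_ge0// subr_ge0.
  by nra.
by rewrite ler_norml; apply/andP; split; rewrite /u in up lo u25 *; nra.
Qed.

Lemma sum_inv_sqr_primes_le y : \sum_(q < y.+1 | prime q) q%:R ^- 2 <= 2 :> R.
Proof.
apply: le_trans (sum_inv_sqr_le2 R y).
rewrite -(big_mkord prime (fun q => q%:R ^- 2)) big_mkcond big_ltn//= add0r.
by apply: ler_sum => q _; case: ifP.
Qed.

Variable a : nat -> R[i].
Hypothesis a1 : a 1 = 1.
Hypothesis aM : forall m n, (0 < m)%N -> (0 < n)%N -> a (m * n)%N = a m * a n.
Variable d : R.
Hypothesis d0 : 0 < d.
Hypothesis a_le : forall n, (0 < n)%N -> normc (a n) <= npow (1 + d) n.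

(** Knowing the Euler product within a factor 2 is enough, at a cost of [ln 2 <= 1]. The other 24 is
    the second-order part [12 / q^2] of the logarithms, summed over primes. *)
Lemma euler_log : exists y0, forall y, (y0 <= y)%N ->
  exists M0, forall M, (M0 <= M)%N ->
  0 < normc (\sum_(1 <= n < M.+1) a n) /\
  `|ln (normc (\sum_(1 <= n < M.+1) a n)) -
    \sum_(q < y.+1 | prime q) complex.Re (a q)| <= 25.
Proof.
have d1 : 0 <= 1 + d by rewrite addr_ge0// ltW.
have a_le1 n : (0 < n)%N -> `|a n| <= 1.
  move=> n0; rewrite normr_normc lecR.
  by apply: le_trans (a_le n0) _; exact: npow_le1.
have a_tail e : 0 < e -> exists m0, forall m M, (m0 <= m)%N ->
    \sum_(m <= n < M) `|a n| <= e.
  case: e => e e' e0; have {e0} [/eqP ie e0] : e' == 0 /\ 0 < e.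
    by move: e0; rewrite ltcE /= eq_sym => /andP[].
  have [m m0 hm] := npow_small d0 (mulr_gt0 e0 d0).
  exists m.+1 => m1 M mm1.
  have -> : (e +i* e')%C = e%:C%C by rewrite ie.
  have -> : \sum_(m1 <= n < M) `|a n| = (\sum_(m1 <= n < M) normc (a n))%:C%C.
    by rewrite rmorph_sum.
  rewrite lecR.
  apply: (@le_trans _ _ (\sum_(m1 <= n < M) npow (1 + d) n)).
    rewrite big_nat_cond [leRHS]big_nat_cond; apply: ler_sum => n /andP[/andP[mn _] _].
    by apply: a_le; apply: leq_trans mn; exact: leq_trans mm1.
  case: m1 mm1 => // m1; rewrite ltnS => mm1.
  apply: le_trans (sum_npow_tail M d0 (leq_trans m0 mm1)) _.
  rewrite ler_pdivrMr//; apply: le_trans hm; apply: ler_npow; first exact: ltW.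
  by rewrite m0.
have e2 : 0 < (2^-1)%:C%C :> R[i] by rewrite ltcR invr_gt0.
have [y0 hy0] := euler_product a1 aM a_le1 a_tail e2.
exists y0 => y /hy0[M0 hM0]; exists M0 => M /hM0.
set P := \prod_(_ | _) _; set F := \sum_(1 <= n < M.+1) a n.
rewrite normr_normc lecR => PF.
have PF1 : 2^-1 <= normc P * normc F.
  rewrite -normcM; have := normcD (P * F) (- (P * F - 1)).
  by rewrite normcN opprB addrCA subrr addr0 normc1; lra.
have PF2 : normc P * normc F <= 2.
  rewrite -normcM; have := normcD (P * F - 1) 1.
  by rewrite subrK normc1; lra.
have nP := normc_ge0 P; have nF := normc_ge0 F.
have P0 : 0 < normc P.
  by rewrite lt_neqAle nP andbT eq_sym; apply: contraTneq PF1 => ->; rewrite mul0r -ltNge; lra.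
have F0 : 0 < normc F.
  by rewrite lt_neqAle nF andbT eq_sym; apply: contraTneq PF1 => ->; rewrite mulr0 -ltNge; lra.
split => //.
have ln21 : ln 2 <= 1 :> R by have := @le_ln1Dx R 1; rewrite -natr1; apply; lra.
have hPF : `|ln (normc P) + ln (normc F)| <= 1.
  rewrite -lnM ?posrE// ler_norml; apply/andP; split.
    apply: (@le_trans _ _ (ln 2^-1)); last by rewrite ler_ln ?posrE ?mulr_gt0.
    by rewrite lnV ?posrE// lerN2.
  by apply: le_trans ln21; rewrite ler_ln ?posrE ?mulr_gt0.
have aq q : prime q -> normc (a q) <= q%:R^-1.
  move=> pq; have q0 := prime_gt0 pq; apply: le_trans (a_le q0) _.
  by rewrite -npow_inv// ler_npow_exp// lerDl ltW.
have aq2 q : prime q -> normc (a q) <= 2^-1.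
  move=> pq; apply: le_trans (aq q pq) _.
  by rewrite lef_pV2 ?posrE ?ltr0n ?prime_gt0// ler_nat prime_gt1.
have lnP : ln (normc P) = \sum_(q < y.+1 | prime q) ln (normc (1 - a q)).
  suff : 0 < normc P /\ ln (normc P) = \sum_(q < y.+1 | prime q) ln (normc (1 - a q)) by case.
  rewrite /P; elim/big_rec2: _ => [|q u z pq [z0 <-]]; first by rewrite normc1 ln1.
  have q0 : 0 < normc (1 - a q).
    have := normcD (1 - a q) (a q); rewrite subrK normc1.
    by have := aq2 _ pq; lra.
  by rewrite normcM mulr_gt0// lnM.
have : `|ln (normc P) + \sum_(q < y.+1 | prime q) complex.Re (a q)| <= 24.
  rewrite lnP -big_split /=; apply: (le_trans (ler_norm_sum _ _ _)).
  apply: (@le_trans _ _ (\sum_(q < y.+1 | prime q) 12 * q%:R ^- 2)); last first.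
    by rewrite -mulr_sumr; have := sum_inv_sqr_primes_le y; lra.
  apply: ler_sum => q pq; apply: le_trans (ln_normc1B (aq2 _ pq)) _.
  rewrite ler_wpM2l// -exprVn; apply: lerXn2r; rewrite ?nnegrE ?normc_ge0 ?invr_ge0//.
  exact: aq.
move: hPF; rewrite !ler_norml => /andP[? ?] /andP[? ?].
by apply/andP; split; lra.
Qed.

End EulerLog.

Lemma uniform_threshold (n : nat) (P : nat -> nat -> Prop) :
  (forall k, (k < n)%N -> exists m0, forall m, (m0 <= m)%N -> P k m) ->
  exists m0, forall m, (m0 <= m)%N -> forall k, (k < n)%N -> P k m.
Proof.
elim: n => [|n IH] h; first by exists 0%N.
have [k kn|m0 hm0] := IH; first by apply: h; exact: leq_trans kn _.
have [m1 hm1] := h n (ltnSn n).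
exists (maxn m0 m1) => m; rewrite geq_max => /andP[h0 h1] k.
by rewrite ltnS leq_eqVlt => /orP[/eqP->|kn]; [exact: hm1|exact: hm0].
Qed.

(** * From characters to primes congruent to -1 *)

Section DirichletLowerBound.
Variables (R : realType) (p : nat).
Hypothesis pp : prime p.

Let F k M d : R[i] := dirichlet_sum pp k M (1 + d).
Let U k y d : R := \sum_(q < y.+1 | prime q) complex.Re (chi R pp k q) * npow (1 + d) q.

Lemma chi_log k d : 0 < d -> exists y0, forall y, (y0 <= y)%N ->
  exists M0, forall M, (M0 <= M)%N ->
  0 < normc (F k M d) /\ `|ln (normc (F k M d)) - U k y d| <= 25.
Proof.
move=> d0; pose a n : R[i] := chi R pp k n * (npow (1 + d) n)%:C%C.
have a1 : a 1%N = 1 by rewrite /a chi1 npow1 mul1r.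
have aM m n : (0 < m)%N -> (0 < n)%N -> a (m * n)%N = a m * a n.
  by move=> m0 n0; rewrite /a chiM npowM// rmorphM /= mulrACA.
have ale n : (0 < n)%N -> normc (a n) <= npow (1 + d) n.
  move=> n0; rewrite /a normcM normc_real gtr0_norm ?npow_gt0//.
  by rewrite ler_piMl ?normc_chi_le1// ltW// npow_gt0.
have [y0 hy0] := euler_log a1 aM d0 ale.
exists y0 => y /hy0[M0 hM0]; exists M0 => M /hM0.
have -> : \sum_(q < y.+1 | prime q) complex.Re (a q) = U k y d.
  apply: eq_bigr => q _; rewrite /a; case: (chi R pp k q) => u v /=.
  by rewrite mulr0 subr0.
by [].
Qed.

(** A long truncation of zeta at [1 + d] lies between [1 / (2 d)] and [2 / d]; this adds [ln 2 <= 1]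
    to the 25 of [euler_log]. *)
Lemma zeta_log d : 0 < d <= 1 -> exists y0, forall y, (y0 <= y)%N ->
  `|ln d^-1 - \sum_(q < y.+1 | prime q) npow (1 + d) q| <= 26 :> R.
Proof.
move=> /andP[d0 d1]; pose a n : R[i] := (npow (1 + d) n)%:C%C.
have a1 : a 1%N = 1 by rewrite /a npow1.
have aM m n : (0 < m)%N -> (0 < n)%N -> a (m * n)%N = a m * a n.
  by move=> m0 n0; rewrite /a npowM// rmorphM.
have ale n : (0 < n)%N -> normc (a n) <= npow (1 + d) n.
  by move=> n0; rewrite /a normc_real gtr0_norm ?npow_gt0.
have [y0 hy0] := euler_log a1 aM d0 ale.
exists y0 => y /hy0[M0 hM0].
have h2 : 0 < 2^-1 :> R by rewrite invr_gt0.
have [m m0 hm] := npow_small d0 h2.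
have [_] := hM0 (maxn M0 m) (leq_maxl _ _).
set N := maxn M0 m.
rewrite -rmorph_sum normc_real.
set Z := \sum_(1 <= n < N.+1) npow (1 + d) n.
have Zl : d^-1 / 2 <= Z.
  apply: le_trans (sum_npow_ge N d0).
  rewrite mulrC ler_wpM2r ?invr_ge0 ?(ltW d0)//.
  have : npow d N.+1 <= npow d m.
    by apply: ler_npow; [exact: ltW|rewrite m0 leqW// leq_maxr].
  by lra.
have i1 : 1 <= d^-1 by rewrite -[leLHS]invr1 lef_pV2 ?posrE.
have Zu : Z <= 2 * d^-1 by have := sum_npow_le N d0; rewrite -/Z; lra.
have Z0 : 0 < Z by lra.
rewrite (gtr0_norm Z0).
have ln21 : ln 2 <= 1 :> R by have := @le_ln1Dx R 1; rewrite -natr1; apply; lra.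
have hl : ln d^-1 - 1 <= ln Z.
  have : ln (d^-1 / 2) <= ln Z by rewrite ler_ln ?posrE//; lra.
  by rewrite ln_div ?posrE ?invr_gt0//; lra.
have hu : ln Z <= ln d^-1 + 1.
  have : ln Z <= ln (2 * d^-1) by rewrite ler_ln ?posrE ?mulr_gt0 ?invr_gt0.
  by rewrite lnM ?posrE ?invr_gt0//; lra.
rewrite !ler_norml => /andP[? ?]; apply/andP; split; lra.
Qed.

Let norm_conj k M d : (k <= p.-1)%N -> normc (F (p.-1 - k) M d) = normc (F k M d).
Proof.
move=> kp; have -> : F (p.-1 - k) M d = (F k M d)^*%C.
  rewrite /F /dirichlet_sum rmorph_sum; apply: eq_bigr => n _.
  by rewrite rmorphM /= chi_conj// oppr0.
by case: (F k M d) => u v /=; rewrite sqrrN.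
Qed.

Let F_real k : (0 < k)%N -> (k.*2 = p.-1)%N -> exists M0, forall M, (M0 <= M)%N ->
  (128 * p%:R)^-1 <= normc (dirichlet_sum pp k M 1 : R[i]).
Proof.
move=> k0 k2; pose c n : R := complex.Re (chi R pp k n).
have cE n : chi R pp k n = (c n)%:C%C.
  by rewrite /c; case: (chi_real R pp n k2) => ->; rewrite ?rmorphN ?rmorph1 ?rmorph0.
have kp : (0 < k < p.-1)%N by rewrite k0 -k2 -addnn -[ltnLHS]addn0 ltn_add2l.
have c0 : c 0%N = 0 by rewrite /c /chi dvdn0.
have c1 : c 1%N = 1 by rewrite /c chi1.
have cM m n : c (m * n)%N = c m * c n.
  by apply: (@complexI R); rewrite rmorphM /= -!cE chiM.
have cval n : [\/ c n = 0, c n = 1 | c n = -1].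
  by rewrite /c; case: (chi_real R pp n k2) => ->; [constructor 1|constructor 2|constructor 3].
have csum N : `|\sum_(n < N) c n| <= p%:R.
  rewrite -normc_real; have -> : (\sum_(n < N) c n)%:C%C = \sum_(n < N) chi R pp k n.
    by rewrite rmorph_sum; apply: eq_bigr => n _; rewrite cE.
  exact: sum_chi_le.
have [M0 hM0] := sum_quadratic_character_ge (prime_gt0 pp) c0 c1 cM cval csum.
exists M0 => M /hM0 /le_trans; apply.
have -> : dirichlet_sum pp k M 1 = (\sum_(1 <= n < M.+1) c n / n%:R)%:C%C.
  rewrite rmorph_sum /dirichlet_sum; apply: eq_big_nat => n /andP[n0 _].
  by rewrite cE npow_inv// -rmorphM.
by rewrite normc_real ler_norm.
Qed.

(* At distance [d0] from 1 every truncated L-sum still exceeds the variation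
   allowed by [dirichlet_sum_lipschitz] on [1, 1 + d0]. *)
Let Lam : R := 80 * p%:R * (1 + ln p%:R).
Let d0 : R := expR (- Lam).

Let p2 : 2 <= p%:R :> R. Proof. by rewrite ler_nat prime_gt1. Qed.
Let lnp0 : 0 <= ln p%:R :> R. Proof. by rewrite ln_ge0// ler1n prime_gt0. Qed.

Let Lam_ge : 80 * p%:R <= Lam.
Proof. by rewrite /Lam ler_peMr ?mulr_ge0// lerDl lnp0. Qed.

Let d0_gt0 : 0 < d0. Proof. exact: expR_gt0. Qed.

Let d0_small : d0 * (20 * p%:R) ^+ 2 <= 100^-1.
Proof.
have hp2 : 2 <= p%:R :> R by exact: p2.
set t : R := 20 * p%:R.
have t40 : 40 <= t by rewrite /t; lra.
have t0 : 0 < t by lra.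
have h : expR (- t) <= t^-1.
  rewrite expRN lef_pV2 ?posrE ?expR_gt0//.
  by have := expR_ge1Dx t; lra.
have : d0 <= t^-1 ^+ 4.
  apply: (@le_trans _ _ (expR (- t) ^+ 4)); last first.
    by apply: lerXn2r; rewrite ?nnegrE ?expR_ge0 ?invr_ge0 ?(ltW t0).
  rewrite -expRM_natl ler_expR mulrN lerN2.
  have -> : 4%:R * t = 80 * p%:R by rewrite /t; ring.
  exact: Lam_ge.
move=> h2; apply: (@le_trans _ _ (t^-1 ^+ 4 * t ^+ 2)).
  by rewrite ler_wpM2r// sqr_ge0.
have -> : t^-1 ^+ 4 * t ^+ 2 = t^-1 ^+ 2 by field; exact: lt0r_neq0.
have : t^-1 <= 40^-1 by rewrite lef_pV2 ?posrE.
have : 0 < t^-1 by rewrite invr_gt0.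
by nra.
Qed.

Let d0_le1 : d0 <= 1.
Proof.
rewrite /d0 -(expR0 R) ler_expR oppr_le0.
by apply: le_trans Lam_ge; rewrite mulr_ge0.
Qed.

Let U0_le d y : U 0 y d <= \sum_(q < y.+1 | prime q) npow (1 + d) q.
Proof.
apply: ler_sum => q _; rewrite ler_piMl ?(ltW (npow_gt0 _ _))//.
by apply: le_trans (normc_chi_le1 R pp 0 q); apply: le_trans (Re_le_normc _); exact: ler_norm.
Qed.

Let U0_ge d y : 0 <= d -> \sum_(q < y.+1 | prime q) npow (1 + d) q - 1 <= U 0 y d.
Proof.
move=> dge0; rewrite lerBlDr.
have E (q : 'I_y.+1) : prime q -> npow (1 + d) q <=
    complex.Re (chi R pp 0 q) * npow (1 + d) q + (q == p :> nat)%:R.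
  move=> pq; rewrite /chi dvdn_prime2// eq_sym; case: eqP => [->|_].
    by rewrite mul0r add0r npow_le1 ?addr_ge0// prime_gt0.
  by rewrite mul0n expr0 mul1r addr0.
apply: (le_trans (ler_sum _ E)); rewrite big_split /= lerD2l.
have [yp|py] := leqP y.+1 p.
  rewrite big1// => q _; have -> : (q == p :> nat) = false; last by [].
  by apply/eqP => qp; have := ltn_ord q; rewrite qp; lia.
rewrite (bigD1 (Ordinal py))//= eqxx big1 ?addr0// => q /andP[_].
by rewrite -val_eqE /= => /negPf ->.
Qed.

(** By orthogonality the sum is [p.-1] times a sum of positive terms over primes [q = 1 (mod p)].
    This is the lower bound for the product of all L-values. *)
Let sumU_ge0 d y : 0 <= \sum_(k < p.-1) U k y d.
Proof.
rewrite exchange_big /=; apply: sumr_ge0 => q _; rewrite -mulr_suml.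
rewrite mulr_ge0 ?(ltW (npow_gt0 _ _))//.
case: (boolP (p %| q)%N) => pq; first by rewrite big1// => k _; rewrite /chi pq.
have -> : \sum_(k < p.-1) complex.Re (chi R pp k q) = complex.Re (\sum_(k < p.-1) chi R pp k q).
  by elim/big_rec2: _ => // k x z _ ->; case: (chi R pp k q) => ? ?; case: x.
rewrite sum_chi_orth//; case: ifP => _ //.
by rewrite -(rmorph_nat (real_complex R)).
Qed.

(** Real parts suffice because [chi k p.-1] is 1 or -1. *)
Let sum_pred y d :
  p.-1%:R * (\sum_(q < y.+1 | prime q && (p %| q.+1)%N) npow (1 + d) q) =
  \sum_(k < p.-1) complex.Re (chi R pp k p.-1) * U k y d.
Proof.
rewrite /U; under [RHS]eq_bigr do rewrite mulr_sumr.
rewrite [RHS]exchange_big /= mulr_sumr big_mkcondr; apply: eq_bigr => q pq.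
have -> : \sum_(k < p.-1) complex.Re (chi R pp k p.-1) *
      (complex.Re (chi R pp k q) * npow (1 + d) q) =
    complex.Re (\sum_(k < p.-1) chi R pp k p.-1 * chi R pp k q) * npow (1 + d) q.
  have -> : complex.Re (\sum_(k < p.-1) chi R pp k p.-1 * chi R pp k q) =
      \sum_(k < p.-1) complex.Re (chi R pp k p.-1) * complex.Re (chi R pp k q).
    elim/big_rec2: _ => // k x z _ <-.
    have [->|->] := chi_pred R pp k; case: (chi R pp k q) => u v; case: z => z z' /=; ring.
  by rewrite mulr_suml; apply: eq_bigr => k _; rewrite mulrA.
case: (boolP (p %| q)%N) => pq'.
  have -> : (p %| q.+1)%N = false.
    by apply/negP; rewrite -addn1 dvdn_addr// dvdn1 => /eqP p1; have := prime_gt1 pp; rewrite p1.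
  by rewrite big1 ?mul0r// => k _; rewrite {2}/chi pq' mulr0.
rewrite sum_chi_pred//; case: ifP => _ /=; last by rewrite mul0r.
by rewrite -(rmorph_nat (real_complex R)).
Qed.

Let sum_ord_first (f : nat -> R) :
  \sum_(k < p.-1) f k = f 0%N + \sum_(1 <= k < p.-1) f k.
Proof.
rewrite -(big_mkord xpredT f) big_ltn//.
by have := prime_gt1 pp; case: p => [|[]].
Qed.

Let sum_const_le (c : R) : 0 <= c -> \sum_(1 <= k < p.-1) c <= p%:R * c.
Proof.
move=> c0; rewrite sumr_const_nat -[leLHS]mulr_natl ler_wpM2r// ler_nat.
by rewrite leq_subLR (leq_trans (leq_pred _))// leq_addl.
Qed.

(** * Inequalities at fixed y, M and d, the approximations being hypotheses *)

Section LowerBoundAtPoint.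
Variables (y M : nat) (d : R).
Hypothesis dge0 : 0 < d.
Hypothesis dd0 : d <= d0.
Hypothesis log0 : forall k, (k < p.-1)%N ->
  0 < normc (F k M d0) /\ `|ln (normc (F k M d0)) - U k y d0| <= 25.
Hypothesis log1 : forall k, (k < p.-1)%N ->
  0 < normc (F k M d) /\ `|ln (normc (F k M d)) - U k y d| <= 25.
Hypothesis real_ge : forall k, (k < p.-1)%N -> (0 < k)%N -> (k.*2 = p.-1)%N ->
  (128 * p%:R)^-1 <= normc (dirichlet_sum pp k M 1 : R[i]).
Hypothesis zeta0 : `|ln d0^-1 - \sum_(q < y.+1 | prime q) npow (1 + d0) q| <= 26.
Hypothesis zeta1 : `|ln d^-1 - \sum_(q < y.+1 | prime q) npow (1 + d) q| <= 26.

Let L k := ln (normc (F k M d0)).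
Let L' k := ln (normc (F k M d)).

Let L_le k : (0 < k < p.-1)%N -> L k <= ln p%:R.
Proof.
move=> kp; have [F0 _] := log0 (proj2 (andP kp)).
rewrite /L ler_ln ?posrE ?ltr0n ?prime_gt0//.
by apply: normc_dirichlet_sum_le => //; rewrite addr_ge0// ltW.
Qed.

Let L'_le k : (0 < k < p.-1)%N -> L' k <= ln p%:R.
Proof.
move=> kp; have [F0 _] := log1 (proj2 (andP kp)).
rewrite /L' ler_ln ?posrE ?ltr0n ?prime_gt0//.
by apply: normc_dirichlet_sum_le => //; rewrite addr_ge0// ltW.
Qed.

(** In [sumU_ge0] the principal character accounts for at most [Lam + 26], and replacing each [U] by
    [L] costs 25; [26 <= 13 p] gives [38 = 25 + 13]. *)
Let sumL_ge : - Lam - 38 * p%:R <= \sum_(1 <= k < p.-1) L k.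
Proof.
have hp2 : 2 <= p%:R :> R by exact: p2.
have := sumU_ge0 d0 y; rewrite (sum_ord_first (fun k => U k y d0)).
have lnd0 : ln d0^-1 = Lam by rewrite /d0 -expRN opprK expRK.
have := U0_le d0 y; move: zeta0; rewrite ler_norml lnd0 => /andP[z1 z2] u1 u2.
have : \sum_(1 <= k < p.-1) U k y d0 <= \sum_(1 <= k < p.-1) (L k + 25).
  rewrite big_nat_cond [leRHS]big_nat_cond; apply: ler_sum => k /andP[/andP[_ kp] _].
  by have [_] := log0 kp; rewrite ler_norml -/(L k) => /andP[]; lra.
rewrite big_split /=; have := @sum_const_le 25 (ler0n _ _).
lra.
Qed.

(* [sumL_ge] bounds the sum of all [L j] below; for a non-real character a very
   negative [L k] would enter it twice, through [k] and its conjugate. *)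
Let F_large k : (0 < k < p.-1)%N -> 12 * p%:R * d0 <= normc (F k M d0).
Proof.
move=> kp; have hp2 : 2 <= p%:R :> R by exact: p2.
have hlp : 0 <= ln p%:R :> R by exact: lnp0.
have d00 : 0 < d0 by exact: d0_gt0.
have [/andP[k0 k1] [F0 _]] := (kp, log0 (proj2 (andP kp))).
have [k2|k2] := eqVneq k.*2 p.-1.
  have := real_ge k1 k0 k2.
  have := dirichlet_sum_lipschitz pp M kp (ltW d00).
  rewrite -/(F k M d0); set Z := dirichlet_sum _ _ _ _ => h1 h2.
  have := normcD (Z - F k M d0) (F k M d0); rewrite subrK => h3.
  (* The target [12 p d0] plus the Lipschitz loss [3 p d0] between 1 and [1 + d0]. *)
  suff : 15 * p%:R * d0 <= (128 * p%:R)^-1 by lra.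
  rewrite -[leRHS]mul1r ler_pdivlMr; last by lra.
  have -> : 15 * p%:R * d0 * (128 * p%:R) = d0 * (20 * p%:R) ^+ 2 * (24 / 5) by field.
  by have := d0_small; lra.
have k' : (0 < p.-1 - k < p.-1)%N by rewrite subn_gt0 k1 ltn_subrL k0 (ltn_trans k0 k1).
have kk' : (p.-1 - k)%N != k by apply: contra k2 => /eqP e; rewrite -addnn -{1}e subnK// ltnW.
have LL : L (p.-1 - k)%N = L k by rewrite /L norm_conj// ltnW.
have := sumL_ge.
rewrite (bigD1_seq k) ?iota_uniq ?mem_index_iota//=.
rewrite big_mkcond (bigD1_seq (p.-1 - k)%N) ?iota_uniq ?mem_index_iota//= kk' LL.
set Rest := \sum_(_ <- _ | _) _ => h.
have Rest_le : Rest <= p%:R * ln p%:R.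
  apply: le_trans (sum_const_le hlp).
  rewrite /Rest big_mkcond /= big_nat_cond [leRHS]big_nat_cond.
  by apply: ler_sum => j /andP[jp _]; do 2! [case: ifP => // _]; exact: L_le.
(* With [L k] counted twice, [2 * L k >= - Lam - 38 p - p ln p]. This exceeds [2 * (12 p - Lam)] as
   soon as [Lam >= 62 p + p ln p]. *)
have ln12 : ln (12 * p%:R * d0) <= L k.
  rewrite lnM ?posrE//; last by lra.
  have -> : ln d0 = - Lam by rewrite /d0 expRK.
  have : ln (12 * p%:R) < 12 * p%:R :> R by rewrite ln_sublinear//; lra.
  have : 62 * p%:R + p%:R * ln p%:R <= Lam.
    by rewrite /Lam; have := mulr_ge0 (ler0n R p) hlp; lra.
  by lra.
by move: ln12; rewrite /L ler_ln ?posrE// !mulr_gt0//; lra.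
Qed.

(** Compared through the value at 1, the sums at [d] and [d0] differ by at most [6 p d0], half of
    the lower bound in [F_large]; so the norm at most halves. *)
Let L'_ge k : (0 < k < p.-1)%N -> L k - 1 <= L' k.
Proof.
move=> kp; have F6 := F_large kp.
have d00 : 0 < d0 by exact: d0_gt0.
have [F0 _] := log0 (proj2 (andP kp)); have [F1 _] := log1 (proj2 (andP kp)).
have h1 := dirichlet_sum_lipschitz pp M kp (ltW d00).
have h2 := dirichlet_sum_lipschitz pp M kp (ltW dge0).
rewrite -/(F k M d0) in h1; rewrite -/(F k M d) in h2.
set Z := dirichlet_sum _ _ _ _ in h1 h2.
have h3 : 3 * p%:R * d <= 3 * p%:R * d0 by rewrite ler_wpM2l// mulr_ge0.
have h4 : normc (F k M d0) <= normc (F k M d) + 6 * p%:R * d0.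
  have -> : F k M d0 = F k M d + ((Z - F k M d) - (Z - F k M d0)) by ring.
  have := normcD (F k M d) ((Z - F k M d) - (Z - F k M d0)).
  have := normcD (Z - F k M d) (- (Z - F k M d0)); rewrite normcN; lra.
have ln21 : ln 2 <= 1 :> R by have := @le_ln1Dx R 1; rewrite -natr1; apply; lra.
have : ln (normc (F k M d0) / 2) <= L' k.
  by rewrite /L' ler_ln ?posrE ?divr_gt0//; lra.
by rewrite ln_div ?posrE// -/(L k); lra.
Qed.

(** As [L k - 1 <= L' k <= ln p] and [L k <= ln p], each absolute value is at most
    [2 ln p + 26 - L k]. Being linear in [L k], this bound can be summed with [sumL_ge]. *)
Let sum_absU_le : \sum_(1 <= k < p.-1) `|U k y d| <=
  Lam + 64 * p%:R + 2 * (p%:R * ln p%:R).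
Proof.
have hlp : 0 <= ln p%:R :> R by exact: lnp0.
have : \sum_(1 <= k < p.-1) `|U k y d| <= \sum_(1 <= k < p.-1) (2 * ln p%:R + 26 - L k).
  rewrite big_nat_cond [leRHS]big_nat_cond; apply: ler_sum => k /andP[kp _].
  have [_] := log1 (proj2 (andP kp)); rewrite -/(L' k).
  have := L'_ge kp; have := L'_le kp; have := L_le kp.
  move=> ? ? ?; rewrite !ler_norml => /andP[? ?].
  by apply/andP; split; lra.
rewrite sumrB; have := sumL_ge.
have c0 : 0 <= 2 * ln p%:R + 26 :> R by lra.
have := sum_const_le c0; lra.
Qed.

(** The principal character yields [ln d^-1] up to a constant; all the others together cost an
    amount independent of [d]. *)
Lemma progression_sum_ge_at : ln d^-1 - 230 * p%:R * (1 + ln p%:R) <=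
  p.-1%:R * \sum_(q < y.+1 | prime q && (p %| q.+1)%N) npow (1 + d) q.
Proof.
have hp2 : 2 <= p%:R :> R by exact: p2.
have hlp : 0 <= ln p%:R :> R by exact: lnp0.
rewrite sum_pred (sum_ord_first (fun k => complex.Re (chi R pp k p.-1) * U k y d)).
have -> : complex.Re (chi R pp 0 p.-1) = 1.
  have p1 := prime_gt1 pp; rewrite /chi gtnNdvd ?mul0n ?expr0//.
    by rewrite -subn1 subn_gt0.
  by rewrite ltn_predL ltnW.
rewrite mul1r; have := U0_ge y (ltW dge0).
move: zeta1; rewrite ler_norml => /andP[z1 z2] u1.
have : - \sum_(1 <= k < p.-1) `|U k y d| <=
    \sum_(1 <= k < p.-1) complex.Re (chi R pp k p.-1) * U k y d.
  rewrite -sumrN; apply: ler_sum => k _.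
  rewrite lerNl; apply: le_trans (ler_norm _) _; rewrite normrN normrM ler_piMl//.
  by apply: le_trans (Re_le_normc _) _; exact: normc_chi_le1.
have := sum_absU_le; have := mulr_ge0 (ler0n R p) hlp.
rewrite /Lam; lra.
Qed.

End LowerBoundAtPoint.

Lemma progression_sum_ge (d : R) : 0 < d <= 1 -> exists y0, forall y, (y0 <= y)%N ->
  ln d^-1 - 230 * p%:R * (1 + ln p%:R) <=
  p.-1%:R * \sum_(q < y.+1 | prime q && (p %| q.+1)%N) npow (1 + d) q.
Proof.
move=> /andP[dg0 d1].
have [dd0|dd0] := leP d d0; last first.
  (* For [d > d0] the claim is empty: [ln d^-1 <= Lam] makes the left side nonpositive. *)
  exists 0%N => y _; apply: (@le_trans _ _ 0).
    have : ln d^-1 <= Lam.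
      rewrite -[leRHS]expRK ler_ln ?posrE ?invr_gt0 ?expR_gt0//.
      by rewrite -[leRHS]invrK -expRN lef_pV2 ?posrE ?invr_gt0 ?expR_gt0 ?ltW.
    have : 0 <= p%:R * (1 + ln p%:R) :> R by rewrite mulr_ge0// addr_ge0// lnp0.
    by rewrite /Lam; lra.
  by rewrite mulr_ge0// sumr_ge0// => q _; exact/ltW/npow_gt0.
have d01 : 0 < d0 <= 1 by rewrite d0_gt0 d0_le1.
have [y1 hy1] := uniform_threshold (fun k (_ : (k < p.-1)%N) => chi_log k d0_gt0).
have [y2 hy2] := uniform_threshold (fun k (_ : (k < p.-1)%N) => chi_log k dg0).
have [y3 hy3] := zeta_log d01.
have [y4 hy4] := @zeta_log d (introT andP (conj dg0 d1)).
exists (maxn (maxn y1 y2) (maxn y3 y4)) => y; rewrite !geq_max.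
move=> /andP[/andP[/hy1 h1 /hy2 h2] /andP[/hy3 h3 /hy4 h4]].
have [M1 hM1] := uniform_threshold h1.
have [M2 hM2] := uniform_threshold h2.
have h5 k : (k < p.-1)%N -> exists M0, forall M, (M0 <= M)%N ->
    (0 < k)%N -> (k.*2 = p.-1)%N ->
    (128 * p%:R)^-1 <= normc (dirichlet_sum pp k M 1 : R[i]).
  move=> _; have [/andP[k0 /eqP k2]|nk] := boolP ((0 < k)%N && (k.*2 == p.-1)%N).
    by have [M0 hM0] := F_real k0 k2; exists M0 => M /hM0.
  by exists 0%N => M _ k0 k2; move: nk; rewrite k0 k2 eqxx.
have [M3 hM3] := uniform_threshold h5.
(* The length [M] does not occur in the conclusion, so it may be chosen after [y], large enough for
   every character at once. *)
pose M := maxn M1 (maxn M2 M3).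
apply: (@progression_sum_ge_at y M) => //.
- by apply: hM1; exact: leq_maxl.
- by apply: hM2; rewrite leq_max leq_maxl orbT.
- by move=> k kp; apply: hM3 => //; rewrite !leq_max leqnn !orbT.
Qed.

End DirichletLowerBound.

(** * Prime divisors of psi(n) on average *)

Section TuranSieve.
Variable R : realType.

Lemma sum_dvdn_count d N : (0 < d)%N -> (\sum_(1 <= n < N.+1) (d %| n) = N %/ d)%N.
Proof.
move=> d0; elim: N => [|N IH]; first by rewrite big_geq// div0n.
by rewrite big_nat_recr//= IH divnS// addnC.
Qed.

Lemma divn_ler (N d : nat) : (N %/ d)%N%:R <= N%:R / d%:R :> R.
Proof.
have [->|d0] := posnP d; first by rewrite divn0 invr0 mulr0.
by rewrite ler_pdivlMr ?ltr0n// -natrM ler_nat leq_divM.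
Qed.

Lemma divn_ger (N d : nat) : (0 < d)%N -> N%:R / d%:R - 1 <= (N %/ d)%N%:R :> R.
Proof.
move=> d0; rewrite lerBlDr natr1 ler_pdivrMr ?ltr0n// -natrM ler_nat.
exact/ltnW/ltn_ceil.
Qed.

(* Turan's variance argument for the number of prime divisors lying in [P]. *)
Lemma turan_sieve (P : pred nat) (K N : nat) : (K ^ 2 <= N)%N ->
  (\sum_(1 <= n < N.+1) [forall q : 'I_K.+1, prime q && P q ==> ~~ (q %| n)])%N%:R *
    (\sum_(q < K.+1 | prime q && P q) q%:R^-1) <= 3 * N%:R :> R.
Proof.
move=> KN; set s := \sum_(q < K.+1 | _) _; set c := (\sum_(1 <= n < N.+1) _)%N.
have s0 : 0 <= s by exact: sumr_ge0.
have [->|sN0] := eqVneq s 0; first by rewrite mulr0 mulr_ge0.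
have {s0 sN0} s0 : 0 < s by rewrite lt_neqAle eq_sym sN0.
have KN1 : (K.+1 <= N)%N.
  have : (1 < K)%N; last by move: KN; nia.
  rewrite ltnNge; apply/negP => K1; move: s0; rewrite /s big1 ?ltxx// => q /andP[pq _].
  by have := prime_gt1 pq; have := ltn_ord q; lia.
pose w n : R := \sum_(q < K.+1 | prime q && P q) (q %| n)%N%:R.
have c_le : c%:R * s ^+ 2 <= \sum_(1 <= n < N.+1) (w n - s) ^+ 2.
  rewrite /c natr_sum mulr_suml; apply: ler_sum => n _.
  case: forallP => h; last by rewrite mul0r sqr_ge0.
  have -> : w n = 0; last by rewrite mul1r sub0r sqrrN.
  by rewrite /w big1// => q pq; have := h q; rewrite pq /= => /negPf ->.
have sum1 : N%:R * s - K.+1%:R <= \sum_(1 <= n < N.+1) w n.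
  rewrite exchange_big /=.
  apply: (@le_trans _ _ (\sum_(q < K.+1 | prime q && P q) (N%:R / q%:R - 1))).
    rewrite sumrB -mulr_sumr lerD2l lerN2 sumr_const -[K.+1 in leRHS]card_ord.
    by rewrite ler_nat max_card.
  apply: ler_sum => q /andP[/prime_gt0 q0 _].
  by rewrite -natr_sum sum_dvdn_count// divn_ger.
have sum2 : \sum_(1 <= n < N.+1) w n ^+ 2 <= N%:R * s ^+ 2 + N%:R * s.
  under eq_bigr do rewrite expr2 /w mulr_suml.
  under eq_bigr => n _ do under eq_bigr do rewrite mulr_sumr.
  rewrite exchange_big /=; under eq_bigr do rewrite exchange_big /=.
  have -> : N%:R * s ^+ 2 + N%:R * s = \sum_(q < K.+1 | prime q && P q)
      (\sum_(l < K.+1 | prime l && P l) N%:R / (q%:R * l%:R) + N%:R / q%:R).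
    rewrite big_split /= -mulr_sumr; congr (_ + _).
    rewrite expr2 {1}/s mulrCA mulr_suml; apply: eq_bigr => q _.
    rewrite /s mulrA mulr_sumr; apply: eq_bigr => l _.
    by rewrite invfM mulrA [X in X * _]mulrC.
  apply: ler_sum => q Pq; have /andP[pq _] := Pq.
  rewrite (bigD1 q)//= [leRHS]addrC; apply: lerD.
    under eq_bigr do rewrite -natrM mulnb andbb.
    by rewrite -natr_sum sum_dvdn_count ?prime_gt0// divn_ler.
  rewrite [leRHS](bigD1 q)//=; apply: ler_wpDl; first by rewrite divr_ge0// mulr_ge0.
  apply: ler_sum => l /andP[/andP[pl _] lq].
  have ql : coprime q l by rewrite prime_coprime// dvdn_prime2// eq_sym.
  under eq_bigr do rewrite -natrM mulnb -Gauss_dvd//.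
  by rewrite -natr_sum sum_dvdn_count ?muln_gt0 ?prime_gt0// -natrM divn_ler.
have : \sum_(1 <= n < N.+1) (w n - s) ^+ 2 <= N%:R * s + 2 * s * K.+1%:R.
  under eq_bigr do rewrite sqrrB -mulr_natl.
  rewrite big_split /= sumrB sumr_const_nat subn1 /= -mulr_sumr.
  rewrite -[X in _ + X <= _]mulr_natl.
  rewrite -mulr_suml.
  have : s * (N%:R * s - K.+1%:R) <= s * \sum_(1 <= n < N.+1) w n.
    by rewrite ler_wpM2l// ltW.
  by move: sum2; move: (\sum_(1 <= n < N.+1) w n) (\sum_(1 <= n < N.+1) w n ^+ 2) => u v; nra.
move=> h; have {h c_le} := le_trans c_le h.
rewrite expr2 mulrA => h; rewrite -(ler_pM2r s0); apply: (le_trans h).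
have KR : K.+1%:R <= N%:R :> R by rewrite ler_nat.
have : s * K.+1%:R <= s * N%:R by rewrite ler_wpM2l// ltW.
by lra.
Qed.

End TuranSieve.

Section DedekindPsi.

Lemma dedekind_psi_prod n : (0 < n)%N ->
  dedekind_psi n = (n %/ (\prod_(p <- primes n) p) * \prod_(p <- primes n) p.+1)%N.
Proof.
by move=> n0; rewrite /dedekind_psi mulnC -muln_divA ?dvdn_prod_primes// mulnC.
Qed.

Lemma dedekind_psi_gt0 n : (0 < n)%N -> (0 < dedekind_psi n)%N.
Proof.
move=> n0; rewrite dedekind_psi_prod// muln_gt0; apply/andP; split.
  have := dvdn_prod_primes n0 => d.
  by rewrite divn_gt0 ?(dvdn_gt0 n0 d)// dvdn_leq.
by rewrite prodn_gt0.
Qed.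

Lemma dvdn_succ_dedekind_psi q n : (0 < n)%N -> prime q -> (q %| n)%N ->
  (q.+1 %| dedekind_psi n)%N.
Proof.
move=> n0 pq qn; rewrite dedekind_psi_prod//; apply: dvdn_mull.
by rewrite (bigD1_seq q) ?primes_uniq ?mem_primes ?pq ?n0//= dvdn_mulr.
Qed.

(** In [psi n = (n / rad n) * prod (q + 1)], a prime dividing the first factor divides [n] at least
    twice. *)
Lemma prime_dvdn_dedekind_psi p n : (0 < n)%N -> prime p -> (p %| dedekind_psi n)%N ->
  (p ^ 2 %| n)%N \/ exists q, [/\ prime q, (q %| n)%N & (p %| q.+1)%N].
Proof.
move=> n0 pp; rewrite dedekind_psi_prod// Euclid_dvdM// => /orP[pm|].
  left; have d := dvdn_prod_primes n0.
  have pn : p \in primes n.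
    by rewrite mem_primes pp n0 -(divnK d) dvdn_mulr.
  rewrite -(divnK d) expnS expn1 dvdn_mul//.
  by rewrite (bigD1_seq p) ?primes_uniq//= dvdn_mulr.
rewrite big_seq; elim/big_rec: _ => [|q x qn IH].
  by rewrite dvdn1 => /eqP p1; move: pp; rewrite p1.
rewrite Euclid_dvdM// => /orP[pq|/IH//]; right; exists q.
by move: qn; rewrite mem_primes => /and3P[].
Qed.

End DedekindPsi.

(** * Mean values over n of the reciprocal sums of primes *)

Section Averages.
Variable R : realType.

(* [B] only makes the sum finite: it is taken to be at least [psi n]. *)
Definition large_prime_sum (y B n : nat) : R :=
  \sum_(p < B.+1 | prime p && (y < p)%N && (p %| dedekind_psi n)%N) p%:R^-1.

(** For each [p] the [n] concerned number at most [N / p^2] plus [164 N (1 + ln (ln N)) / p]. The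
    weight [1 / p] makes this summable over [p > y], and [165 = 164 + 1]. *)
Lemma sum_large_prime_sum_le y B N : (0 < y)%N -> 1 <= ln N%:R :> R ->
  \sum_(1 <= n < N.+1) large_prime_sum y B n <=
    N%:R * (165 * (1 + ln (ln N%:R))) / y%:R.
Proof.
move=> y0 lN; have N0 : 0 <= N%:R :> R by [].
have lnl : 0 <= ln (ln N%:R) :> R by rewrite ln_ge0.
rewrite /large_prime_sum; under eq_bigr do rewrite big_mkcondr.
rewrite exchange_big /=.
have E (p : 'I_B.+1) : prime p && (y < p)%N ->
    \sum_(1 <= n < N.+1) (if (p %| dedekind_psi n)%N then p%:R^-1 else 0) <=
    N%:R * (165 * (1 + ln (ln N%:R))) * p%:R ^- 2 :> R.
  move=> /andP[pp yp]; have p0 := prime_gt0 pp.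
  have pR : 0 < p%:R :> R by rewrite ltr0n.
  have : \sum_(1 <= n < N.+1) (if (p %| dedekind_psi n)%N then p%:R^-1 else 0) <=
      \sum_(1 <= n < N.+1) p%:R^-1 * ((p ^ 2 %| n)%N%:R +
        \sum_(q < N.+1 | prime q && (p %| q.+1)%N) (q %| n)%N%:R) :> R.
    rewrite big_nat_cond [leRHS]big_nat_cond; apply: ler_sum => n /andP[/andP[n0 nN] _].
    case: ifP => [pn|_]; last by rewrite mulr_ge0 ?invr_ge0 ?addr_ge0 ?sumr_ge0.
    rewrite -[leLHS]mulr1 ler_wpM2l ?invr_ge0//.
    have [->|[q [pq qn pq1]]] := prime_dvdn_dedekind_psi n0 pp pn.
      by rewrite lerDl sumr_ge0.
    rewrite -[leLHS]add0r lerD//.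
    have qN : (q < N.+1)%N by rewrite (leq_ltn_trans (dvdn_leq n0 qn)).
    by rewrite (bigD1 (Ordinal qN)) ?pq//= qn lerDl sumr_ge0.
  move=> /le_trans; apply; rewrite -mulr_sumr big_split /= exchange_big /=.
  rewrite -natr_sum sum_dvdn_count ?expn_gt0 ?p0//.
  have h1 := divn_ler R N (p ^ 2).
  have h2 : \sum_(q < N.+1 | prime q && (p %| q.+1)%N) \sum_(1 <= n < N.+1) (q %| n)%N%:R <=
      N%:R * (164 / p%:R * (1 + ln (ln N%:R))) :> R.
    apply: le_trans (_ : N%:R * \sum_(q < N.+1 | prime q && (p %| q.+1)%N) q%:R^-1 <= _).
      rewrite mulr_sumr; apply: ler_sum => q /andP[pq _].
      by rewrite -natr_sum sum_dvdn_count ?prime_gt0// divn_ler.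
    by rewrite ler_wpM2l// sum_inv_prime_progression_le.
  apply: le_trans (ler_wpM2l _ (lerD h1 h2)) _; first by rewrite invr_ge0 ltW.
  rewrite natrX.
  have -> : p%:R^-1 * (N%:R / p%:R ^+ 2 + N%:R * (164 / p%:R * (1 + ln (ln N%:R)))) =
      N%:R * (p%:R^-1 + 164 * (1 + ln (ln N%:R))) * p%:R ^- 2 :> R.
    by field; exact: lt0r_neq0.
  rewrite ler_wpM2r ?invr_ge0 ?exprn_ge0 ?(ltW pR)// ler_wpM2l//.
  have : p%:R^-1 <= 1 :> R by rewrite invf_le1// ler1n.
  by lra.
apply: (le_trans (ler_sum _ E)); rewrite -mulr_sumr.
apply: ler_wpM2l; first by rewrite !mulr_ge0// addr_ge0.
have [By|yB] := leqP B y.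
  rewrite big1 ?invr_ge0// => p /andP[_ yp].
  by have := ltn_ord p; rewrite ltnS leqNgt (leq_ltn_trans By yp).
apply: le_trans (sum_inv_sqr_tail R B.+1 y0).
rewrite -(big_mkord (fun p => prime p && (y < p)%N) (fun p => p%:R ^- 2)).
rewrite (@big_cat_nat _ _ _ y.+1 0 B.+1)//= ?ltnS ?(ltnW yB)//.
rewrite [X in X + _]big1_seq ?add0r.
  by rewrite big_mkcond; apply: ler_sum => p _; case: ifP.
move=> p /andP[/andP[_ yp]]; rewrite mem_index_iota ltnS /= leqNgt yp.
by [].
Qed.

(** With [L = ln (ln K)] and [d = L / ln K], [K^(-d) = 1 / ln K], so the terms beyond [K] sum to at
    most [K^(-d) / d = 1 / L <= 1], while up to [K] each [q^(-1-d)] is at most [1 / q]. Here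
    [ln d^-1 = L - ln L], and the tail turns 230 into 231. *)
Lemma progression_inv_sum_ge p K : prime p -> 1 <= ln (ln K%:R) :> R ->
  ln (ln K%:R) - ln (ln (ln K%:R)) - 231 * p%:R * (1 + ln p%:R) <=
  p%:R * \sum_(q < K.+1 | prime q && (p %| q.+1)%N) q%:R^-1 :> R.
Proof.
move=> pp lK; pose l : R := ln K%:R; pose L : R := ln l.
have l0 : 0 < l by rewrite /l ltNge; apply/negP => h; move: lK; rewrite [ln (ln _)]ln0// ler10.
have K0 : (0 < K)%N.
  by rewrite lt0n; apply/eqP => K0; move: l0; rewrite /l K0 ln0// ltxx.
have L1 : 1 <= L by [].
have L0 : 0 < L by lra.
have Ll : L < l by exact: ln_sublinear.
pose d := L / l.
have d0 : 0 < d by rewrite divr_gt0.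
have d1 : 0 < d <= 1 by rewrite d0 ler_pdivrMr// mul1r ltW.
have [y0 hy0] := progression_sum_ge pp d1.
have := hy0 (maxn y0 K) (leq_maxl _ _); set y := maxn y0 K.
have lnd : ln d^-1 = L - ln L by rewrite invf_div ln_div ?posrE.
rewrite lnd -/l -/L.
have Ky : (K <= y)%N by exact: leq_maxr.
have : \sum_(q < y.+1 | prime q && (p %| q.+1)%N) npow (1 + d) q <=
    \sum_(q < K.+1 | prime q && (p %| q.+1)%N) q%:R^-1 + 1.
  rewrite -(big_mkord (fun q => prime q && (p %| q.+1)%N) (npow (1 + d))).
  rewrite -(big_mkord (fun q => prime q && (p %| q.+1)%N) (fun q => q%:R^-1)).
  rewrite (@big_cat_nat _ _ _ K.+1 0 y.+1)//=; apply: lerD.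
    apply: ler_sum => q /andP[pq _]; rewrite -npow_inv ?prime_gt0//.
    by rewrite ler_npow_exp ?prime_gt0// lerDl ltW.
  apply: (@le_trans _ _ (\sum_(K.+1 <= q < y.+1) npow (1 + d) q)).
    rewrite big_mkcond; apply: ler_sum => q _; case: ifP => // _.
    exact/ltW/npow_gt0.
  apply: le_trans (sum_npow_tail _ d0 K0) _.
  rewrite ler_pdivrMr// mul1r /npow -/l /d divfK ?lt0r_neq0// expRN.
  rewrite /L lnK ?posrE// -[leLHS]mul1r ler_wpM2r// invr_ge0; exact: ltW.
set S := \sum_(q < y.+1 | _) _; set T := \sum_(q < K.+1 | _) _ => ST h.
have T0 : 0 <= T by exact: sumr_ge0.
have p1 : p.-1%:R <= p%:R :> R by rewrite ler_nat leq_pred.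
have h1 : p.-1%:R * S <= p.-1%:R * (T + 1) by rewrite ler_wpM2l.
have h2 : p.-1%:R * (T + 1) <= p%:R * (T + 1) by rewrite ler_wpM2r//; lra.
have h3 : 0 <= p%:R * ln p%:R :> R by rewrite mulr_ge0// ln_ge0// ler1n prime_gt0.
by lra.
Qed.

Definition missing_prime_sum (y n : nat) : R :=
  \sum_(p < y.+1 | prime p && ~~ (p %| dedekind_psi n)%N) p%:R^-1.

(** Turan's bound leaves at most [3 N p / L] integers whose psi-value misses [p]; the weight [1 / p]
    cancels the [p], and there are at most [y.+1] primes. *)
Lemma sum_missing_prime_sum_le y K N (L : R) : (K ^ 2 <= N)%N -> 0 < L ->
  (forall p, prime p -> (p <= y)%N ->
    L <= p%:R * \sum_(q < K.+1 | prime q && (p %| q.+1)%N) q%:R^-1) ->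
  \sum_(1 <= n < N.+1) missing_prime_sum y n <= 3 * N%:R * y.+1%:R / L.
Proof.
move=> KN L0 hL; rewrite /missing_prime_sum; under eq_bigr do rewrite big_mkcondr.
rewrite exchange_big /=.
have E (p : 'I_y.+1) : prime p ->
    \sum_(1 <= n < N.+1) (if ~~ (p %| dedekind_psi n)%N then p%:R^-1 else 0) <=
    3 * N%:R / L.
  move=> pp; have pR : 0 < p%:R :> R by rewrite ltr0n prime_gt0.
  have py : (p <= y)%N by rewrite -ltnS.
  have := turan_sieve R (fun q => p %| q.+1)%N KN.
  set c := (\sum_(1 <= n < N.+1) _)%N; set s := \sum_(q < K.+1 | _) _ => cs.
  apply: (@le_trans _ _ (c%:R * p%:R^-1)).
    rewrite /c natr_sum mulr_suml big_nat_cond [leRHS]big_nat_cond.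
    apply: ler_sum => n /andP[/andP[n0 _] _].
    case: ifP => [pn|_]; last by rewrite mulr_ge0 ?invr_ge0.
    have -> : [forall q : 'I_K.+1, prime q && (p %| q.+1)%N ==> ~~ (q %| n)%N].
      apply/forallP => q; apply/implyP => /andP[pq pq1]; apply: contra pn => qn.
      by apply: (dvdn_trans pq1); exact: dvdn_succ_dedekind_psi.
    by rewrite mul1r.
  rewrite ler_pdivlMr// mulrAC -mulrA.
  apply: le_trans cs; apply: ler_wpM2l => //.
  by rewrite ler_pdivrMr// mulrC; exact: hL.
apply: (le_trans (ler_sum _ E)).
rewrite big_mkcond; apply: (@le_trans _ _ (\sum_(p < y.+1) 3 * N%:R / L)).
  by apply: ler_sum => p _; case: ifP => // _; rewrite divr_ge0 ?mulr_ge0// (ltW L0).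
by rewrite sumr_const card_ord -[leLHS]mulr_natr mulrAC.
Qed.

End Averages.

(** * Mertens' theorem *)

Section MertensFirst.
Variable R : realType.

Lemma sum_ln_primes_le N : (0 < N)%N -> \sum_(q < N.+1 | prime q) ln q%:R <= 80 * N%:R :> R.
Proof.
move=> N0; have N1 : 1 <= N%:R :> R by rewrite ler1n.
have l0 : 0 < ln N.+1%:R :> R by rewrite ln_gt0// ltr1n.
have := @primes_in_progression_le R 1 N.+1 (or_intror erefl) N0.
rewrite ler_pdivlMr// => h.
apply: (@le_trans _ _ (40 * N.+1%:R)); last by rewrite -[N.+1%:R]natr1; lra.
apply: le_trans h; rewrite natr_sum mulr_suml big_mkcond; apply: ler_sum => q _.
rewrite mul1n addn0; case: ifP => [pq|_] /=; last by rewrite mul0r.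
by rewrite mul1r ler_ln ?ler_nat ?posrE ?ltr0n ?(ltnW (ltn_ord q))// prime_gt0.
Qed.

Lemma sum_ln_inv_le N : \sum_(2 <= n < N.+1) ln n%:R / (n%:R * n.-1%:R) <= 2 :> R.
Proof.
rewrite big_add1 /=.
(* The same telescoping majorant as in [npow_variation], the integral of [(ln x + 1) / x^2]. *)
suff : forall M, (0 < M)%N -> \sum_(1 <= n < M) ln n.+1%:R / (n.+1%:R * n%:R) <=
    2 - (ln M%:R + 2) / M%:R :> R.
  move=> h; have [->|N0] := posnP N; first by rewrite big_geq.
  apply: (le_trans (h N N0)); rewrite gerBl divr_ge0// addr_ge0//.
  by rewrite ln_ge0// ler1n.
case=> // M _; elim: M => [|M IH]; first by rewrite big_geq// ln1 divr1; lra.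
rewrite big_nat_recr//= (le_trans (lerD IH (lexx _)))//.
have t1 : 1 <= M.+1%:R :> R by rewrite ler1n.
have h := ln_succ_sub_le R (ltn0Sn M).
set L := ln M.+1%:R in h *; set L' := ln M.+2%:R in h *.
rewrite -[M.+2%:R]natr1; move: (M.+1%:R : R) t1 h => t t1 h.
rewrite -subr_ge0.
have -> : 2 - (L' + 2) / (t + 1) - (2 - (L + 2) / t + L' / ((t + 1) * t)) =
    (2 - (L' - L) * (t + 1)) / (t * (t + 1)) by field; lra.
have : (L' - L) * (t + 1) <= t^-1 * (t + 1) by rewrite ler_wpM2r//; lra.
have -> : t^-1 * (t + 1) = 1 + t^-1 by field; lra.
have : t^-1 <= 1 by rewrite invf_le1//; lra.
by move=> ? ?; rewrite divr_ge0 ?mulr_ge0//; lra.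
Qed.

Lemma sum_primes_ln_inv_le N : \sum_(q < N.+1 | prime q) ln q%:R / (q%:R * q.-1%:R) <= 2 :> R.
Proof.
apply: le_trans (sum_ln_inv_le N).
rewrite -(big_mkord prime (fun q => ln q%:R / (q%:R * q.-1%:R))) big_mkcond.
have [N1|N1] := ltnP N 2.
  rewrite [leRHS]big_geq// big_nat_cond big1// => n /andP[/andP[_ nN] _].
  by case: ifP => // /prime_gt1; lia.
rewrite (@big_cat_nat _ _ _ 2 0 N.+1)//=; last exact: ltnW.
rewrite [X in X + _](_ : _ = 0) ?add0r; last by rewrite big_nat_recr//= big_nat1 addr0.
rewrite big_nat_cond [leRHS]big_nat_cond.
apply: ler_sum => n /andP[/andP[n1 _] _]; case: ifP => // _.
by rewrite divr_ge0 ?mulr_ge0// ln_ge0// ler1n ltnW.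
Qed.

Definition ln_fact (N : nat) : R := \sum_(1 <= n < N.+1) ln n%:R.

Lemma ln_fact_le N : ln_fact N <= N%:R * ln N%:R.
Proof.
rewrite /ln_fact mulr_natl -[X in _ *+ X](subn0 N) -subSS -sumr_const_nat.
rewrite big_nat_cond [leRHS]big_nat_cond; apply: ler_sum => n /andP[/andP[n0 nN] _].
by rewrite ler_ln ?posrE ?ltr0n ?ler_nat// (leq_trans n0).
Qed.

Lemma ln_fact_ge N : N%:R * ln N%:R - N%:R <= ln_fact N.
Proof.
elim: N => [|N IH]; first by rewrite /ln_fact big_geq// mul0r subr0.
rewrite /ln_fact big_nat_recr//= -/(ln_fact N).
have [->|N0] := posnP N; first by rewrite ln1 /ln_fact big_geq//; lra.
have nR : 0 < N%:R :> R by rewrite ltr0n.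
have h : N%:R * (ln N.+1%:R - ln N%:R) <= 1 :> R.
  rewrite mulrC -ler_pdivlMr// mul1r; exact: ln_succ_sub_le.
move: IH h; set l' := ln N.+1%:R; rewrite -[N.+1%:R]natr1; lra.
Qed.

Lemma ln_nat_logn n z : (0 < n <= z)%N ->
  ln n%:R = \sum_(q < z.+1 | prime q) (logn q n)%:R * ln q%:R :> R.
Proof.
move=> /andP[n0 nz]; rewrite [in LHS](prod_prime_decomp n0) prime_decompE big_map /=.
rewrite (bigID (fun q : 'I_z.+1 => (q %| n)%N)) /= [X in _ + X]big1 ?addr0; last first.
  move=> q /andP[pq qn]; suff -> : logn q n = 0%N by rewrite mul0r.
  by apply/eqP; rewrite -leqn0 leqNgt logn_gt0 mem_primes pq n0.
rewrite (big_ord_primes _ (fun q => (logn q n)%:R * ln q%:R)) ?n0//.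
have : all prime (primes n) by apply/allP => q; rewrite mem_primes => /andP[].
elim: (primes n) => [|q s IH] /=; first by rewrite !big_nil ln1.
move=> /andP[pq ps]; have q0 := prime_gt0 pq.
have s0 : (0 < \prod_(j <- s) j ^ logn j n)%N.
  rewrite big_seq; elim/big_ind: _ => [|x y x0 y0|l ls]; first by [].
    by rewrite muln_gt0 x0.
  by rewrite expn_gt0 prime_gt0//; exact: (allP ps).
rewrite !big_cons natrM lnM ?posrE ?ltr0n ?expn_gt0 ?q0//.
by rewrite IH// natrX lnXn ?ltr0n// mulr_natl.
Qed.

Lemma logn_sum_fact q N : (\sum_(1 <= n < N.+1) logn q n = logn q N`!)%N.
Proof.
elim: N => [|N IH]; first by rewrite big_geq// logn1.
by rewrite big_nat_recr//= IH factS lognM ?fact_gt0// addnC.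
Qed.

Lemma logn_fact_le q N : prime q -> (logn q N`!)%:R <= N%:R / q.-1%:R :> R.
Proof.
move=> pq; rewrite logn_fact// natr_sum.
have q1 : 1 < q%:R :> R by rewrite ltr1n prime_gt1.
have q1E : q.-1%:R = q%:R - 1 :> R by rewrite -subn1 natrB// prime_gt0.
apply: (@le_trans _ _ (\sum_(1 <= k < N.+1) N%:R / q%:R ^+ k)).
  by apply: ler_sum => k _; rewrite -natrX divn_ler.
rewrite -mulr_sumr ler_wpM2l// q1E.
have -> : \sum_(1 <= k < N.+1) q%:R ^- k = (1 - q%:R ^- N) / (q%:R - 1) :> R.
  elim: N => [|N IH]; first by rewrite big_geq// expr0 invr1 subrr mul0r.
  rewrite big_nat_recr//= IH exprSr.
  have : q%:R ^+ N != 0 :> R by rewrite expf_neq0// gt_eqF//; lra.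
  move: (q%:R ^+ N : R) => t t0; field.
  by rewrite t0 andbT; apply/andP; split; apply: lt0r_neq0; lra.
rewrite -[leRHS]mul1r ler_wpM2r ?invr_ge0//; lra.
Qed.

Definition prime_log_sum (N : nat) : R := \sum_(q < N.+1 | prime q) ln q%:R / q%:R.

(** [ln N!] is evaluated directly and through Legendre's formula. In one direction higher prime
    powers add at most [2 N]; in the other they are dropped, and the floors cost the sum of [ln q],
    at most [80 N] by the sieve with [a = 1]. *)
Lemma mertens_first N : (0 < N)%N -> `|prime_log_sum N - ln N%:R| <= 80.
Proof.
move=> N0; have nR : 0 < N%:R :> R by rewrite ltr0n.
have lfE : ln_fact N = \sum_(q < N.+1 | prime q) (logn q N`!)%:R * ln q%:R.
  rewrite /ln_fact (eq_big_nat _ _ (F2 := fun n =>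
    \sum_(q < N.+1 | prime q) (logn q n)%:R * ln q%:R)); last first.
    by move=> n nN; rewrite -ln_nat_logn.
  rewrite exchange_big /=; apply: eq_bigr => q _.
  by rewrite -mulr_suml -natr_sum logn_sum_fact.
have lnq (q : 'I_N.+1) : prime q -> 0 <= ln q%:R :> R.
  by move=> pq; rewrite ln_ge0// ler1n prime_gt0.
rewrite ler_norml; apply/andP; split.
  have h1 : ln_fact N <= N%:R * (prime_log_sum N + 2).
    rewrite lfE; apply: (@le_trans _ _ (\sum_(q < N.+1 | prime q) N%:R / q.-1%:R * ln q%:R)).
      by apply: ler_sum => q pq; rewrite ler_wpM2r ?lnq// logn_fact_le.
    rewrite /prime_log_sum mulrDr.
    have -> : \sum_(q < N.+1 | prime q) N%:R / q.-1%:R * ln q%:R =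
      N%:R * \sum_(q < N.+1 | prime q) ln q%:R / q%:R +
      N%:R * \sum_(q < N.+1 | prime q) ln q%:R / (q%:R * q.-1%:R) :> R.
      rewrite -mulrDr -big_split mulr_sumr; apply: eq_bigr => q pq /=.
      have q1 : 1 < q%:R :> R by rewrite ltr1n prime_gt1.
      rewrite -subn1 natrB ?prime_gt0//.
      by field; apply/andP; split; apply: lt0r_neq0; lra.
    by rewrite lerD2l ler_wpM2l// sum_primes_ln_inv_le.
  have := le_trans (ln_fact_ge N) h1.
  have -> : N%:R * ln N%:R - N%:R = N%:R * (ln N%:R - 1) :> R by ring.
  by rewrite ler_pM2l//; lra.
have h1 : N%:R * prime_log_sum N - 80 * N%:R <= ln_fact N.
  apply: (@le_trans _ _ (\sum_(q < N.+1 | prime q) (N%:R / q%:R - 1) * ln q%:R)).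
    under [leRHS]eq_bigr do rewrite mulrBl mul1r.
    rewrite sumrB; apply: lerB; last exact: sum_ln_primes_le.
    rewrite /prime_log_sum mulr_sumr le_eqVlt; apply/orP; left; apply/eqP.
    by apply: eq_bigr => q _; rewrite mulrA mulrAC.
  rewrite lfE; apply: ler_sum => q pq; rewrite ler_wpM2r ?lnq//.
  apply: le_trans (divn_ger R N (prime_gt0 pq)) _.
  rewrite ler_nat -sum_dvdn_count ?prime_gt0// -logn_sum_fact.
  rewrite big_nat_cond [leqRHS]big_nat_cond; apply: leq_sum => n /andP[/andP[n0 _] _].
  by case: (boolP (q %| n)%N) => // qn; rewrite logn_gt0 mem_primes pq n0 qn.
have := le_trans h1 (ln_fact_le N).
have -> : N%:R * prime_log_sum N - 80 * N%:R = N%:R * (prime_log_sum N - 80) by ring.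
by rewrite ler_pM2l//; lra.
Qed.

End MertensFirst.

Section ExponentialBounds.
Variable R : realType.

Lemma expR1_ge2 : 2 <= expR 1 :> R.
Proof. by have := expR_ge1Dx (1 : R); lra. Qed.

Lemma expR_le1D2 (u : R) : 0 <= u <= 2^-1 -> expR u <= 1 + 2 * u.
Proof.
move=> /andP[u0 u1]; rewrite -[u in leLHS]opprK expRN -[leRHS]invrK.
rewrite lef_pV2 ?posrE ?expR_gt0 ?invr_gt0//; last lra.
apply: le_trans (expR_ge1Dx _); rewrite -[leLHS]mul1r ler_pdivrMr; last lra.
by nra.
Qed.

Lemma one_sub_expRN (d : R) : 0 < d -> d / (1 + d) <= 1 - expR (- d) <= d.
Proof.
move=> d0; apply/andP; split; last by have := expR_ge1Dx (- d); lra.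
have : (expR d)^-1 <= (1 + d)^-1 by rewrite lef_pV2 ?posrE ?expR_gt0 ?expR_ge1Dx//; lra.
have -> : d / (1 + d) = 1 - (1 + d)^-1 by field; lra.
by rewrite expRN; lra.
Qed.

Lemma truncn_expR (u : R) : 0 <= u ->
  [/\ (0 < Num.truncn (expR u))%N, (Num.truncn (expR u))%:R <= expR u,
      u <= (Num.truncn (expR u))%:R, expR (u - 1) <= (Num.truncn (expR u))%:R
    & u - 1 <= ln (Num.truncn (expR u))%:R <= u].
Proof.
move=> u0; have /andP[h1 h2] := truncn_itv (expR_ge0 u).
have y0 : (0 < Num.truncn (expR u))%N by rewrite truncn_gt0 -expR0 ler_expR.
have y1 : 1 <= (Num.truncn (expR u))%:R :> R by rewrite ler1n.
have e1 := expR_ge1Dx u; have e2 := expR1_ge2.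
move: h1 h2; rewrite -natr1; move: (Num.truncn _) y0 y1 => y y0 y1 h1 h2.
have e3 : expR (u - 1) <= y%:R.
  by rewrite expRD expRN ler_pdivrMr ?expR_gt0//; nra.
split=> //; first by lra.
by apply/andP; split; rewrite -ler_expR lnK ?posrE ?ltr0n.
Qed.

End ExponentialBounds.

(** * Reciprocals of primes along powers of e *)

Section MertensSecond.
Variable R : realType.

(** On the block from [expfloor k] to [expfloor k.+1], [ln q] lies in [[k, k + 1]]. Partial
    summation then runs over the integers [k], and harmonic numbers take the place of
    [ln (ln y)]. *)
Definition expfloor (k : nat) : nat := Num.truncn (expR k%:R : R).

Lemma expfloor_itv k : (expfloor k)%:R <= (expR k%:R : R) < (expfloor k).+1%:R.
Proof. by rewrite truncn_itv// expR_ge0. Qed.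

Lemma expfloor_gt0 k : (0 < expfloor k)%N.
Proof. by have [] := truncn_expR (ler0n R k). Qed.

Lemma expfloor_ge k : (k <= expfloor k)%N.
Proof. by have [_ _ + _ _] := truncn_expR (ler0n R k); rewrite ler_nat. Qed.

Lemma expfloor_le k l : (k <= l)%N -> (expfloor k <= expfloor l)%N.
Proof. by move=> kl; apply: le_truncn; rewrite ler_expR ler_nat. Qed.

Lemma expfloor0 : expfloor 0 = 1%N.
Proof. by rewrite /expfloor expR0 truncn1. Qed.

Lemma ln_expfloor k : k%:R - 1 <= (ln (expfloor k)%:R : R) <= k%:R.
Proof. by have [] := truncn_expR (ler0n R k). Qed.

Lemma ln_block k q : (expfloor k < q <= expfloor k.+1)%N ->
  k%:R <= (ln q%:R : R) <= k.+1%:R.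
Proof.
move=> /andP[kq qk].
have q0 : (0 < q)%N by exact: leq_ltn_trans kq.
have /andP[_ h1] := expfloor_itv k; have /andP[h2 _] := expfloor_itv k.+1.
apply/andP; split; rewrite -ler_expR lnK ?posrE ?ltr0n//.
  by apply: (le_trans (ltW h1)); rewrite ler_nat.
by apply: le_trans h2; rewrite ler_nat.
Qed.

Lemma sum_primes_block (f : nat -> R) k :
  \sum_(q < (expfloor k.+1).+1 | prime q) f q =
  \sum_(q < (expfloor k).+1 | prime q) f q +
  \sum_((expfloor k).+1 <= q < (expfloor k.+1).+1 | prime q) f q.
Proof.
rewrite -!(big_mkord prime f) (@big_cat_nat _ _ _ (expfloor k).+1)//=.
by rewrite ltnS expfloor_le.
Qed.

Let E k := prime_log_sum R (expfloor k) - k%:R.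

Let E_le k : `|E k| <= 81.
Proof.
have h := mertens_first R (expfloor_gt0 k).
have /andP[h2 h1] := ln_expfloor k.
by move: h; rewrite /E !ler_norml => /andP[? ?]; apply/andP; split; lra.
Qed.

(** The boundary term [E k / k] of partial summation is removed, so that the increments are
    [O(1/k - 1/(k+1))] and telescope. *)
Let Phi k := \sum_(q < (expfloor k).+1 | prime q) q%:R^-1
  - \sum_(1 <= j < k.+1) j%:R^-1 - E k / k%:R.

Let Phi_step k : (0 < k)%N -> `|Phi k.+1 - Phi k| <= 244 * (k%:R^-1 - k.+1%:R^-1).
Proof.
move=> k0; have kR : 0 < k%:R :> R by rewrite ltr0n.
rewrite /Phi (sum_primes_block (fun q => q%:R^-1)) big_nat_recr//=.
set b := \sum_(_ <= q < _ | prime q) q%:R^-1.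
pose w : R := \sum_((expfloor k).+1 <= q < (expfloor k.+1).+1 | prime q) ln q%:R / q%:R.
have wE : w = 1 + E k.+1 - E k.
  rewrite /E /prime_log_sum (sum_primes_block (fun q => ln q%:R / q%:R)) -/w.
  by rewrite -natr1; ring.
have q0 q : ((expfloor k).+1 <= q < (expfloor k.+1).+1)%N -> 0 < q%:R :> R.
  by move=> /andP[h _]; rewrite ltr0n (leq_ltn_trans _ h).
have b1 : k%:R * b <= w.
  rewrite /b /w mulr_sumr big_nat_cond [leRHS]big_nat_cond.
  apply: ler_sum => q /andP[qb _]; rewrite ler_wpM2r ?invr_ge0//.
  by have /andP[] := @ln_block k q qb.
have b2 : w <= k.+1%:R * b.
  rewrite /b /w mulr_sumr big_nat_cond [leRHS]big_nat_cond.
  apply: ler_sum => q /andP[qb _]; rewrite ler_wpM2r ?invr_ge0//.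
  by have /andP[] := @ln_block k q qb.
have := E_le k; have := E_le k.+1.
rewrite !ler_norml => /andP[e1 e2] /andP[e3 e4].
set A := \sum_(q < _ | _) _; set H := \sum_(1 <= j < k.+1) _.
rewrite -[k.+1%:R]natr1 in b2 *; move: (k%:R : R) kR b1 b2 => t t0 b1 b2.
have t1 : 0 < t + 1 by lra.
have -> : A + b - (H + (t + 1)^-1) - E k.+1 / (t + 1) - (A - H - E k / t) =
    (b - w / (t + 1)) + E k * (t^-1 - (t + 1)^-1).
  by rewrite wE; field; lra.
have d0 : 0 < t^-1 - (t + 1)^-1.
  by rewrite subr_gt0 ltf_pV2 ?posrE//; lra.
have c1 : 0 <= b - w / (t + 1) by rewrite subr_ge0 ler_pdivrMr// mulrC.
have c2 : b - w / (t + 1) <= 163 * (t^-1 - (t + 1)^-1).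
  apply: (@le_trans _ _ (w * (t^-1 - (t + 1)^-1))).
    rewrite mulrBr lerD2r ler_pdivlMr// mulrC; exact: b1.
  by rewrite ler_wpM2r ?(ltW d0)//; lra.
move: (t^-1 - (t + 1)^-1) (b - w / (t + 1)) d0 c1 c2 => dd c dd0 c1 c2.
have c3 : E k * dd <= 81 * dd by rewrite ler_wpM2r// ltW.
have c4 : - 81 * dd <= E k * dd by rewrite ler_wpM2r// ltW.
by apply/andP; split; lra.
Qed.

(** A Cauchy estimate, since the limit is identified only later; [406 = 244 + 2 * 81], the
    telescoped increments and the two boundary terms. *)
Lemma mertens_second k l : (0 < k <= l)%N ->
  `|(\sum_(q < (expfloor l).+1 | prime q) q%:R^-1 - \sum_(1 <= j < l.+1) j%:R^-1) -
    (\sum_(q < (expfloor k).+1 | prime q) q%:R^-1 - \sum_(1 <= j < k.+1) j%:R^-1)|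
  <= 406 / k%:R :> R.
Proof.
move=> /andP[k0 kl]; have kR : 0 < k%:R :> R by rewrite ltr0n.
have : `|Phi l - Phi k| <= 244 * (k%:R^-1 - l%:R^-1).
  rewrite -(subnKC kl); elim: (l - k)%N => [|n IH].
    by rewrite addn0 !subrr mulr0 normr0.
  rewrite addnS; have := @Phi_step (k + n)%N (leq_trans k0 (leq_addr _ _)).
  have -> : Phi (k + n)%N.+1 - Phi k = (Phi (k + n)%N.+1 - Phi (k + n)%N) + (Phi (k + n)%N - Phi k).
    by ring.
  move=> h; apply: (le_trans (ler_normD _ _)); apply: (le_trans (lerD h IH)).
  by rewrite -mulrDr addrC addrA subrK.
have lR : 0 < l%:R :> R by rewrite ltr0n (leq_trans k0).
have lk : l%:R^-1 <= k%:R^-1 :> R by rewrite lef_pV2 ?posrE// ler_nat.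
have l0 : 0 < l%:R^-1 :> R by rewrite invr_gt0.
have El : `|E l / l%:R| <= 81 / k%:R.
  by rewrite normrM; apply: ler_pM => //; rewrite gtr0_norm.
have Ek : `|E k / k%:R| <= 81 / k%:R.
  by rewrite normrM; apply: ler_pM => //; rewrite gtr0_norm ?invr_gt0.
move: El Ek; rewrite /Phi; set a := E l / l%:R; set b := E k / k%:R.
rewrite !ler_norml => /andP[? ?] /andP[? ?] /andP[? ?].
by apply/andP; split; lra.
Qed.

(** Subtracting the harmonic number instead of [ln k] builds Euler's constant in: the limit to be
    identified is 0. *)
Definition mertens_log (k : nat) : R :=
  \sum_(q < (expfloor k).+1 | prime q) - ln (1 - q%:R^-1)
  - \sum_(1 <= j < k.+1) j%:R^-1.

Lemma ln1B_bounds (z : R) : 0 <= z <= 2^-1 -> 0 <= - ln (1 - z) - z <= 2 * z ^+ 2.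
Proof.
move=> /andP[z0 z1]; have h1 : ln (1 - z) <= - z by rewrite le_ln1Dx//; lra.
have h2 : - ln (1 - z) <= z / (1 - z).
  rewrite -lnV ?posrE; last by lra.
  rewrite [X in ln X](_ : _ = 1 + z / (1 - z)); last by field; lra.
  rewrite le_ln1Dx// (@lt_le_trans _ _ 0)// ?divr_ge0//; lra.
have h3 : z / (1 - z) <= z + 2 * z ^+ 2.
  by rewrite ler_pdivrMr; [nra|lra].
by apply/andP; split; lra.
Qed.

Lemma mertens_log_oscillation k l : (0 < k <= l)%N ->
  `|mertens_log l - mertens_log k| <= 410 / k%:R.
Proof.
move=> kl; have /andP[k0 kl'] := kl.
have kR : 0 < k%:R :> R by rewrite ltr0n.
pose f q : R := - ln (1 - q%:R^-1) - q%:R^-1.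
have split_sum m : mertens_log m =
    (\sum_(q < (expfloor m).+1 | prime q) q%:R^-1 - \sum_(1 <= j < m.+1) j%:R^-1)
    + \sum_(q < (expfloor m).+1 | prime q) f q.
  rewrite /mertens_log addrAC -big_split /=; congr (_ - _).
  by apply: eq_bigr => q _; rewrite /f; ring.
have f_bounds q : prime q -> 0 <= f q <= 2 * q%:R ^- 2.
  move=> pq; rewrite /f -exprVn; apply: ln1B_bounds.
  by rewrite invr_ge0 ler0n/= lef_pV2 ?posrE ?ltr0n ?prime_gt0// ler_nat prime_gt1.
have tail : 0 <= \sum_(q < (expfloor l).+1 | prime q) f q -
    \sum_(q < (expfloor k).+1 | prime q) f q <= 4 / k%:R.
  rewrite -!(big_mkord prime f) (@big_cat_nat _ _ _ (expfloor k).+1 0 (expfloor l).+1)//=;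
    last by rewrite ltnS expfloor_le.
  rewrite addrAC subrr add0r; apply/andP; split.
    by apply: sumr_ge0 => q /f_bounds/andP[].
  apply: (@le_trans _ _ (\sum_((expfloor k).+1 <= q < (expfloor l).+1) 2 * q%:R ^- 2)).
    rewrite big_mkcond; apply: ler_sum => q _; case: ifP => [/f_bounds/andP[]//|_].
    by rewrite mulr_ge0// invr_ge0 exprn_ge0.
  rewrite -mulr_sumr.
  have := @sum_inv_sqr_tail R (expfloor k) (expfloor l).+1 (expfloor_gt0 k).
  have : (expfloor k)%:R^-1 <= k%:R^-1 :> R.
    by rewrite lef_pV2 ?posrE ?ltr0n ?expfloor_gt0// ler_nat expfloor_ge.
  have : 0 < k%:R^-1 :> R by rewrite invr_gt0.
  by lra.
have := mertens_second kl; rewrite !split_sum !ler_norml => /andP[? ?].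
by move: tail => /andP[? ?]; apply/andP; split; lra.
Qed.

End MertensSecond.

(** * Identification of the constant in Mertens' product *)

Section MertensConstant.
Variable R : realType.
Local Notation npow := (@npow R).

Let g (q : nat) : R := - ln (1 - q%:R^-1).

Let inv_prime q : prime q -> 0 < (q%:R^-1 : R) <= 2^-1.
Proof.
move=> pq; rewrite invr_gt0 ltr0n prime_gt0//=.
by rewrite lef_pV2 ?posrE ?ltr0n ?prime_gt0// ler_nat prime_gt1.
Qed.

Let g_ge0 q : prime q -> 0 <= g q.
Proof.
by move=> /inv_prime/andP[h1 h2]; rewrite /g oppr_ge0 ln_le0//; lra.
Qed.

Lemma ln1B_ge (z : R) : 0 <= z <= 2^-1 -> - (2 * z) <= ln (1 - z).
Proof.
move=> z01; have /andP[_ h] := ln1B_bounds z01.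
by move: z01 => /andP[? ?]; nra.
Qed.

(** The error must tend to 0 with [d], unlike in [zeta_log]: the truncated zeta sum lies between
    [(1 - d/2) / d] and [(1 + d) / d], and the Euler product is taken to precision [d / 2]. *)
Lemma sum_ln_zeta (d : R) : 0 < d <= 2^-1 -> exists y0, forall y, (y0 <= y)%N ->
  `|\sum_(q < y.+1 | prime q) - ln (1 - npow (1 + d) q) - ln d^-1| <= 2 * d.
Proof.
move=> /andP[d0 d1].
have npow01 q : prime q -> 0 < npow (1 + d) q <= 2^-1.
  move=> pq; rewrite npow_gt0/=.
  have /andP[_] := inv_prime pq; apply: le_trans.
  rewrite npowD npow_inv ?prime_gt0// ler_piMr ?invr_ge0//.
  by rewrite npow_le1 ?(ltW d0)// prime_gt0.
have d20 : 0 < d / 2 by lra.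
have [m m0 hm] := npow_small d0 d20.
have aM i j : (0 < i)%N -> (0 < j)%N -> npow (1 + d) (i * j) = npow (1 + d) i * npow (1 + d) j.
  exact: npowM.
have le1 n : (0 < n)%N -> `|npow (1 + d) n| <= 1.
  by move=> n0; rewrite gtr0_norm ?npow_gt0// npow_le1//; lra.
have tail (e : R) : 0 < e -> exists m0, forall m M, (m0 <= m)%N ->
    \sum_(m <= n < M) `|npow (1 + d) n| <= e.
  move=> e0; have [k k0 hk] := npow_small d0 (mulr_gt0 e0 d0).
  exists k.+1 => -[//|i] M ki; under eq_bigr do rewrite gtr0_norm ?npow_gt0//.
  apply: le_trans (sum_npow_tail _ d0 (leq_trans k0 ki)) _; rewrite ler_pdivrMr//.
  by apply: le_trans hk; apply: ler_npow (ltW d0) _; rewrite k0.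
have [y0 hy0] := @euler_product R (npow (1 + d)) (npow1 _) aM le1 tail _ d20.
exists y0 => y /hy0[M0 /(_ (maxn M0 m) (leq_maxl _ _))].
set M := maxn M0 m; set Z := \sum_(1 <= n < M.+1) _.
set P := \prod_(q < _ | _) _.
have Z1 : Z <= 1 + d^-1 by exact: sum_npow_le.
have Z2 : (1 - d / 2) / d <= Z.
  apply: le_trans (sum_npow_ge _ d0); rewrite ler_pM2r ?invr_gt0// lerD2l lerN2.
  apply: le_trans hm; apply: ler_npow (ltW d0) _.
  by rewrite m0/= (leq_trans (leq_maxr M0 m)).
have Z0 : 0 < Z by apply: lt_le_trans Z2; rewrite divr_gt0//; lra.
have P0 : 0 < P by apply: prodr_gt0 => q /npow01/andP[? ?]; lra.
have -> : \sum_(q < y.+1 | prime q) - ln (1 - npow (1 + d) q) = - ln P.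
  rewrite sumrN /P; congr (- _).
  rewrite -[LHS]expRK expR_sum; congr ln; apply: eq_bigr => q /npow01/andP[? ?].
  by rewrite lnK// posrE; lra.
rewrite ler_norml lerBlDr lerBrDr => /andP[h1 h2].
have -> : - ln P = ln Z - ln (P * Z) by rewrite lnM// opprD addrCA subrr addr0.
have dV : 0 < d^-1 by rewrite invr_gt0.
have k1 : ln Z <= d + ln d^-1.
  apply: (@le_trans _ _ (ln ((1 + d) * d^-1))).
    rewrite ler_ln ?posrE ?mulr_gt0//; last lra.
    by rewrite mulrDl mul1r mulfV ?gt_eqF// addrC.
  by rewrite lnM ?posrE//; [rewrite lerD2r le_ln1Dx//|]; lra.
have k2 : - d + ln d^-1 <= ln Z.
  apply: (@le_trans _ _ (ln ((1 - d / 2) * d^-1))); last first.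
    by rewrite ler_ln ?posrE// mulr_gt0//; lra.
  rewrite lnM ?posrE//; last lra.
  by rewrite lerD2r; have := @ln1B_ge (d / 2); lra.
have PZ0 : 0 < P * Z by rewrite mulr_gt0.
have k3 : ln (P * Z) <= d.
  apply: (@le_trans _ _ (ln (1 + d))); last by rewrite le_ln1Dx//; lra.
  by rewrite ler_ln ?posrE//; lra.
have k4 : - d <= ln (P * Z).
  apply: (@le_trans _ _ (ln (1 - d / 2))); last by rewrite ler_ln ?posrE//; lra.
  by have := @ln1B_ge (d / 2); lra.
by rewrite ler_norml; apply/andP; split; lra.
Qed.

(** With [z = 1/q] and [v = q^(-d)] this exchanges [- ln (1 - q^(-1-d))] for [q^(-d)] times the
    Mertens term. Both begin with [z * v], and the quadratic error keeps the factor
    [1 - v <= d ln q], so it sums to [O(d)]. *)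
Lemma ln1B_scale (z v : R) : 0 < z <= 2^-1 -> 0 < v <= 1 ->
  `|v * - ln (1 - z) + ln (1 - z * v)| <= 2 * z ^+ 2 * (1 - v).
Proof.
move=> /andP[z0 z1] /andP[v0 v1].
have zv : z * v <= z by rewrite ler_piMr// ltW.
have z2 : 0 < 1 - z by lra.
have zv2 : 0 < 1 - z * v by lra.
have -> : v * - ln (1 - z) + ln (1 - z * v) =
    ln ((1 - z * v) / (1 - z)) + (1 - v) * ln (1 - z).
  by rewrite ln_div ?posrE//; ring.
have a1 : ln ((1 - z * v) / (1 - z)) <= z * (1 - v) / (1 - z).
  rewrite [X in ln X](_ : _ = 1 + z * (1 - v) / (1 - z)); last by field; lra.
  by rewrite le_ln1Dx// (@lt_le_trans _ _ 0)// ?divr_ge0 ?mulr_ge0//; lra.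
have a2 : z * (1 - v) <= ln ((1 - z * v) / (1 - z)).
  rewrite -[leRHS]opprK -lnV ?posrE ?divr_gt0// lerNr.
  rewrite [X in ln X](_ : _ = 1 + - (z * (1 - v) / (1 - z * v))); last first.
    by field; apply/andP; split; lra.
  apply: (@le_trans _ _ (- (z * (1 - v) / (1 - z * v)))).
    by rewrite le_ln1Dx// ltrN2 ltr_pdivrMr// mul1r; lra.
  rewrite lerN2 ler_pdivlMr//; have : 0 <= z * (1 - v) by rewrite mulr_ge0//; lra.
  have zv0 : 0 < z * v by rewrite mulr_gt0.
  move=> h; rewrite -[leRHS]mulr1 ler_wpM2l//; lra.
have b1 : ln (1 - z) <= - z by rewrite le_ln1Dx//; lra.
have b2 : - (z + 2 * z ^+ 2) <= ln (1 - z).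
  have /andP[_] : 0 <= - ln (1 - z) - z <= 2 * z ^+ 2 by apply: ln1B_bounds; lra.
  lra.
have a3 : z * (1 - v) / (1 - z) <= (z + 2 * z ^+ 2) * (1 - v).
  rewrite mulrAC ler_wpM2r//; first lra.
  by rewrite ler_pdivrMr//; nra.
have s0 : 0 <= 1 - v by lra.
have := ler_wpM2l s0 b1; have := ler_wpM2l s0 b2.
by rewrite ler_norml => ? ?; apply/andP; split; lra.
Qed.

Lemma sum_ln_npow (d : R) : 0 < d <= 2^-1 -> exists y0, forall y, (y0 <= y)%N ->
  `|\sum_(q < y.+1 | prime q) g q * npow d q - ln d^-1| <= 6 * d.
Proof.
move=> d01; have /andP[d0 d1] := d01; have [y0 h] := sum_ln_zeta d01.
exists y0 => y /h {}h.
suff k : `|\sum_(q < y.+1 | prime q) g q * npow d q -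
    \sum_(q < y.+1 | prime q) - ln (1 - npow (1 + d) q)| <= 4 * d.
  by move: h k; rewrite !ler_norml => /andP[? ?] /andP[? ?]; apply/andP; split; lra.
rewrite -sumrB; apply: le_trans (ler_norm_sum _ _ _) _.
apply: (@le_trans _ _ (\sum_(q < y.+1 | prime q) 2 * d * (ln q%:R / (q%:R * q.-1%:R)))).
  apply: ler_sum => q pq; have q0 := prime_gt0 pq.
  have v01 : 0 < npow d q <= 1 by rewrite npow_gt0 npow_le1// ltW.
  have := ln1B_scale (inv_prime pq) v01.
  rewrite opprK npowD npow_inv// [g q * _]mulrC => k; apply: (le_trans k).
  have lq : 1 - npow d q <= d * ln q%:R by have := npow_ge1B d q; lra.
  have q1 : 1 < q%:R :> R by rewrite ltr1n prime_gt1.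
  have lq0 : 0 <= ln q%:R :> R by rewrite ln_ge0// ltW.
  rewrite -!mulrA ler_pM2l//.
  apply: (@le_trans _ _ (q%:R^-1 ^+ 2 * (d * ln q%:R))).
    by rewrite expr2 -!mulrA !ler_wpM2l.
  rewrite mulrCA ler_pM2l// mulrC ler_wpM2l// exprVn.
  rewrite lef_pV2 ?posrE ?exprn_gt0 ?mulr_gt0 ?ltr0n//.
    by rewrite expr2 ler_pM2l ?ltr0n// ler_nat leq_pred.
  by rewrite -subn1 subn_gt0 prime_gt1.
rewrite -mulr_sumr.
have d2 : 0 <= 2 * d by lra.
apply: le_trans (ler_wpM2l d2 (sum_primes_ln_inv_le R y)) _; lra.
Qed.

Let A k : R := \sum_(q < (expfloor R k).+1 | prime q) g q.

Let A0 : A 0 = 0.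
Proof.
rewrite /A expfloor0 big1// => q pq.
by have := prime_gt1 pq; have := ltn_ord q; lia.
Qed.

Let A_succ k : A k.+1 - A k = \sum_((expfloor R k).+1 <= q < (expfloor R k.+1).+1 | prime q) g q.
Proof. by rewrite /A sum_primes_block addrC addKr. Qed.

(** On each block [q^(-d)] equals a power of [exp (-d)] up to one factor [exp (-d)], which turns the
    prime sum into a power series in [exp (-d)]. *)
Lemma sum_blocks d K : 0 < d ->
  let T := \sum_(k < K) (A k.+1 - A k) * expR (- d) ^+ k.+1 in
  let S := \sum_(q < (expfloor R K).+1 | prime q) g q * npow d q in
  expR (- d) * S <= T <= S.
Proof.
move=> d0 /=; elim: K => [|K IH].
  rewrite big_ord0 expfloor0 big1 ?mulr0 ?lexx// => q pq.
  by have := prime_gt1 pq; have := ltn_ord q; lia.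
rewrite big_ord_recr/= (sum_primes_block (fun q => g q * npow d q)) mulrDr.
suff /andP[h1 h2] : expR (- d) * \sum_((expfloor R K).+1 <= q < (expfloor R K.+1).+1 | prime q)
    g q * npow d q <= (A K.+1 - A K) * expR (- d) ^+ K.+1 <=
    \sum_((expfloor R K).+1 <= q < (expfloor R K.+1).+1 | prime q) g q * npow d q.
  by move: IH => /andP[? ?]; rewrite !lerD.
have b q : ((expfloor R K).+1 <= q < (expfloor R K.+1).+1)%N ->
    expR (- d) * npow d q <= expR (- d) ^+ K.+1 <= npow d q.
  move=> /ln_block/andP[b1 b2]; rewrite /npow -expRM_natr -expRD !ler_expR.
  have := ler_wpM2l (ltW d0) b1; have := ler_wpM2l (ltW d0) b2.
  by rewrite -[K.+1%:R]natr1 => ? ?; apply/andP; split; lra.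
rewrite A_succ mulr_sumr mulr_suml; apply/andP; split.
  rewrite big_nat_cond [leRHS]big_nat_cond; apply: ler_sum => q /andP[/b/andP[b1 _] pq].
  by rewrite mulrCA ler_wpM2l// g_ge0.
rewrite big_nat_cond [leRHS]big_nat_cond; apply: ler_sum => q /andP[/b/andP[_ b1] pq].
by rewrite ler_wpM2l// g_ge0.
Qed.

Lemma ln_series_bound (x : R) K : 0 < x < 1 ->
  `|\sum_(k < K) x ^+ k.+1 / k.+1%:R + ln (1 - x)| <= x ^+ K / (1 - x).
Proof.
move=> /andP[x0 x1].
pose F (t : R) := \sum_(k < K) t ^+ k.+1 / k.+1%:R + ln (1 - t).
have dF (t : R) : t < 1 -> is_derive t 1 F (- (t ^+ K / (1 - t))).
  move=> t1; rewrite /F.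
  have s : is_derive t 1 (fun t : R => \sum_(k < K) t ^+ k.+1 / k.+1%:R) (\sum_(k < K) t ^+ k).
    have -> : (fun t : R => \sum_(k < K) t ^+ k.+1 / k.+1%:R) =
        \sum_(k < K) (fun t : R => t ^+ k.+1 / k.+1%:R).
      by apply/funext => u; rewrite fct_sumE.
    apply: is_derive_sum => k.
    have -> : (fun t : R => t ^+ k.+1 / k.+1%:R) = (k.+1%:R^-1 : R) *: (fun t : R => t ^+ k.+1).
      by apply/funext => u; rewrite /= mulrC.
    have := is_deriveZ (k.+1%:R^-1 : R) (is_deriveX k.+1 (is_derive_id t 1)).
    rewrite /= -[_ *: _]/(_ * (_ * _ * 1)) mulr1 mulKf ?pnatr_eq0//.
    by rewrite exprfctE.
  have l : is_derive t 1 (fun t : R => ln (1 - t)) (- (1 - t)^-1).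
    have t10 : 0 < 1 - t by lra.
    have := @is_derive1_comp R (@ln R) (fun t => 1 - t) t ((1 - t)^-1) (-1) (is_derive1_ln t10).
    rewrite mulrN1; apply.
    by have := is_deriveB (is_derive_cst (1 : R) t 1) (is_derive_id t 1); rewrite sub0r.
  apply: is_derive_eq.
  have : (\sum_(k < K) t ^+ k) * (1 - t) = 1 - t ^+ K.
    elim: K {F s} => [|K IH]; first by rewrite big_ord0 mul0r expr0 subrr.
    by rewrite big_ord_recr/= mulrDl IH exprSr; ring.
  have t10 : 1 - t != 0 by rewrite gt_eqF// subr_gt0.
  move=> h; apply: (mulIf t10); rewrite mulrDl h !mulNr mulVf// divfK//; ring.
have [||c] := @MVT R F (fun t => - (t ^+ K / (1 - t))) 0 x x0.
- by move=> t; rewrite in_itv/= => /andP[_ tx]; apply: dF; exact: lt_trans x1.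
- apply: derivable_within_continuous => t; rewrite in_itv/= => /andP[_ tx].
  by have [] := dF t (le_lt_trans tx x1).
rewrite in_itv/= => /andP[c0 cx] h.
have F0 : F 0 = 0.
  rewrite /F subr0 ln1 addr0 big1// => k _; by rewrite expr0n mul0r.
move: h; rewrite F0 !subr0 /F => ->.
rewrite mulNr normrN ger0_norm; last first.
  by rewrite mulr_ge0 ?divr_ge0 ?exprn_ge0 ?(ltW c0)//; lra.
apply: (@le_trans _ _ (c ^+ K / (1 - c))).
  by rewrite ler_piMr ?divr_ge0 ?exprn_ge0 ?(ltW c0)//; lra.
apply: ler_pM; rewrite ?exprn_ge0 ?invr_ge0 ?(ltW c0)//; first lra.
  by apply: lerXn2r; rewrite ?nnegrE ?(ltW c0) ?(ltW cx) ?(ltW x0).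
by rewrite lef_pV2 ?posrE; lra.
Qed.

Lemma ln1B_expRN (d : R) : 0 < d -> - d <= ln (1 - expR (- d)) + ln d^-1 <= 0.
Proof.
move=> d0; have dV : 0 < d^-1 by rewrite invr_gt0.
have /andP[e2 e1] := one_sub_expRN d0.
have e0 : 0 < 1 - expR (- d) by apply: lt_le_trans e2; rewrite divr_gt0//; lra.
apply/andP; split.
  apply: (@le_trans _ _ (ln (d / (1 + d)) + ln d^-1)); last first.
    by rewrite lerD2r ler_ln ?posrE ?divr_gt0//; lra.
  rewrite ln_div ?posrE//; last lra.
  have : ln (1 + d) <= d by rewrite le_ln1Dx//; lra.
  by rewrite lnV ?posrE//; lra.
by rewrite lnV ?posrE// subr_le0 ler_ln ?posrE.
Qed.

(** At [d = u^2] the prime part and the harmonic part, a series for [- ln (1 - exp (-d))], are both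
    [ln d^-1] up to a small error, and they cancel. The square is there because blocking costs about
    [d ln d^-1], at most [2 u]. *)
Lemma mertens_log_abel (u : R) : 0 < u <= 2^-1 -> exists K0, forall K, (K0 <= K)%N ->
  `|\sum_(k < K) (mertens_log R k.+1 - mertens_log R k) * expR (- u ^+ 2) ^+ k.+1| <= 20 * u.
Proof.
move=> /andP[u0 u1]; set d := u ^+ 2.
have d0 : 0 < d by rewrite exprn_gt0.
have du : 2 * d <= u by rewrite /d; nra.
have d01 : 0 < d <= 2^-1 by apply/andP; split => //; lra.
have [y0 hy] := sum_ln_npow d01.
set r := expR (- d).
have r01 : 0 < r < 1 by rewrite expR_gt0 expR_lt1 oppr_lt0.
have r0 := expR_gt0 (- d).
have r1d : 1 - d <= r by have := expR_ge1Dx (- d).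
have [m m0 hm] : exists2 m, (0 < m)%N & forall K, (m <= K)%N -> r ^+ K <= d ^+ 2 / 2.
  have e0 : 0 < d ^+ 2 / 2 by rewrite divr_gt0 ?exprn_gt0.
  have [m m0 h] := npow_small d0 e0; exists m => // K mK.
  apply: le_trans h; rewrite /npow /r -expRM_natr ler_expR mulNr lerN2 ler_pM2l//.
  have : ln m%:R <= m%:R - 1 :> R.
    rewrite -[X in ln X](subrK 1) addrC le_ln1Dx// (@lt_le_trans _ _ 0)//.
    by rewrite subr_ge0 ler1n.
  have : m%:R <= K%:R :> R by rewrite ler_nat.
  lra.
exists (maxn y0 m) => K; rewrite geq_max => /andP[yK mK].
have := hy _ (leq_trans yK (expfloor_ge R K)).
have /= := @sum_blocks d K d0; rewrite -/r.
set S := \sum_(q < _ | _) _; set T := \sum_(k < K) _ => /andP[rST TS].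
have := @ln_series_bound r K r01; set H := \sum_(k < K) _ => hH hS.
have -> : \sum_(k < K) (mertens_log R k.+1 - mertens_log R k) * r ^+ k.+1 = T - H.
  rewrite /T /H -sumrB; apply: eq_bigr => k _.
  rewrite /mertens_log big_nat_recr//= -!/(A _); ring.
have lnd : d * ln d^-1 <= 2 * u.
  rewrite lnV ?posrE// lnXn// -mulNrn -lnV ?posrE//.
  have : ln u^-1 <= u^-1.
    rewrite -[X in ln X](subrK 1) addrC.
    have : 1 < u^-1 by rewrite invf_gt1//; lra.
    move=> h; apply: (@le_trans _ _ (u^-1 - 1)); last by lra.
    by rewrite le_ln1Dx//; lra.
  move=> h; have := ler_wpM2l (ltW d0) h.
  by rewrite {2}/d expr2 mulfK ?gt_eqF// mulrnAr mulr2n; lra.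
have /andP[c1 c2] := ln1B_expRN d0.
have rd : r ^+ K / (1 - r) <= d.
  move: r01 => /andP[_ r1].
  rewrite ler_pdivrMr ?subr_gt0//; apply: (le_trans (hm _ mK)).
  rewrite expr2 -mulrA ler_pM2l//.
  have /andP[+ _] := one_sub_expRN d0; rewrite -/r.
  apply: le_trans; rewrite ler_pM2l// lef_pV2 ?posrE; lra.
have hH2 : `|H + ln (1 - r)| <= d by exact: le_trans hH rd.
have S0 : 0 <= S.
  apply: sumr_ge0 => q pq; rewrite mulr_ge0 ?g_ge0//; exact/ltW/npow_gt0.
have dS : (1 - d) * S <= r * S by rewrite ler_wpM2r.
move: hS hH2; rewrite !ler_norml => /andP[s1 s2] /andP[t1 t2].
have dS2 : d * S <= 2 * u + 6 * d * d.
  have : d * S <= d * (ln d^-1 + 6 * d) by rewrite ler_wpM2l ?(ltW d0)//; lra.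
  lra.
have dd : 6 * d * d <= 3 * d by nra.
by apply/andP; split; lra.
Qed.

Lemma mertens_log0 : mertens_log R 0 = 0.
Proof. by rewrite /mertens_log -/(A 0) A0 big_geq// subr0. Qed.

Lemma abel_mean (D : nat -> R) r K : D 0 = 0 ->
  \sum_(k < K) (D k.+1 - D k) * r ^+ k.+1 = D K * r ^+ K + (1 - r) * \sum_(k < K) D k * r ^+ k.
Proof.
move=> D0; elim: K => [|K IH]; first by rewrite !big_ord0 D0 mulr0 mul0r add0r.
by rewrite !big_ord_recr/= IH !exprS; ring.
Qed.

(* [mertens_log] oscillates little beyond [k0], and its Abel means tend to 0. *)
Lemma mertens_log_le k0 : (0 < k0)%N -> `|mertens_log R k0| <= 410 / k0%:R.
Proof.
move=> k00; set D := mertens_log R; set c := 410 / k0%:R.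
have c0 : 0 <= c by apply: divr_ge0; exact: ler0n.
pose e k := D k - D k0.
have ec k : (k0 <= k)%N -> `|e k| <= c.
  by move=> kk; apply: mertens_log_oscillation; rewrite k00.
pose B := \sum_(k < k0) `|e k|.
have B0 : 0 <= B by apply: sumr_ge0.
apply/ler_addgt0Pr => eps eps0.
pose u := Num.min 2^-1 (eps / (20 + B)).
have uB : 0 < 20 + B by lra.
have u0 : 0 < u by rewrite lt_min invr_gt0 ltr0n divr_gt0.
have u1 : u <= 2^-1 by rewrite ge_min lexx.
have u2 : u * (20 + B) <= eps by rewrite -ler_pdivlMr// ge_min lexx orbT.
have [|K1 hK1] := @mertens_log_abel u; first by rewrite u0.
pose K := maxn K1 k0; have := hK1 K (leq_maxl _ _).
set r := expR _.
have r0 : 0 < r by exact: expR_gt0.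
have r1 : 1 - u <= r.
  apply: le_trans (expR_ge1Dx _); have : u ^+ 2 <= u by nra.
  lra.
have r2 : r <= 1 by rewrite /r -expR0 ler_expR oppr_le0 sqr_ge0.
rewrite (abel_mean _ _ mertens_log0) -/D.
have geo n : (1 - r) * \sum_(k < n) r ^+ k = 1 - r ^+ n.
  elim: n => [|n IH]; first by rewrite big_ord0 mulr0 expr0 subrr.
  by rewrite big_ord_recr/= mulrDr IH exprS; ring.
have -> : D K * r ^+ K + (1 - r) * \sum_(k < K) D k * r ^+ k =
    D k0 + (e K * r ^+ K + (1 - r) * \sum_(k < K) e k * r ^+ k).
  have -> : \sum_(k < K) D k * r ^+ k =
      D k0 * (\sum_(k < K) r ^+ k) + \sum_(k < K) e k * r ^+ k.
    rewrite mulr_sumr -big_split; apply: eq_bigr => k _ /=; rewrite /e; ring.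
  rewrite mulrDr mulrCA geo /e; ring.
set w := e K * _ + _ => hw.
suff hw2 : `|w| <= c + u * B.
  have := ler_normB (D k0 + w) w; rewrite addrK; lra.
have rK : 0 <= r ^+ K by rewrite exprn_ge0// ltW.
have rB : 0 <= 1 - r by lra.
have sumb : `|\sum_(k < K) e k * r ^+ k| <= B + c * \sum_(k < K) r ^+ k.
  rewrite -(big_mkord xpredT (fun k => e k * r ^+ k)) -(big_mkord xpredT (fun k => r ^+ k)).
  rewrite (@big_cat_nat _ _ _ k0 0 K)//= ?leq_maxr// /B.
  apply: le_trans (ler_normD _ _) _; apply: lerD.
    rewrite big_mkord; apply: le_trans (ler_norm_sum _ _ _) _; apply: ler_sum => k _.
    by rewrite normrM ler_piMr// normrX ger0_norm ?exprn_ile1// ltW.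
  apply: le_trans (ler_norm_sum _ _ _) _.
  rewrite mulr_sumr [leRHS](@big_cat_nat _ _ _ k0 0 K)//= ?leq_maxr//.
  rewrite -[leLHS]add0r lerD ?sumr_ge0// => [k _|].
    by rewrite mulr_ge0 ?exprn_ge0// ltW.
  rewrite big_nat_cond [leRHS]big_nat_cond; apply: ler_sum => k /andP[/andP[kk _] _].
  rewrite normrM ler_pM// ?ec// ger0_norm// exprn_ge0// ltW//.
have := ler_wpM2l rB sumb.
rewrite mulrDr mulrCA geo => h.
have h2 : `|e K * r ^+ K| <= c * r ^+ K.
  by rewrite normrM [X in _ * X]ger0_norm// ler_wpM2r// ec// leq_maxr.
have h3 : (1 - r) * B <= u * B by rewrite ler_wpM2r//; lra.
apply: le_trans (ler_normD _ _) _.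
by rewrite [X in _ + X]normrM [X in _ + X * _]ger0_norm//; lra.
Qed.

Lemma mertens_third (e : R) : 0 < e -> exists Y, forall y, (Y <= y)%N ->
  `|\sum_(q < y.+1 | prime q) - ln (1 - q%:R^-1) - ln (ln y%:R) - euler_gamma R| <= e.
Proof.
move=> e0; have e4 : 0 < e / 4 by lra.
have : euler_gamma_seq R n @[n --> \oo] --> euler_gamma R.
  exact: is_cvg_euler_gamma_seq.
move=> /cvgrPdist_le /(_ _ e4)[k0 _ hk0].
(* [1644 = 4 * 411] makes [411 / k <= e / 4]: 410 from [mertens_log_le] and 1 from
   [ln (k + 1) - ln k]. *)
pose k1 := maxn (maxn 1 k0) (Num.truncn (1644 / e)).+1.
exists (expfloor R k1.+1) => y yk1.
have y0 : (0 < y)%N by exact: leq_trans (expfloor_gt0 R _) yk1.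
have yR : 0 < y%:R :> R by rewrite ltr0n.
have ly0 : 0 <= ln y%:R :> R by rewrite ln_ge0 ?ler1n.
pose k := Num.truncn (ln y%:R : R).
have /andP[ky1 ky2] : k%:R <= (ln y%:R : R) < k.+1%:R by rewrite truncn_itv.
have k1k : (k1 <= k)%N.
  rewrite truncn_ge_nat//; apply: (@le_trans _ _ (ln (expfloor R k1.+1)%:R)).
    by have /andP[+ _] := ln_expfloor R k1.+1; rewrite -natr1; lra.
  by rewrite ler_ln ?posrE ?ltr0n ?expfloor_gt0// ler_nat.
move: k1k; rewrite !geq_max => /andP[/andP[kgt0 k0k] ke].
have kR : 0 < k%:R :> R by rewrite ltr0n.
have ke2 : 411 / k%:R <= e / 4.
  rewrite ler_pdivrMr// mulrC -ler_pdivrMr//.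
  have -> : 411 / (e / 4) = 1644 / e by field; lra.
  apply: (@le_trans _ _ (Num.truncn (1644 / e)).+1%:R); last by rewrite ler_nat.
  exact/ltW/truncnS_gt.
set S := \sum_(q < y.+1 | prime q) _.
have Ak j : A j = mertens_log R j + euler_gamma_seq R j + ln j%:R.
  rewrite /mertens_log -/(A j) /euler_gamma_seq seriesEnat /= big_add1 /=; ring.
have mono m n : (m <= n)%N -> \sum_(q < m.+1 | prime q) g q <= \sum_(q < n.+1 | prime q) g q.
  move=> mn; rewrite -!(big_mkord prime g) [leRHS](@big_cat_nat _ _ _ m.+1)//=.
  by rewrite lerDl sumr_ge0// => q; exact: g_ge0.
have S1 : A k <= S.
  apply: mono; rewrite truncn_le_nat; apply: le_lt_trans (_ : y%:R < _); last by rewrite ltr_nat.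
  by rewrite -[leRHS]lnK ?posrE// ler_expR.
have S2 : S <= A k.+1.
  apply: mono; rewrite truncn_ge_nat ?expR_ge0//.
  by rewrite -[leLHS]lnK ?posrE// ler_expR ltW.
have l1 : ln k%:R <= ln (ln y%:R) :> R by rewrite ler_ln ?posrE// (lt_le_trans kR).
have l2 : ln (ln y%:R) <= ln k.+1%:R :> R.
  by rewrite ler_ln ?posrE ?ltr0n//; [exact: ltW|exact: lt_le_trans ky1].
have l3 := ln_succ_sub_le R kgt0.
have := mertens_log_le kgt0; have := mertens_log_le (ltn0Sn k).
have h1 := hk0 k k0k; have h2 := hk0 k.+1 (leqW k0k).
have : k.+1%:R^-1 <= k%:R^-1 :> R by rewrite lef_pV2 ?posrE ?ltr0n// ler_nat.
have kV : 0 < k%:R^-1 :> R by rewrite invr_gt0.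
move: ke2 kV l3 h1 h2 S1 S2; rewrite !Ak !ler_norml.
move: (k%:R^-1 : R) (k.+1%:R^-1 : R) (ln k%:R : R) (ln k.+1%:R : R) l1 l2 => v v' lk lk' ? ? ? ? ?.
move=> /andP[? ?] /andP[? ?] ? ? ? /andP[? ?] /andP[? ?].
by apply/andP; split; lra.
Qed.

End MertensConstant.

(** * The value of zeta(2) *)

Section Basel.
Variable R : realType.

Let inv_sin_sqr (x : R) : R := (sin x ^+ 2)^-1.

Lemma inv_sin_sqr_half (x : R) : sin (x / 2) != 0 -> cos (x / 2) != 0 ->
  4 * inv_sin_sqr x = inv_sin_sqr (x / 2) + inv_sin_sqr (x / 2 + pi / 2).
Proof.
move=> s0 c0; rewrite /inv_sin_sqr sinDpihalf {1}(splitr x) sinD.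
have h := cos2Dsin2 (x / 2).
move: s0 c0 h; set s := sin (x / 2); set c := cos (x / 2) => s0 c0 h.
have -> : (s ^+ 2)^-1 + (c ^+ 2)^-1 = (c ^+ 2 + s ^+ 2) / (s ^+ 2 * c ^+ 2).
  by field; rewrite s0 c0.
rewrite h [c * s]mulrC -mulr2n -mulr_natl; field.
by rewrite s0 c0.
Qed.

Let node n k : R := (2 * k%:R + 1) * pi / 2 ^+ n.+1.

Let node_gt0 n k : 0 < node n k.
Proof.
by rewrite divr_gt0 ?exprn_gt0// mulr_gt0 ?pi_gt0// addr_ge0_gt0 ?mulr_ge0.
Qed.

Let node_lt_pi n k : (k < 2 ^ n)%N -> node n k < pi.
Proof.
move=> kn; rewrite /node ltr_pdivrMr ?exprn_gt0// mulrC ltr_pM2l ?pi_gt0//.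
by rewrite -natrX -natrM natr1 ltr_nat expnS; lia.
Qed.

Let node_half n k : node n k / 2 = node n.+1 k.
Proof. by rewrite /node [2 ^+ n.+2]exprSr invfM mulrA. Qed.

Let node_shift n k : node n.+1 k + pi / 2 = node n.+1 (2 ^ n + k).
Proof.
rewrite /node natrD natrX !exprS; set t := 2 ^+ n.
have t0 : t != 0 by rewrite expf_neq0.
by field.
Qed.

Let node_reflect n k : (k < 2 ^ n)%N -> node n (2 ^ n - k.+1) = pi - node n k.
Proof.
move=> kn; rewrite /node natrB// natrX exprS -natr1; set t := 2 ^+ n.
have t0 : t != 0 by rewrite expf_neq0.
by field.
Qed.

(* Hofbauer's proof of the Basel identity: [1/sin^2] at the nodes is summed
   exactly by repeated halving of the angle. *)
Lemma sum_inv_sin_sqr n : \sum_(k < 2 ^ n) inv_sin_sqr (node n k) = 4 ^+ n.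
Proof.
elim: n => [|n IH].
  rewrite expn0 big_ord1 /node mulr0 add0r mul1r expr1 /inv_sin_sqr sin_pihalf.
  by rewrite expr1n invr1 expr0.
rewrite exprS -IH mulr_sumr.
have <- : (2 ^ n + 2 ^ n = 2 ^ n.+1)%N by rewrite expnS; lia.
rewrite big_split_ord /= -big_split /=; apply: eq_bigr => k _.
rewrite -node_shift -node_half; apply/esym/inv_sin_sqr_half.
  rewrite gt_eqF// sin_gt0_pi// divr_gt0//=.
  by have := node_lt_pi (ltn_ord k); have := node_gt0 n k; lra.
rewrite gt_eqF// cos_gt0_pihalf//.
by have := node_lt_pi (ltn_ord k); have := node_gt0 n k; lra.
Qed.

(** Reflection in [pi / 2] keeps only the nodes where [1 / sin^2] is comparable with [1 / x^2]. *)
Lemma sum_inv_sin_sqr_half m : 2 * \sum_(k < 2 ^ m) inv_sin_sqr (node m.+1 k) = 4 ^+ m.+1.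
Proof.
rewrite -sum_inv_sin_sqr; have <- : (2 ^ m + 2 ^ m = 2 ^ m.+1)%N by rewrite expnS; lia.
rewrite big_split_ord /= mulr_natl mulr2n; congr (_ + _).
rewrite (reindex_inj rev_ord_inj) /=; apply: eq_bigr => k _.
have km := ltn_ord k.
have kM : (2 ^ m - k.+1 < 2 ^ m.+1)%N by rewrite expnS; lia.
have -> : (2 ^ m + k = 2 ^ m.+1 - (2 ^ m - k.+1).+1)%N by rewrite expnS; lia.
by rewrite node_reflect// /inv_sin_sqr sinB sinpi cospi mul0r mulN1r sub0r opprK.
Qed.

Lemma sin_le (x : R) : 0 <= x -> sin x <= x.
Proof.
move=> x0; have [|c _] := @MVT_segment R (@sin R) (@cos R) 0 x x0 (fun _ _ => is_derive_sin _).
  exact/continuous_subspaceT/continuous_sin.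
by rewrite sin0 !subr0 => ->; rewrite ler_piMl// cos_le1.
Qed.

Lemma mul_cos_le_sin (x : R) : 0 <= x <= pi -> x * cos x <= sin x.
Proof.
move=> /andP[x0 xpi].
pose f (t : R) := sin t - t * cos t.
have df (t : R) : is_derive t 1 f (t * sin t).
  rewrite /f; have := is_deriveB (is_derive_sin t) (is_deriveM (is_derive_id t 1) (is_derive_cos t)).
  rewrite /= -![_ *: _]/(_ * _) => h; apply: is_derive_eq h _.
  by rewrite mulr1; ring.
have [|c] := @MVT_segment R f (fun t => t * sin t) 0 x x0 (fun t _ => df t).
  by apply: derivable_within_continuous => t _; have [] := df t.
rewrite in_itv/= => /andP[c0 cx]; rewrite /f sin0 mul0r !subr0 => h.
rewrite -subr_ge0 h !mulr_ge0// sin_ge0_pi// c0/=; exact: le_trans xpi.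
Qed.

Lemma inv_sin_sqr_bounds (x : R) : 0 < x < pi / 2 ->
  (x ^+ 2)^-1 <= inv_sin_sqr x <= 1 + (x ^+ 2)^-1.
Proof.
move=> /andP[x0 xpi].
have pi0 := pi_gt0 R.
have s0 : 0 < sin x by rewrite sin_gt0_pihalf// x0.
have c0 : 0 < cos x by rewrite cos_gt0_pihalf//; apply/andP; split; lra.
have s1 : sin x <= x by rewrite sin_le// ltW.
have s2 : x * cos x <= sin x by rewrite mul_cos_le_sin//; apply/andP; split; lra.
rewrite /inv_sin_sqr; apply/andP; split.
  by rewrite lef_pV2 ?posrE ?exprn_gt0// lerXn2r// nnegrE ltW.
have -> : 1 + (x ^+ 2)^-1 = (x ^+ 2 + 1) / x ^+ 2 by field; lra.
rewrite ler_pdivlMr ?exprn_gt0// mulrC ler_pdivrMr ?exprn_gt0//.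
have : (x * cos x) ^+ 2 <= sin x ^+ 2 by rewrite lerXn2r ?nnegrE// ?mulr_ge0// ltW.
rewrite exprMn cos2sin2; lra.
Qed.

(** Replacing [1 / sin^2 x] by [1 / x^2] costs at most 1 at each of the [2 ^ m] nodes, against a
    total of [2 * 4 ^ m]. *)
Lemma sum_inv_odd_sqr m :
  pi ^+ 2 / 8 - pi ^+ 2 / 16 / 2 ^+ m <=
    (\sum_(k < 2 ^ m) (2 * k%:R + 1) ^- 2 : R) <= pi ^+ 2 / 8.
Proof.
have := sum_inv_sin_sqr_half m; set S := \sum_(k < _) _ => SE.
set O := \sum_(k < _) _.
have pi0 := pi_gt0 R.
have t0 : 0 < 2 ^+ m :> R by rewrite exprn_gt0.
have OE : \sum_(k < 2 ^ m) (node m.+1 k ^+ 2)^-1 = O * (16 * (2 ^+ m) ^+ 2 / pi ^+ 2).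
  rewrite /O mulr_suml; apply: eq_bigr => k _; rewrite /node !exprS.
  have k0 : 0 <= k%:R :> R by [].
  by field; rewrite !lt0r_neq0//; lra.
have nb (k : 'I_(2 ^ m)) : 0 < node m.+1 k < pi / 2.
  rewrite node_gt0 -node_half ltr_pM2r// node_lt_pi//.
have S1 : O * (16 * (2 ^+ m) ^+ 2 / pi ^+ 2) <= S.
  by rewrite -OE; apply: ler_sum => k _; have /andP[] := inv_sin_sqr_bounds (nb k).
have S2 : S <= 2 ^+ m + O * (16 * (2 ^+ m) ^+ 2 / pi ^+ 2).
  rewrite -OE -natrX -[X in X%:R]card_ord -sumr_const -big_split.
  by apply: ler_sum => k _; have /andP[] := inv_sin_sqr_bounds (nb k).
have E4 : 4 ^+ m.+1 = 4 * (2 ^+ m) ^+ 2 :> R.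
  by rewrite exprS -exprM mulnC exprM -[2 ^+ 2]natrX.
have {SE} SE : S = 2 * (2 ^+ m) ^+ 2 by move: SE; rewrite E4; lra.
rewrite {}SE in S1 S2; move: (2 ^+ m : R) (pi : R) t0 pi0 S1 S2 => t p t0 p0 S1 S2.
have p2 : 0 < p ^+ 2 by rewrite exprn_gt0.
have t2 : 0 < t ^+ 2 by rewrite exprn_gt0.
apply/andP; split.
  rewrite -(@ler_pM2r _ (16 * t ^+ 2 / p ^+ 2)); last by rewrite divr_gt0 ?mulr_gt0.
  rewrite (_ : (p ^+ 2 / 8 - p ^+ 2 / 16 / t) * (16 * t ^+ 2 / p ^+ 2) = 2 * t ^+ 2 - t); first lra.
  by field; lra.
rewrite -(@ler_pM2r _ (16 * t ^+ 2 / p ^+ 2)); last by rewrite divr_gt0 ?mulr_gt0.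
apply: le_trans S1 _; rewrite le_eqVlt; apply/orP; left; apply/eqP.
by field; lra.
Qed.

(** Completely multiplicative with support on odd numbers, so [euler_product] applies directly to
    the sum just evaluated; the missing prime 2 is restored by the factor [3 / 4]. *)
Let odd_inv_sqr (n : nat) : R := if odd n then n%:R ^- 2 else 0.

Let sum_odd_inv_sqr K : \sum_(1 <= n < K.*2.+1) odd_inv_sqr n = \sum_(k < K) (2 * k%:R + 1) ^- 2.
Proof.
elim: K => [|K IH]; first by rewrite big_geq// big_ord0.
rewrite doubleS big_nat_recr//= big_nat_recr//= IH big_ord_recr/= /odd_inv_sqr /= odd_double /= addr0.
by rewrite -[K.*2.+1%:R]natr1 -muln2 natrM mulrC.
Qed.

Lemma prod_inv_sqr_primes (e : R) : 0 < e -> exists Y, forall y, (Y <= y)%N ->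
  `|\prod_(q < y.+1 | prime q) (1 - q%:R ^- 2) - 6 / pi ^+ 2| <= e :> R.
Proof.
move=> e0; have e6 : 0 < e / 6 by lra.
have pi2 : 2 <= pi :> R := pi_ge2 R.
have aM m n : (0 < m)%N -> (0 < n)%N -> odd_inv_sqr (m * n) = odd_inv_sqr m * odd_inv_sqr n.
  move=> _ _; rewrite /odd_inv_sqr oddM; case: (odd m); case: (odd n) => /=; rewrite ?(mulr0, mul0r)//.
  by rewrite natrM exprMn invfM.
have nle (n : nat) : `|odd_inv_sqr n| <= n%:R ^- 2.
  rewrite /odd_inv_sqr; case: ifP => _; first by rewrite ger0_norm// invr_ge0 exprn_ge0.
  by rewrite normr0 invr_ge0 exprn_ge0.
have le1 n : (0 < n)%N -> `|odd_inv_sqr n| <= 1.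
  move=> n0; apply: le_trans (nle n) _.
  by rewrite invf_le1 ?exprn_gt0 ?ltr0n// exprn_ege1// ler1n.
have tail (d : R) : 0 < d -> exists m0, forall m M, (m0 <= m)%N ->
    \sum_(m <= n < M) `|odd_inv_sqr n| <= d.
  move=> d0; exists (Num.truncn d^-1).+2 => -[//|m] M mM.
  apply: (@le_trans _ _ (\sum_(m.+1 <= n < M) n%:R ^- 2)); first by apply: ler_sum => n _.
  have m0 : (0 < m)%N by case: m mM.
  apply: le_trans (sum_inv_sqr_tail R M m0) _.
  rewrite -[leRHS]invrK lef_pV2 ?posrE ?invr_gt0// ?ltr0n//.
  by apply/ltW/(lt_le_trans (truncnS_gt _)); rewrite ler_nat.
have a1 : odd_inv_sqr 1 = 1 by rewrite /odd_inv_sqr /= expr1n invr1.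
have [y0 hy0] := @euler_product R odd_inv_sqr a1 aM le1 tail _ e6.
exists (maxn y0 2) => y; rewrite geq_max => /andP[/hy0[M0 hM0] y2].
set P := \prod_(q < y.+1 | prime q) _.
set P' := \prod_(q < _ | _) _ in hM0.
have PE : P = 3 / 4 * P'.
  have y2' : (2 < y.+1)%N by [].
  rewrite /P /P' (bigD1 (Ordinal y2'))//= [X in _ = _ * X](bigD1 (Ordinal y2'))//= mulrA.
  congr (_ * _); first by rewrite /odd_inv_sqr /=; field.
  apply: eq_bigr => q /andP[pq q2]; congr (1 - _); rewrite /odd_inv_sqr.
  by case: (even_prime pq) => [q2'|->//]; move: q2; rewrite -val_eqE /= q2' eqxx.
have P0 : 0 <= P'.
  apply: prodr_ge0 => q /prime_gt0/le1; rewrite subr_ge0; exact/le_trans/ler_norm.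
pose m := maxn M0 (Num.truncn (6 / e)).+1.
have mlt : (m < 2 ^ m)%N by exact: ltn_expl.
have /andP[b1 b2] := sum_inv_odd_sqr m.
have := hM0 (2 ^ m).*2; rewrite sum_odd_inv_sqr => /(_ _).
have -> : (M0 <= (2 ^ m).*2)%N.
  rewrite -addnn; apply: leq_trans (leq_addr _ _); apply: leq_trans (ltnW mlt).
  exact: leq_maxl.
set O := \sum_(k < _) _ in b1 b2 *; rewrite PE => /(_ isT) hO.
have tm : (2 ^+ m)^-1 <= e / 6 :> R.
  rewrite -[leRHS]invrK lef_pV2 ?posrE ?invr_gt0 ?exprn_gt0//.
  rewrite invf_div; apply/ltW/(lt_le_trans (truncnS_gt _)); rewrite -natrX ler_nat.
  by rewrite (leq_trans _ (ltnW mlt))// leq_maxr.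
have tm1 : (2 ^+ m)^-1 <= 1 :> R by rewrite invf_le1 ?exprn_gt0// exprn_ege1// ler1n.
have t0 : 0 < (2 ^+ m)^-1 :> R by rewrite invr_gt0 exprn_gt0.
have eE : e / 6 * 6 <= e by lra.
move: ((2 ^+ m)^-1 : R) (pi : R) (e / 6) eE e6 pi2 P0 b1 b2 hO tm tm1 t0.
move=> t p d de d0 p2 P0 b1 b2 hO td t1 t0.
have pp4 : 4 <= p ^+ 2 by nra.
have pp0 : 0 < p ^+ 2 by lra.
have h1 : P' * O <= P' * (p ^+ 2 / 8) by rewrite ler_wpM2l.
have h2 : P' * (p ^+ 2 / 8 - p ^+ 2 / 16 * t) <= P' * O by rewrite ler_wpM2l.
have -> : 3 / 4 * P' - 6 / p ^+ 2 = (P' * (p ^+ 2 / 8) - 1) * (6 / p ^+ 2) by field; lra.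
move: h1 h2 hO.
have -> : P' * (p ^+ 2 / 8 - p ^+ 2 / 16 * t) = P' * (p ^+ 2 / 8) * (1 - t / 2) by field.
have w0 : 0 <= P' * (p ^+ 2 / 8) by rewrite mulr_ge0// divr_ge0// ltW.
move: (P' * (p ^+ 2 / 8)) (P' * O) w0 => w u w0 h1 h2; rewrite ler_norml => /andP[h3 h4].
have w2 : w <= 2 * (1 + d) by nra.
have w3 : w <= 1 + 3 * d by nra.
have p6 : 0 <= 6 / p ^+ 2 <= 3 / 2.
  by rewrite divr_ge0 ?(ltW pp0)//= ler_pdivrMr//; lra.
have w4 : `|w - 1| <= 3 * d by rewrite ler_norml; apply/andP; split; lra.
move: p6 => /andP[p60 p63].
rewrite normrM [X in _ * X]ger0_norm//.
have : `|w - 1| * (6 / p ^+ 2) <= 3 * d * (3 / 2) by apply: ler_pM.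
lra.
Qed.

(** Factor [1 + z = (1 - z^2) / (1 - z)] at [z = 1 / q]: the first part tends to [6 / pi^2], the
    second is Mertens' product. *)
Lemma dedekind_mertens_product (e : R) : 0 < e <= 1 -> exists Y, forall y, (Y <= y)%N ->
  let C := 6 * expR (euler_gamma R) / pi ^+ 2 in
  let M := \prod_(q < y.+1 | prime q) (1 + q%:R^-1) in
  C * ln y%:R * (1 - e) <= M <= C * ln y%:R * (1 + e).
Proof.
move=> /andP[e0 e1] /=.
have pi0 : 0 < pi ^+ 2 :> R by rewrite exprn_gt0// pi_gt0.
have c0 : 0 < 6 / pi ^+ 2 :> R by rewrite divr_gt0.
have e4 : 0 < e / 4 by lra.
have [Y1 h1] := prod_inv_sqr_primes (mulr_gt0 c0 e4).
have [Y2 h2] := mertens_third e4.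
exists (maxn 2 (maxn Y1 Y2)) => y; rewrite !geq_max => /and3P[y2 /h1 {}h1 /h2 {}h2].
have ly : 0 < ln y%:R :> R by rewrite ln_gt0// ltr1n.
set P := \prod_(q < y.+1 | prime q) (1 - q%:R ^- 2) in h1.
set S := \sum_(q < y.+1 | prime q) _ in h2.
have -> : \prod_(q < y.+1 | prime q) (1 + q%:R^-1) = P * expR S.
  rewrite /S expR_sum /P -big_split; apply: eq_bigr => q pq /=.
  have q1 : 1 < q%:R :> R by rewrite ltr1n prime_gt1.
  have qV : q%:R^-1 < 1 :> R by rewrite invf_lt1//; lra.
  rewrite expRN lnK ?posrE ?subr_gt0// -exprVn.
  by field; lra.
have -> : 6 * expR (euler_gamma R) / pi ^+ 2 * ln y%:R =
    6 / pi ^+ 2 * (expR (euler_gamma R) * ln y%:R) by ring.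
have eS : expR (euler_gamma R) * ln y%:R = expR (euler_gamma R + ln (ln y%:R)).
  by rewrite expRD [in RHS](lnK ly).
set T := expR _ * _ in eS *.
have T0 : 0 < T by rewrite eS expR_gt0.
move: h2; rewrite ler_norml => /andP[s1 s2].
have S1 : T * (1 - e / 4) <= expR S.
  apply: (@le_trans _ _ (T * expR (- (e / 4)))).
    by rewrite ler_pM2l//; exact: expR_ge1Dx.
  by rewrite eS -expRD ler_expR; lra.
have S2 : expR S <= T * (1 + 2 * (e / 4)).
  apply: (@le_trans _ _ (T * expR (e / 4))).
    by rewrite eS -expRD ler_expR; lra.
  by rewrite ler_pM2l// expR_le1D2//; lra.
move: h1 c0; move: (6 / pi ^+ 2 : R) => c; rewrite ler_norml => /andP[p1 p2] c0.
have P1 : c * (1 - e / 4) <= P by lra.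
have P2 : P <= c * (1 + e / 4) by lra.
have P0 : 0 <= P by apply: le_trans P1; rewrite mulr_ge0 ?(ltW c0)//; lra.
have cT : 0 < c * T by rewrite mulr_gt0.
apply/andP; split.
  have : c * (1 - e / 4) * (T * (1 - e / 4)) <= P * expR S.
    by apply: ler_pM => //; rewrite mulr_ge0 ?ltW//; lra.
  apply: le_trans.
  have -> : c * (1 - e / 4) * (T * (1 - e / 4)) = c * T * (1 - e / 4) ^+ 2 by ring.
  by rewrite ler_pM2l//; nra.
have : P * expR S <= c * (1 + e / 4) * (T * (1 + 2 * (e / 4))).
  by apply: ler_pM => //; exact: expR_ge0.
move=> h; apply: (le_trans h).
have -> : c * (1 + e / 4) * (T * (1 + 2 * (e / 4))) = c * T * ((1 + e / 4) * (1 + 2 * (e / 4))) by ring.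
by rewrite ler_pM2l//; nra.
Qed.

End Basel.

(** * The normal order *)

Section Assembly.
Variable R : realType.

Let C : R := 6 * expR (euler_gamma R) / pi ^+ 2.
Let M (y : nat) : R := \prod_(q < y.+1 | prime q) (1 + q%:R^-1).

Definition psi_ratio (n : nat) : R := (dedekind_psi (dedekind_psi n))%:R / (dedekind_psi n)%:R.

Lemma psi_ratioE n B : (0 < n)%N -> (dedekind_psi n <= B)%N ->
  psi_ratio n = \prod_(q < B.+1 | prime q && (q %| dedekind_psi n)%N) (1 + q%:R^-1).
Proof.
move=> n0 nB; have m0 := dedekind_psi_gt0 n0; rewrite /psi_ratio dedekind_psiE.
rewrite mulrAC divff ?mul1r ?pnatr_eq0 -?lt0n//.
by rewrite (big_ord_primes _ (fun q => 1 + q%:R^-1)) ?m0.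
Qed.

Let fac_ge1 (q : nat) : 1 <= 1 + q%:R^-1 :> R.
Proof. by rewrite lerDl invr_ge0. Qed.

Let fac_ge0 (q : nat) : 0 <= 1 + q%:R^-1 :> R.
Proof. exact: le_trans (fac_ge1 q). Qed.

Let prod_fac_ge0 (n : nat) (P : pred 'I_n) : 0 <= \prod_(q < n | P q) (1 + q%:R^-1) :> R.
Proof. by apply: prodr_ge0 => q _; exact: fac_ge0. Qed.

Lemma prod_succ_inv_le_exp B (P : pred nat) :
  \prod_(q < B.+1 | P q) (1 + q%:R^-1) <= expR (\sum_(q < B.+1 | P q) q%:R^-1) :> R.
Proof.
rewrite expR_sum; apply: ler_prod => q _.
by rewrite fac_ge0 expR_ge1Dx.
Qed.

Lemma prod_succ_inv_mono (n : nat) (P Q : pred 'I_n) : (forall q, P q -> Q q) ->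
  \prod_(q < n | P q) (1 + q%:R^-1) <= \prod_(q < n | Q q) (1 + q%:R^-1) :> R.
Proof.
move=> PQ; rewrite big_mkcond [leRHS]big_mkcond; apply: ler_prod => q _.
case: (boolP (P q)) => [/PQ ->|_]; first by rewrite fac_ge0 lexx.
by rewrite ler01; case: ifP => _; rewrite ?fac_ge1 ?lexx.
Qed.

Lemma psi_ratio_le y B n : (0 < n)%N -> (dedekind_psi n <= B)%N -> (y <= B)%N ->
  psi_ratio n <= M y * expR (large_prime_sum R y B n).
Proof.
move=> n0 nB yB; rewrite (psi_ratioE n0 nB) (bigID (fun q : 'I_B.+1 => (q < y.+1)%N)) /=.
apply: ler_pM; rewrite ?prod_fac_ge0//.
  rewrite /M (big_ord_widen_cond B.+1 prime (fun q => 1 + q%:R^-1))//.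
  by apply: prod_succ_inv_mono => q /andP[/andP[-> _] ->].
apply: le_trans (prod_succ_inv_le_exp B (fun q => prime q && (y < q)%N && (q %| dedekind_psi n)%N)).
by apply: prod_succ_inv_mono => q; rewrite -leqNgt => /andP[/andP[-> ->] ->].
Qed.

Lemma psi_ratio_ge y n : (0 < n)%N -> M y * expR (- missing_prime_sum R y n) <= psi_ratio n.
Proof.
move=> n0; rewrite expRN ler_pdivrMr ?expR_gt0//.
have le1 : (dedekind_psi n <= dedekind_psi n + y)%N by exact: leq_addr.
rewrite (psi_ratioE n0 le1) /M (bigID (fun q : 'I_y.+1 => q %| dedekind_psi n)%N) /=.
apply: ler_pM; rewrite ?prod_fac_ge0//.
  rewrite (big_ord_widen_cond (dedekind_psi n + y).+1
    (fun q => prime q && (q %| dedekind_psi n)%N) (fun q => 1 + q%:R^-1)) ?ltnS ?leq_addl//.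
  by apply: prod_succ_inv_mono => q /andP[].
exact: (prod_succ_inv_le_exp y (fun q => prime q && ~~ (q %| dedekind_psi n)%N)).
Qed.

Lemma linear_le_expR (a c : R) : 0 < a -> exists T, forall t, T <= t -> c * (1 + t) <= expR (a * t).
Proof.
move=> a0; have a2 : 0 < a ^+ 2 by rewrite exprn_gt0.
exists (Num.max 1 (8 * c / a ^+ 2)) => t; rewrite ge_max => /andP[t1].
rewrite ler_pdivrMr// => ct.
have -> : a * t = a * t / 2 + a * t / 2 by field.
have at0 : 0 <= a * t / 2 by rewrite divr_ge0// mulr_ge0//; lra.
have h := expR_ge1Dx (a * t / 2); rewrite expRD.
have : (a * t / 2) * (a * t / 2) <= expR (a * t / 2) * expR (a * t / 2).
  by apply: ler_pM => //; lra.
apply: le_trans.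
have -> : a * t / 2 * (a * t / 2) = t * a ^+ 2 * (t / 4) by field.
have c1 : 8 * c * (t / 4) <= t * a ^+ 2 * (t / 4) by rewrite ler_wpM2r//; lra.
have [c0|c0] := leP 0 c; first nra.
have : 0 <= t * a ^+ 2 * (t / 4) by rewrite !mulr_ge0//; lra.
by nra.
Qed.

Lemma triple_exp_sqrt_le (t : R) : 1 <= t -> expR (expR (expR (t - 1))) ^+ 2 <= expR (expR (expR t)).
Proof.
move=> t1; rewrite expr2 -expRD ler_expR -mulr2n -mulr_natl.
apply: (@le_trans _ _ (expR 1 * expR (expR (t - 1)))).
  by rewrite ler_wpM2r ?expR_ge0// (expR1_ge2 R).
rewrite -expRD ler_expR.
have : 2 * expR (t - 1) <= expR t.
  have -> : expR t = expR 1 * expR (t - 1) by rewrite -expRD addrC subrK.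
  by rewrite ler_wpM2r ?expR_ge0// (expR1_ge2 R).
have := expR_ge1Dx (t - 1); lra.
Qed.

(** Between [sqrt N] and [N] the triple logarithm varies by at most 1, so one pair of cutoffs,
    depending on [N] only, serves all these [n]. *)
Lemma iter_ln3_itv N n (t : R) : N%:R = expR (expR (expR t)) -> 1 <= t ->
  (N <= n ^ 2)%N -> (n <= N)%N -> t - 1 <= iter_ln 3 n%:R <= t.
Proof.
move=> NE t1 Nn nN; rewrite /iter_ln /=.
have n1 : expR (expR (expR (t - 1))) <= n%:R.
  have := le_trans (triple_exp_sqrt_le t1) _.
  rewrite -NE => /(_ (n%:R ^+ 2)); rewrite -natrX ler_nat => /(_ Nn).
  by rewrite natrX ler_sqr ?nnegrE// expR_ge0.
have n0 : 0 < n%:R :> R by apply: lt_le_trans n1; exact: expR_gt0.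
have n2 : expR (expR (t - 1)) <= ln n%:R by rewrite -ler_expR lnK.
have n3 : 0 < ln n%:R :> R by apply: lt_le_trans n2; exact: expR_gt0.
have n4 : expR (t - 1) <= ln (ln n%:R) by rewrite -ler_expR lnK.
have n5 : 0 < ln (ln n%:R) :> R by apply: lt_le_trans n4; exact: expR_gt0.
apply/andP; split; first by rewrite -ler_expR lnK.
rewrite -ler_expR lnK// -ler_expR lnK// -ler_expR lnK//.
by rewrite -NE ler_nat.
Qed.

(** Since [d * t >= 1], the unit losses from [log_3 n >= t - 1] and from rounding [y1] are relative
    errors of order [d]. The constant 10 absorbs these, the exponents [1 - d] and [1 + d], the
    Mertens error and the factors [exp d], [exp (- d)]. *)
Lemma psi_ratio_near (e d t : R) N n y1 y2 B :
  0 < d <= 10^-1 -> 10 * d <= e -> d^-1 <= t -> 1 <= t ->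
  N%:R = expR (expR (expR t)) ->
  y1 = Num.truncn (expR ((1 - d) * t)) -> y2 = Num.truncn (expR ((1 + d) * t)) ->
  C * ln y1%:R * (1 - d) <= M y1 -> M y2 <= C * ln y2%:R * (1 + d) ->
  (N <= n ^ 2)%N -> (n <= N)%N -> (dedekind_psi n <= B)%N -> (y2 <= B)%N ->
  large_prime_sum R y2 B n <= d -> missing_prime_sum R y1 n <= d ->
  `|psi_ratio n - C * iter_ln 3 n%:R| <= e * (C * iter_ln 3 n%:R).
Proof.
move=> /andP[d0 d1] de dt t1 NE y1E y2E M1 M2 Nn nN nB yB large missing.
have C0 : 0 < C.
  by rewrite /C divr_gt0 ?mulr_gt0 ?expR_gt0 ?exprn_gt0 ?pi_gt0.
have N0 : (0 < N)%N by rewrite -(ltr0n R) NE expR_gt0.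
have n0 : (0 < n)%N by case: n Nn {nN nB large missing} => //; rewrite leqNgt N0.
have /andP[l1 l2] := iter_ln3_itv NE t1 Nn nN.
set l := iter_ln 3 n%:R in l1 l2 *.
have dt1 : 1 <= d * t by rewrite mulrC -ler_pdivrMr// mul1r.
have u1 : 0 <= (1 - d) * t by rewrite mulr_ge0//; lra.
have u2 : 0 <= (1 + d) * t by rewrite mulr_ge0//; lra.
have [_ _ _ _ /andP[a1 _]] := truncn_expR u1; rewrite -y1E in a1.
have [_ _ _ _ /andP[_ a2]] := truncn_expR u2; rewrite -y2E in a2.
have U : psi_ratio n <= C * ((1 + d) * t * (1 + d) * (1 + 2 * d)).
  apply: (le_trans (psi_ratio_le n0 nB yB)).
  rewrite !mulrA; apply: ler_pM; rewrite ?expR_ge0//.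
  - by rewrite prodr_ge0.
  - apply: (le_trans M2); rewrite -[C * _ * t]mulrA ler_wpM2r ?ler_pM2l//; lra.
  apply: (@le_trans _ _ (expR d)); first by rewrite ler_expR.
  by apply: expR_le1D2; lra.
have Lo : C * (((1 - d) * t - 1) * (1 - d) * (1 - d)) <= psi_ratio n.
  apply: le_trans (psi_ratio_ge y1 n0); rewrite !mulrA; apply: ler_pM.
  - by rewrite !mulr_ge0 ?(ltW C0)//; nra.
  - lra.
  - by apply: le_trans M1; rewrite ler_wpM2r ?ler_pM2l//; lra.
  by apply: le_trans (expR_ge1Dx _); lra.
have lt0 : (1 - d) * t <= l by lra.
have k1 : C * ((1 + d) * t * (1 + d) * (1 + 2 * d)) <= C * ((1 + e) * l).
  rewrite ler_pM2l//.
  apply: (@le_trans _ _ ((1 + e) * ((1 - d) * t))); last by rewrite ler_wpM2l//; lra.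
  rewrite [leRHS]mulrA [leLHS](_ : _ = (1 + d) ^+ 2 * (1 + 2 * d) * t); last by ring.
  rewrite ler_wpM2r//; first lra.
  apply: (@le_trans _ _ ((1 + 10 * d) * (1 - d))); last by rewrite ler_wpM2r//; lra.
  by nra.
have k2 : C * ((1 - e) * l) <= C * (((1 - d) * t - 1) * (1 - d) * (1 - d)).
  rewrite ler_pM2l//.
  apply: (@le_trans _ _ ((1 - 10 * d) * t)).
    apply: (@le_trans _ _ ((1 - 10 * d) * l)); first by rewrite ler_wpM2r//; nra.
    by rewrite ler_wpM2l//; lra.
  apply: (@le_trans _ _ (((1 - d) * t - d * t) * (1 - d) * (1 - d))); last first.
    by rewrite -!mulrA ler_wpM2r ?mulr_ge0//; lra.
  rewrite [leRHS](_ : _ = (1 - 2 * d) * (1 - d) ^+ 2 * t); last by ring.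
  by rewrite ler_wpM2r//; nra.
rewrite ler_norml; apply/andP; split.
  by rewrite lerBrDr; apply: le_trans Lo; apply: le_trans k2; lra.
by rewrite lerBlDr; apply: (le_trans U); apply: (le_trans k1); lra.
Qed.

Lemma log_log_sqrt N K (t : R) : N%:R = expR (expR (expR t)) -> 1 <= t ->
  (K ^ 2 <= N)%N -> (N < K.+1 ^ 2)%N ->
  [/\ (0 < K)%N, t / 4 <= K%:R, expR t - 3 <= ln (ln K%:R) & ln (ln K%:R) <= expR t].
Proof.
move=> NE t1 KN NK.
have e2 := expR1_ge2 R.
have N4 : (4 <= N)%N.
  rewrite -(ler_nat R) NE.
  have h1 : 2 <= expR t by apply: (le_trans e2); rewrite ler_expR.
  have h2 : 3 <= expR (expR t) by have := expR_ge1Dx (expR t); lra.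
  by have := expR_ge1Dx (expR (expR t)); lra.
have K2 : (1 < K)%N by rewrite ltnNge; apply/negP => K2; move: NK; rewrite -mulnn; nia.
have NK4 : (N <= K ^ 4)%N.
  apply: (leq_trans (ltnW NK)); have -> : (K ^ 4 = K ^ 2 * K ^ 2)%N by rewrite -expnD.
  rewrite -!mulnn; nia.
have K0 : 0 < K%:R :> R by rewrite ltr0n; apply: ltn_trans K2.
have lK4 : expR (expR t) <= 4 * ln K%:R.
  rewrite -ler_expR -NE mulr_natl -lnXn// lnK ?posrE ?exprn_gt0//.
  by rewrite -natrX ler_nat.
(* [N <= K^4] costs a factor 4 in [ln K], at most [exp 3], hence 3 in [ln (ln K)]. *)
have lK : expR (expR t - 3) <= ln K%:R.
  rewrite expRD expRN ler_pdivrMr ?expR_gt0//; apply: (le_trans lK4).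
  rewrite [leLHS]mulrC ler_wpM2l ?ln_ge0 ?ler1n -?(ltr0n R)//.
  by have := expR_ge1Dx (3 : R); lra.
have lK0 : 0 < ln K%:R :> R by apply: lt_le_trans lK; exact: expR_gt0.
split; first by rewrite -(ltr0n R).
- have : ln K%:R <= K%:R - 1 :> R.
    by rewrite -[X in ln X](subrK 1) addrC le_ln1Dx//; lra.
  have := expR_ge1Dx (expR t); have := expR_ge1Dx t; lra.
- by rewrite -ler_expR lnK.
rewrite -ler_expR lnK// -ler_expR lnK// -NE ler_nat.
by apply: leq_trans KN; rewrite -mulnn leq_pmull// -(ltr0n R).
Qed.

Lemma count_markov N K (bad : pred nat) (F G : nat -> R) d : 0 < d -> (K <= N)%N ->
  (forall n, 0 <= F n) -> (forall n, 0 <= G n) ->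
  (forall n, (0 < n <= N)%N -> bad n -> [\/ (n <= K)%N, d < F n | d < G n]) ->
  (\sum_(1 <= n < N.+1 | bad n) 1)%N%:R <=
    K%:R + (\sum_(1 <= n < N.+1) F n) / d + (\sum_(1 <= n < N.+1) G n) / d.
Proof.
move=> d0 KN F0 G0 h.
have Kle : \sum_(1 <= n < N.+1) (n <= K)%N%:R <= K%:R :> R.
  rewrite (@big_cat_nat _ _ _ K.+1)//= [X in _ + X]big_nat_cond [X in _ + X]big1 ?addr0.
    apply: (@le_trans _ _ (\sum_(1 <= n < K.+1) 1)); first by apply: ler_sum => n _; case: (n <= K)%N.
    by rewrite sumr_const_nat subSS subn0.
  by move=> n /andP[/andP[Kn _] _]; rewrite leqNgt Kn.
apply: (@le_trans _ _ (\sum_(1 <= n < N.+1) ((n <= K)%N%:R + F n / d + G n / d))); last first.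
  by rewrite !big_split /= -!mulr_suml !lerD2r.
rewrite natr_sum big_mkcond big_nat_cond [leRHS]big_nat_cond.
apply: ler_sum => n /andP[/andP[n0 nN] _].
have Fd : 0 <= F n / d by rewrite divr_ge0// ltW.
have Gd : 0 <= G n / d by rewrite divr_ge0// ltW.
have nK0 : 0 <= (n <= K)%N%:R :> R by [].
case: ifP => [bn|_]; last by lra.
have n0N : (0 < n <= N)%N by rewrite n0.
have [nK|dF|dG] := h n n0N bn.
- by move: nK0; rewrite nK /=; lra.
- have : 1 <= F n / d by rewrite ler_pdivlMr// mul1r ltW.
  lra.
have : 1 <= G n / d by rewrite ler_pdivlMr// mul1r ltW.
lra.
Qed.

(** The mean is about [log log N / y], with [log log N = exp t] and [y] about [exp ((1 + d) t)]. The
    4 pays for rounding [y], and [330 = 2 * 165] for [1 + exp t <= 2 exp t]. *)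
Lemma sum_large_prime_sum_exp N y B (d t : R) : N%:R = expR (expR (expR t)) -> 0 <= t ->
  (0 < y)%N -> expR t * expR (d * t) / 4 <= y%:R ->
  \sum_(1 <= n < N.+1) large_prime_sum R y B n <= N%:R * (330 * 4) / expR (d * t).
Proof.
move=> NE t0 y0 yE; have Et := expR_gt0 t; have Edt := expR_gt0 (d * t).
have lnN : ln N%:R = expR (expR t) by rewrite NE expRK.
have := @sum_large_prime_sum_le R y B N y0; rewrite lnN expRK => /(_ _)/le_trans; apply.
  by have := expR_ge1Dx (expR t); lra.
have yR : 0 < y%:R :> R by rewrite ltr0n.
rewrite -!mulrA; apply: ler_wpM2l => //.
rewrite mulrA ler_pdivrMr; last exact: yR.
move: yE; move: (expR (d * t)) Edt => E E0 yE.
apply: (@le_trans _ _ (330 * (4 / E) * (expR t * E / 4))); last first.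
  by apply: ler_wpM2l yE; apply: mulr_ge0; last apply: divr_ge0; lra.
rewrite (_ : 330 * (4 / E) * (expR t * E / 4) = 330 * expR t); last by field; lra.
by have := expR_ge1Dx t; lra.
Qed.

(** For [p <= y] the loss [231 p (1 + ln p)] is at most [exp t / 4], and the constant and
    triple-logarithm losses [3 + t] at most [exp t / 2], so [exp t / 4] remains for Turan's
    bound. *)
Lemma sum_missing_prime_sum_exp N K y (d t : R) : N%:R = expR (expR (expR t)) -> 1 <= t ->
  (K ^ 2 <= N)%N -> (N < K.+1 ^ 2)%N -> (0 < y)%N -> ln y%:R <= t ->
  y%:R <= expR t / expR (d * t) -> 231 * (4 * (1 + t)) <= expR (d * t) -> 6 * (1 + t) <= expR t ->
  \sum_(1 <= n < N.+1) missing_prime_sum R y n <= N%:R * 24 / expR (d * t).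
Proof.
move=> NE t1 KN NK y0 ly yE hd ht; have Et := expR_gt0 t; have Edt := expR_gt0 (d * t).
have [_ _ lK1 lK2] := log_log_sqrt NE t1 KN NK.
have L0 : 0 < expR t / 4 by rewrite divr_gt0.
have yR : 1 <= y%:R :> R by rewrite ler1n.
move: (expR (d * t)) Edt hd yE => E E0 hE yE.
have y1t : 231 * (4 * (y%:R * (1 + t))) <= expR t.
  have q0 : 0 <= 231 * (4 * (1 + t)) by apply/mulr_ge0/mulr_ge0; lra.
  have := ler_pM (ler0n R y) q0 yE hE.
  by rewrite divfK ?gt_eqF// mulrCA [y%:R * (4 * _)]mulrCA.
have hp p : prime p -> (p <= y)%N ->
    expR t / 4 <= p%:R * \sum_(q < K.+1 | prime q && (p %| q.+1)%N) q%:R^-1.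
  move=> pp py; have lK3 : 1 <= ln (ln K%:R) :> R by lra.
  apply: le_trans (progression_inv_sum_ge pp lK3).
  have l3 : ln (ln (ln K%:R)) <= t.
    by rewrite -ler_expR lnK ?posrE// (lt_le_trans ltr01).
  have lp : ln p%:R <= t.
    by apply: le_trans ly; rewrite ler_ln ?posrE ?ltr0n ?ler_nat// prime_gt0.
  have lp0 : 0 <= ln p%:R :> R by rewrite ln_ge0// ler1n prime_gt0.
  have : p%:R * (1 + ln p%:R) <= y%:R * (1 + t).
    by apply: ler_pM; rewrite ?ler_nat//; lra.
  rewrite -[231 * _ * _]mulrA; move: (p%:R * (1 + ln p%:R)) (y%:R * (1 + t)) y1t => a b; lra.
apply: (le_trans (sum_missing_prime_sum_le KN L0 hp)).
have -> : 3 * N%:R * y.+1%:R / (expR t / 4) = N%:R * (12 * y.+1%:R) / expR t.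
  by field; rewrite gt_eqF.
rewrite ler_pdivrMr// mulrAC -!mulrA; apply: ler_wpM2l => //.
have -> : 24 * (expR t / E) = 12 * (2 * (expR t / E)) by ring.
by apply: ler_wpM2l => //; rewrite -natr1; lra.
Qed.

Lemma exceptional_le (e eta : R) : 0 < e -> 0 < eta -> exists T : R, forall (N : nat) (t : R),
  T <= t -> N%:R = expR (expR (expR t)) ->
  (\sum_(1 <= n < N.+1 |
    ~~ (`|psi_ratio n - C * iter_ln 3 n%:R| <= e * (C * iter_ln 3 n%:R))%R) 1)%N%:R <= eta * N%:R :> R.
Proof.
move=> e0 eta0.
pose d := Num.min 10^-1 (e / 10).
have d0 : 0 < d by rewrite lt_min invr_gt0 ltr0n divr_gt0.
have d1 : d <= 10^-1 by rewrite ge_min lexx.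
have de : 10 * d <= e.
  by have : d <= e / 10; [rewrite ge_min lexx orbT|lra].
have [Y hY] : exists Y, forall y, (Y <= y)%N ->
    C * ln y%:R * (1 - d) <= M y <= C * ln y%:R * (1 + d).
  by apply: dedekind_mertens_product; rewrite d0/=; lra.
have dc0 : 0 < d * eta by rewrite mulr_gt0.
(* Once [exp (d t) >= A], each of the two mean values, divided by [d] in Markov's inequality, is at
   most [eta N / 3]. *)
pose A : R := 330 * 4 * 3 / (d * eta).
have A0 : 0 <= A by apply: divr_ge0; lra.
have [T1 hT1] := linear_le_expR (231 * 4 + A) d0.
have [T2 hT2] := @linear_le_expR 1 6 ltr01.
(* [d^-1] gives [d * t >= 1]; [2 Y] puts both cutoffs above [Y], as [y1 >= (1 - d) t >= t / 2];
   [12 / eta] gives [K >= t / 4 >= 3 / eta], so that the discarded [n <= K] number at most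
   [eta N / 3]. *)
exists (Num.max (Num.max T1 T2) (Num.max (Num.max d^-1 (2 * Y%:R)) (Num.max 1 (12 / eta)))).
move=> N t; rewrite !ge_max => /and3P[/andP[/hT1 {}hT1 /hT2 {}hT2] /andP[dt Yt] /andP[t1 et]] NE.
rewrite mul1r in hT2; have Et := expR_gt0 t; have Edt := expR_gt0 (d * t).
have EA : A <= expR (d * t).
  apply: le_trans hT1; have At : 0 <= A * t by apply: mulr_ge0; lra.
  by move: A A0 At => a; lra.
have E924 : 231 * (4 * (1 + t)) <= expR (d * t).
  by apply: le_trans hT1; rewrite mulrA; apply: ler_wpM2r; lra.
clear hT1 T1 T2.
have e4 : expR 1 <= 4 :> R.
  have h : expR (2^-1) <= 2 :> R by apply: le_trans (expR_le1D2 _) _; lra.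
  have -> : expR 1 = expR (2^-1) * expR (2^-1) :> R by rewrite -expRD; congr expR; field.
  apply: (@le_trans _ _ (2 * 2)); last by lra.
  by apply: ler_pM => //; exact: expR_ge0.
have /andP[dt0 dt1] : 0 <= d * t <= 10^-1 * t by rewrite mulr_ge0 ?ler_wpM2r//; lra.
have u1 : 0 <= (1 - d) * t by lra.
have u2 : 0 <= (1 + d) * t by lra.
pose y1 := Num.truncn (expR ((1 - d) * t)).
pose y2 := Num.truncn (expR ((1 + d) * t)).
have [y10 y1le y1ge _ /andP[_ ly1]] := truncn_expR u1; rewrite -/y1 in y10 y1le y1ge ly1.
have [y20 _ y2ge y2exp _] := truncn_expR u2; rewrite -/y2 in y20 y2ge y2exp.
have y1E : expR ((1 - d) * t) = expR t / expR (d * t).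
  by rewrite -expRN -expRD; congr expR; ring.
rewrite y1E in y1le.
have y2E : expR t * expR (d * t) / 4 <= y2%:R.
  apply: le_trans y2exp; rewrite (_ : (1 + d) * t - 1 = t + d * t - 1); last by ring.
  by rewrite !expRD expRN ler_pM2l ?mulr_gt0// lef_pV2 ?posrE// expR_gt0.
have /hY/andP[M1 _] : (Y <= y1)%N by rewrite -(ler_nat R); lra.
have /hY/andP[_ M2] : (Y <= y2)%N by rewrite -(ler_nat R); lra.
pose K := Num.truncn (Num.sqrt N%:R : R).
have /andP[K1 K2] := truncn_itv (sqrtr_ge0 (N%:R : R)); rewrite -/K in K1 K2.
have KN : (K ^ 2 <= N)%N.
  by rewrite -(ler_nat R) natrX -[leRHS]sqr_sqrtr// lerXn2r// nnegrE// sqrtr_ge0.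
have NK : (N < K.+1 ^ 2)%N.
  by rewrite -(ltr_nat R) natrX -[ltLHS]sqr_sqrtr// ltrXn2r// nnegrE// sqrtr_ge0.
have [K0 tK _ _] := log_log_sqrt NE t1 KN NK.
have KleN : (K <= N)%N by apply: leq_trans KN; rewrite -mulnn leq_pmull.
pose B := (y2 + \sum_(1 <= n < N.+1) dedekind_psi n)%N.
have psiB n : (0 < n <= N)%N -> (dedekind_psi n <= B)%N.
  move=> nN; apply: leq_trans (leq_addl _ _).
  by rewrite (bigD1_seq n) ?mem_index_iota ?iota_uniq//= leq_addr.
have bad_cases n : (0 < n <= N)%N ->
    ~~ (`|psi_ratio n - C * iter_ln 3 n%:R| <= e * (C * iter_ln 3 n%:R)) ->
    [\/ (n <= K)%N, d < large_prime_sum R y2 B n | d < missing_prime_sum R y1 n].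
  move=> nN bad; have /andP[n0 nN'] := nN.
  have [nK|Kn] := leqP n K; first by constructor 1.
  have [lg|] := leP (large_prime_sum R y2 B n) d; last by constructor 2.
  have [ms|] := leP (missing_prime_sum R y1 n) d; last by constructor 3.
  case/negP: bad; apply: (@psi_ratio_near e d t N n y1 y2 B) => //.
  - by rewrite d0.
  - by apply: leq_trans (ltnW NK) _; rewrite leq_exp2r.
  - exact: psiB.
  - exact: leq_addr.
have ly1t : ln y1%:R <= t by lra.
have t0 : 0 <= t by lra.
have S1 := @sum_large_prime_sum_exp N y2 B d t NE t0 y20 y2E.
have S2 := sum_missing_prime_sum_exp NE t1 KN NK y10 ly1t y1le E924 hT2.
have N0 : 0 < N%:R :> R by rewrite NE expR_gt0.
have EdA : 330 * 4 * 3 <= d * eta * expR (d * t).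
  by move: EA; rewrite /A ler_pdivrMr; [rewrite [expR _ * _]mulrC|exact: dc0].
have small c : c <= 330 * 4 -> N%:R * c / expR (d * t) / d <= eta / 3 * N%:R.
  move=> c4; rewrite ler_pdivrMr// ler_pdivrMr//.
  have := ler_wpM2l (ltW N0) (le_trans (ler_wpM2r (ler0n R 3) c4) EdA).
  lra.
apply: (le_trans (count_markov d0 KleN _ _ bad_cases)) => [n|n|].
- by apply: sumr_ge0 => q _; rewrite invr_ge0.
- by apply: sumr_ge0 => q _; rewrite invr_ge0.
have part1 : K%:R <= eta / 3 * N%:R.
  have KK : K%:R * K%:R <= N%:R :> R by rewrite -natrM ler_nat mulnn.
  have KR : 0 < K%:R :> R by rewrite ltr0n.
  move: et tK KK KR; clear -eta0 t1; rewrite ler_pdivrMr// => et tK KK KR.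
  have : 3 <= eta * K%:R by nra.
  by nra.
have part2 : (\sum_(1 <= n < N.+1) large_prime_sum R y2 B n) / d <= eta / 3 * N%:R.
  by apply: le_trans (small _ (lexx _)); rewrite ler_pM2r ?invr_gt0.
have part3 : (\sum_(1 <= n < N.+1) missing_prime_sum R y1 n) / d <= eta / 3 * N%:R.
  have c24 : 24 <= 330 * 4 :> R by rewrite -natrM ler_nat.
  by apply: le_trans (small _ c24); rewrite ler_pM2r ?invr_gt0.
move: part1 part2 part3; clear.
by move: (_ / d) (_ / d) => a b; lra.
Qed.

End Assembly.

Unset Implicit Arguments.

Theorem theorem1p2 (R : realType) :
  normal_order
    (fun n : nat => (dedekind_psi (dedekind_psi n))%:R / (dedekind_psi n)%:R)
    (fun n : nat => 6 * expR (euler_gamma R) / pi ^+ 2 * iter_ln 3 n%:R).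
Proof.
move=> e e0; apply/cvgrPdist_le => eta eta0.
have [T hT] := exceptional_le e0 eta0.
near=> x.
have x1 : expR (expR (expR T)) + 1 <= x by near: x; exact: nbhs_pinfty_ge.
have E0 := expR_gt0 (expR (expR T)).
have x0 : 0 < x by lra.
have /andP[N1 N2] := truncn_itv (ltW x0).
rewrite sub0r normrN ger0_norm ?divr_ge0 ?(ltW x0)// ler_pdivrMr//.
(* The count depends only on the integer part [N] of [x], and a large [N] has the form required by
   [exceptional_le] with [t = ln (ln (ln N))]. *)
apply: (@le_trans _ _ (eta * (Num.truncn x)%:R)); last by rewrite ler_wpM2l// ltW.
move: N1 N2; rewrite /exceptional_count -natr1; move: (Num.truncn x) => N N1 N2.
have NT : expR (expR (expR T)) <= N%:R by lra.
have l1 : expR (expR T) <= ln N%:R.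
  by rewrite -ler_expR lnK// posrE; exact: lt_le_trans NT.
have l2 : expR T <= ln (ln N%:R).
  by rewrite -ler_expR lnK// posrE; apply: lt_le_trans l1; exact: expR_gt0.
have l3 : T <= ln (ln (ln N%:R)).
  by rewrite -ler_expR lnK// posrE; apply: lt_le_trans l2; exact: expR_gt0.
apply: (hT N _ l3).
rewrite !lnK// posrE.
- exact: lt_le_trans NT.
- by apply: lt_le_trans l1; exact: expR_gt0.
by apply: lt_le_trans l2; exact: expR_gt0.
Unshelve. all: by end_near. Qed.
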